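(* Let $(u_{PP},p_{PP})$ and $(u_\varepsilon,p_\varepsilon)$ ($\varepsilon>0$) be the solutions of problems (PP') and (ES') defined in the context. There exists a constant $c>0$ independent of $\varepsilon>0$ such that $$\|u_\varepsilon-u_{PP}\|_{H^1(\Omega)^n}\le\frac{c}{\varepsilon}\|\operatorname{div}u_{PP}\|_{Q^*},\qquad\|p_\varepsilon-p_{PP}\|_{H^1(\Omega)}\le\frac{c}{\varepsilon}\|\operatorname{div}u_{PP}\|_{Q^*}$$ for all $\varepsilon>0$. In particular, $\|u_\varepsilon-u_{PP}\|_{H^1(\Omega)^n}\to0$ and $\|p_\varepsilon-p_{PP}\|_{H^1(\Omega)}\to0$ as $\varepsilon\to\infty$.
   Context: $n\ge2$ is an integer and $\Omega\subset\mathbb{R}^n$ is a bounded domain with Lipschitz continuous boundary $\Gamma$ and unit outward normal $\nu$. $\gamma_0:H^1(\Omega)\to H^{1/2}(\Gamma)$ is the trace operator, applied componentwise to vector fields. $\nabla u:\nabla\varphi:=\sum_i\frac{\partial u}{\partial x_i}\cdot\frac{\partial\varphi}{\partial x_i}$. $Q\subset H^1(\Omega)$ is a closed subspace for which there is a constant $c>0$ with $\|q\|_{L^2(\Omega)}\le c\|\nabla q\|_{L^2(\Omega)^n}$ for all $q\in Q$; its dual $Q^*$ has the norm $\|f\|_{Q^*}:=\sup\{\langle f,\psi\rangle:\psi\in Q,\ \|\nabla\psi\|_{L^2(\Omega)^n}=1\}$, and a function $h\in L^2(\Omega)$ is regarded as the element $\psi\mapsto\int_\Omega h\psi$ of $Q^*$.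 The data are $F\in L^2(\Omega)^n$, $u_b\in H^{1/2}(\Gamma)^n$ with $\int_\Gamma u_b\cdot\nu=0$, $p_b\in H^1(\Omega)$ and $G\in Q^*$. Each of the following problems has a unique solution. (PP'): $(u_{PP},p_{PP})\in H^1(\Omega)^n\times H^1(\Omega)$ with $\int_\Omega\nabla u_{PP}:\nabla\varphi+\int_\Omega\nabla p_{PP}\cdot\varphi=\int_\Omega F\cdot\varphi$ for all $\varphi\in H^1_0(\Omega)^n$, $\int_\Omega\nabla p_{PP}\cdot\nabla\psi=\langle G,\psi\rangle$ for all $\psi\in Q$, $\gamma_0u_{PP}=u_b$, $p_{PP}-p_b\in Q$. (ES') for $\varepsilon>0$: $(u_\varepsilon,p_\varepsilon)\in H^1(\Omega)^n\times H^1(\Omega)$ with $\int_\Omega\nabla u_\varepsilon:\nabla\varphi+\int_\Omega\nabla p_\varepsilon\cdot\varphi=\int_\Omega F\cdot\varphi$ for all $\varphi\in H^1_0(\Omega)^n$, $\varepsilon\int_\Omega\nabla p_\varepsilon\cdot\nabla\psi+\int_\Omega(\operatorname{div}u_\varepsilon)\psi=\varepsilon\langle G,\psi\rangle$ for all $\psi\in Q$, $\gamma_0u_\varepsilon=u_b$, $p_\varepsilon-p_b\in Q$. *)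

(* Defs.v *)
From HB Require Import structures.
From mathcomp Require Import all_boot all_order all_algebra.
From mathcomp Require Import all_classical all_reals all_analysis.

Set Implicit Arguments.
Unset Strict Implicit.
Unset Printing Implicit Defensive.

Import Order.TTheory GRing.Theory Num.Theory.
Import numFieldNormedType.Exports.

Local Open Scope classical_set_scope.
Local Open Scope ring_scope.

Definition row_display : measure_display. Proof. exact. Qed.

Section row_measurable.
Variables (R : realType) (n : nat).

Let coord (i : 'I_n) (x : 'rV[R]_n) : R := x ord0 i.

Let row_set0 : g_sigma_preimage coord set0.
Proof. exact: sigma_algebra0. Qed.

Let row_setC A : g_sigma_preimage coord A -> g_sigma_preimage coord (~` A).
Proof. exact: sigma_algebraC. Qed.

Let row_bigcup (F : (set 'rV[R]_n)^nat) :
  (forall i, g_sigma_preimage coord (F i)) ->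
  g_sigma_preimage coord (\bigcup_i F i).
Proof. exact: sigma_algebra_bigcup. Qed.

HB.instance Definition _ := @isMeasurable.Build row_display
  'rV[R]_n (g_sigma_preimage coord) row_set0 row_setC row_bigcup.

Lemma measurable_coord (i : 'I_n) :
  measurable_fun [set: 'rV[R]_n] (fun x => x ord0 i).
Proof.
move=> _ Y mY; rewrite setTI; apply: sub_sigma_algebra => /=.
rewrite -bigcup_seq/=; exists i => /=; first by rewrite mem_index_enum.
by exists Y => //; rewrite setTI.
Qed.

Lemma measurable_fun_row d (T : measurableType d) (f : T -> 'rV[R]_n) :
  (forall i, measurable_fun [set: T] (fun t => f t ord0 i)) ->
  measurable_fun [set: T] f.
Proof.
move=> mf _ A; rewrite setTI.
suff H : g_sigma_preimage coord `<=` [set B | measurable (f @^-1` B)] by exact: H.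
apply: smallest_sub.
  split => /= [|B mB|F mF].
  - by rewrite preimage_set0.
  - by rewrite setTD preimage_setC; exact: measurableC.
  - by rewrite preimage_bigcup; exact: bigcupT_measurable.
move=> B; rewrite -bigcup_seq => -[i _ [C mC <-]] /=.
by rewrite setTI -[X in measurable X]setTI; exact: (mf i).
Qed.

End row_measurable.

Section lebesgue_row.
Variable R : realType.

Definition row_cons n (tv : R * 'rV[R]_n) : 'rV[R]_n.+1 :=
  row_mx (const_mx (tv.1) : 'rV[R]_1) tv.2.

Lemma row_cons0 n (tv : R * 'rV[R]_n) : row_cons tv ord0 ord0 = tv.1.
Proof.
rewrite [LHS](_ : _ = row_cons tv ord0 (lshift n (ord0 : 'I_1))); last first.
  by congr (row_cons _ _ _); exact: val_inj.
by rewrite [LHS]row_mxEl mxE.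
Qed.

Lemma row_consS n (tv : R * 'rV[R]_n) i :
  row_cons tv ord0 (lift ord0 i) = tv.2 ord0 i.
Proof.
rewrite [LHS](_ : _ = row_cons tv ord0 (rshift 1 i)); last first.
  by congr (row_cons _ _ _); exact: val_inj.
by rewrite [LHS]row_mxEr.
Qed.

Lemma measurable_row_cons n :
  measurable_fun [set: R * 'rV[R]_n] (@row_cons n).
Proof.
apply: measurable_fun_row => i; case: (unliftP ord0 i) => [j|] ->.
  under eq_fun do rewrite row_consS.
  exact: (measurableT_comp (measurable_coord j) measurable_snd).
by under eq_fun do rewrite row_cons0; exact: measurable_fst.
Qed.

Definition row_uncons n (x : 'rV[R]_n.+1) : R * 'rV[R]_n :=
  (x ord0 ord0, \row_i x ord0 (lift ord0 i)).

Lemma row_consK n : cancel (@row_cons n) (@row_uncons n).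
Proof.
move=> tv; rewrite /row_uncons row_cons0 [RHS]surjective_pairing.
by congr pair; apply/rowP => i; rewrite mxE row_consS.
Qed.

Lemma measurable_row_uncons n :
  measurable_fun [set: 'rV[R]_n.+1] (@row_uncons n).
Proof.
apply/measurable_fun_pairP; split; first exact: measurable_coord.
apply: measurable_fun_row => i; rewrite /comp /=.
by under eq_fun do rewrite mxE; exact: measurable_coord.
Qed.

Section step.
Variables (n : nat)
  (mu : {sigma_finite_measure set 'rV[R]_n -> \bar R}).

Definition lebesgue_row_step : set 'rV[R]_n.+1 -> \bar R :=
  pushforward (@lebesgue_measure R \x mu)%E (@row_cons n).

Let pm : {measure set 'rV[R]_n.+1 -> \bar R} :=
  measure_function_pushforward__canonical__measure_function_Measure
    (@lebesgue_measure R \x mu)%E (@measurable_row_cons n).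

HB.instance Definition _ := isMeasure.Build _ _ _ lebesgue_row_step
  (measure0 pm) (measure_ge0 pm) (@measure_semi_sigma_additive _ _ _ pm).

Let lebesgue_row_step_sigma_finite : sigma_finite setT lebesgue_row_step.
Proof.
have /sigma_finiteP[F [TF ndF Foo]] := sigma_finiteT (@lebesgue_measure R).
have /sigma_finiteP[G [TG ndG Goo]] := sigma_finiteT mu.
exists (fun k => @row_uncons n @^-1` (F k `*` G k)).
  rewrite -preimage_bigcup (_ : \bigcup_k _ = setT) ?preimage_setT//.
  rewrite -subTset => -[x y] _.
  have [i _ Fix] : (\bigcup_i F i) x by rewrite -TF.
  have [j _ Gjy] : (\bigcup_i G i) y by rewrite -TG.
  exists (maxn i j) => //; split => /=.
  - by move: x Fix; exact/subsetPset/ndF/leq_maxl.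
  - by move: y Gjy; exact/subsetPset/ndG/leq_maxr.
move=> k; have [? ?] := Foo k; have [? ?] := Goo k; split.
  rewrite -[X in measurable X]setTI; apply: measurable_row_uncons => //.
  exact: measurableX.
rewrite /lebesgue_row_step /pushforward -comp_preimage.
rewrite (_ : @row_uncons n \o @row_cons n = id) ?preimage_id; last first.
  by apply/funext => tv; exact: row_consK.
by rewrite product_measure1E// lte_mul_pinfty// ge0_fin_numE.
Qed.

HB.instance Definition _ := @Measure_isSigmaFinite.Build _ _ _
  lebesgue_row_step lebesgue_row_step_sigma_finite.

End step.

Definition lebesgue_row : forall n, {sigma_finite_measure set 'rV[R]_n -> \bar R} :=
  nat_rect (fun n => {sigma_finite_measure set 'rV[R]_n -> \bar R})
    (\d_ (0 : 'rV[R]_0))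
    (fun n mu => lebesgue_row_step mu).

End lebesgue_row.

Definition dot (R : realType) n (x y : 'rV[R]_n) : R :=
  \sum_i x ord0 i * y ord0 i.

(* The norm [`|x|] that the library puts on ['rV[R]_n] is the sup norm. *)
Definition enorm (R : realType) n (x : 'rV[R]_n) : R := Num.sqrt (dot x x).

Section hausdorff.
Variables (R : realType) (n k : nat).
Local Open Scope ereal_scope.

Definition diam (E : set 'rV[R]_n) : \bar R :=
  ereal_sup [set (enorm (x - y))%:E | x in E & y in E].

Definition hausdorff_gauge (delta : R) (E : set 'rV[R]_n) : \bar R :=
  if E == set0 then 0
  else if diam E <= delta%:E then diam E ^+ k else +oo.

(* [mu_ext] is the infimum, over countable Borel covers, of the sum of the
   gauges.  There is no normalizing factor: on a [k]-dimensional Lipschitz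
   surface this is a positive constant, depending on [k] only, times the usual
   surface measure. *)
Definition hausdorff (A : set 'rV[R]_n) : \bar R :=
  ereal_sup [set mu_ext (hausdorff_gauge delta) A
            | delta in [set delta : R | (0 < delta)%R]].

Let gauge0 delta : hausdorff_gauge delta set0 = 0.
Proof. by rewrite /hausdorff_gauge eqxx. Qed.

Let gauge_ge0 delta E : 0 <= hausdorff_gauge delta E.
Proof.
rewrite /hausdorff_gauge; case: ifPn => // /set0P[x Ex].
case: ifPn => // _; apply: expe_ge0.
apply: le_ereal_sup_tmp; exists (enorm (x - x))%:E; first by exists x => //; exists x.
by rewrite lee_fin sqrtr_ge0.
Qed.

Let hausdorff0 : hausdorff set0 = 0.
Proof.
apply/eqP; rewrite eq_le; apply/andP; split.
  apply: ge_ereal_sup => _ [delta _ <-].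
  by rewrite (mu_ext0 (gauge0 delta) (gauge_ge0 delta)).
apply: le_ereal_sup_tmp; exists (mu_ext (hausdorff_gauge 1) set0).
  by exists 1%R => //=; exact: ltr01.
exact: (mu_ext_ge0 (gauge_ge0 _)).
Qed.

Let hausdorff_ge0 A : 0 <= hausdorff A.
Proof.
apply: le_ereal_sup_tmp; exists (mu_ext (hausdorff_gauge 1) A).
  by exists 1%R => //=; exact: ltr01.
exact: (mu_ext_ge0 (gauge_ge0 _)).
Qed.

Let le_hausdorff : {homo hausdorff : A B / A `<=` B >-> A <= B}.
Proof.
move=> A B AB; apply: ge_ereal_sup => _ [delta d0 <-].
apply: (le_trans (le_mu_ext (hausdorff_gauge delta) AB)).
by apply: ereal_sup_ubound; exists delta.
Qed.

Let hausdorff_sigma_subadditive : sigma_subadditive hausdorff.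
Proof.
move=> F; apply: ge_ereal_sup => _ [delta d0 <-].
apply: (le_trans (mu_ext_sigma_subadditive (gauge_ge0 delta) F)).
apply: lee_nneseries => i *; first exact: (mu_ext_ge0 (gauge_ge0 _)).
by apply: ereal_sup_ubound; exists delta.
Qed.

HB.instance Definition _ := isOuterMeasure.Build R 'rV[R]_n hausdorff
  hausdorff0 hausdorff_ge0 le_hausdorff hausdorff_sigma_subadditive.

End hausdorff.
Arguments hausdorff {R n} k A.

Section surface_measure.
Variables (R : realType) (n : nat).

Let mu : {outer_measure set 'rV[R]_n -> \bar R} := @hausdorff R n n.-1.

Definition surface_measure :
    set (caratheodory_type (@hausdorff R n n.-1)) -> \bar R :=
  @hausdorff R n n.-1.

HB.instance Definition _ := isMeasure.Build _ _ _ surface_measure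
  (@caratheodory_measure0 R 'rV[R]_n mu)
  (@caratheodory_measure_ge0 R 'rV[R]_n mu)
  (@caratheodory_measure_sigma_additive R 'rV[R]_n mu).

End surface_measure.
Arguments surface_measure : clear implicits.

Section domains.
Variables (R : realType) (n : nat).
Implicit Types (Omega : set 'rV[R]_n).

Definition boundary Omega : set 'rV[R]_n := closure Omega `\` Omega°.

(* In Cartesian coordinates whose last axis is [e], [Omega] is locally the
   strict epigraph of a Lipschitz function of the other coordinates; [g] is
   only evaluated on the hyperplane orthogonal to [e]. *)
Definition lipschitz_boundary Omega : Prop :=
  forall x0, boundary Omega x0 ->
  exists (r L : R) (e : 'rV[R]_n) (g : 'rV[R]_n -> R),
    [/\ 0 < r, enorm e = 1,
        forall y z, `|g y - g z| <= L * enorm (y - z) &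
        forall x, enorm (x - x0) < r ->
          (Omega x <-> g (x - dot x e *: e) < dot x e)].

Definition bounded_lipschitz_domain Omega : Prop :=
  [/\ open Omega, connected Omega, Omega !=set0, bounded_set Omega &
      lipschitz_boundary Omega].

(* At [x], the blow-ups of [Omega] converge to the half-space
   [y | dot y nu < 0].  On a Lipschitz boundary this determines [nu] at
   almost every point. *)
Definition outward_unit_normal_at Omega (x nu : 'rV[R]_n) : Prop :=
  enorm nu = 1 /\
  forall eps : R, 0 < eps -> exists2 r : R, 0 < r &
    forall y, enorm (y - x) < r ->
      (dot (y - x) nu < - eps * enorm (y - x) -> Omega y) /\
      (eps * enorm (y - x) < dot (y - x) nu -> ~ Omega y).

Definition outward_unit_normal Omega (nu : 'rV[R]_n -> 'rV[R]_n) : Prop :=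
  {ae surface_measure R n, forall x, boundary Omega x ->
    outward_unit_normal_at Omega x (nu x)}.

End domains.

Section smooth.
Variables (R : realType) (n : nat).
Implicit Types (f : 'rV[R]_n -> R).

Definition partial (i : 'I_n) f : 'rV[R]_n -> R :=
  fun x => 'D_(delta_mx ord0 i) f x.

Fixpoint Ck (k : nat) f : Prop :=
  if k is k'.+1 then
    continuous f /\
    forall i, (forall x, derivable f x (delta_mx ord0 i)) /\ Ck k' (partial i f)
  else continuous f.

Definition smooth f : Prop := forall k, Ck k f.

Definition test_function (Omega : set 'rV[R]_n) f : Prop :=
  let supp := closure [set x | f x != 0] in
  [/\ smooth f, compact supp & supp `<=` Omega].

End smooth.

Definition L2 d (T : measurableType d) (R : realType)
    (mu : {measure set T -> \bar R}) (D : set T) (f : T -> R) : Prop :=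
  measurable_fun D f /\ mu.-integrable D (EFin \o (fun x => f x ^+ 2)).

(* An element of [H^1(Omega)] is represented by the pair of a function and of
   its weak gradient, and an [H^1] vector field by its components.  Functions
   equal almost everywhere are not identified; all the notions below are
   insensitive to null sets. *)
Notation sobolev R n :=
  (('rV[R]_n -> R) * ('I_n -> 'rV[R]_n -> R))%type.

Section sobolev.
Variables (R : realType) (n : nat) (Omega : set 'rV[R]_n).
Local Notation V := 'rV[R]_n.
Local Notation lambda := (lebesgue_row R n).
Local Notation sigma := (surface_measure R n).
Local Notation Gamma := (boundary Omega).
Implicit Types (f : V -> R) (u v : sobolev R n).

Definition weak_partial (i : 'I_n) f g : Prop :=
  forall phi, test_function Omega phi ->
    \int[lambda]_(x in Omega) (f x * partial i phi x) =
    - \int[lambda]_(x in Omega) (g x * phi x).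

Definition H1 : set (sobolev R n) :=
  [set u | L2 lambda Omega u.1 /\
           forall i, L2 lambda Omega (u.2 i) /\ weak_partial i u.1 (u.2 i)].

Definition l2norm f : R := Num.sqrt (\int[lambda]_(x in Omega) f x ^+ 2).

Definition grad_norm u : R := Num.sqrt (\sum_i l2norm (u.2 i) ^+ 2).

Definition h1norm u : R := Num.sqrt (l2norm u.1 ^+ 2 + grad_norm u ^+ 2).

Definition h1vnorm (u : 'I_n -> sobolev R n) : R :=
  Num.sqrt (\sum_j h1norm (u j) ^+ 2).

Definition of_smooth f : sobolev R n := (f, fun i => partial i f).

Definition H10 : set (sobolev R n) :=
  [set u | H1 u /\ exists2 s : nat -> V -> R,
      (forall k, test_function Omega (s k)) &
      h1norm (of_smooth (s k) - u) @[k --> \oo] --> 0].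

(* [has_trace u g] states that the trace of [u] is [g]: the trace operator is
   the continuous extension to [H^1(Omega)], with values in [L^2(Gamma)], of
   the restriction to [Gamma] of the functions smooth up to the boundary. *)
Definition has_trace u (g : V -> R) : Prop :=
  L2 sigma Gamma g /\
  exists s : nat -> V -> R,
    [/\ forall k, smooth (s k),
        h1norm (of_smooth (s k) - u) @[k --> \oo] --> 0 &
        (\int[sigma]_(x in Gamma) ((s k x - g x) ^+ 2)%:E)%E
          @[k --> \oo] --> 0%E].

(* [H^(1/2)(Gamma)] is the range of the trace operator. *)
Definition H12 : set (V -> R) :=
  [set g | exists2 u, H1 u & has_trace u g].

Definition divergence (u : 'I_n -> sobolev R n) : V -> R :=
  fun x => \sum_i (u i).2 i x.

Definition closed_subspace (Q : set (sobolev R n)) : Prop :=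
  [/\ Q `<=` H1, Q 0,
      forall (a : R) q q', Q q -> Q q' -> Q (a *: q + q') &
      forall (s : nat -> sobolev R n) q, (forall k, Q (s k)) -> H1 q ->
        h1norm (s k - q) @[k --> \oo] --> 0 -> Q q].

Definition poincare (Q : set (sobolev R n)) : Prop :=
  exists2 c : R, 0 < c & forall q, Q q -> l2norm q.1 <= c * grad_norm q.

Definition dual (Q : set (sobolev R n)) (G : sobolev R n -> R) : Prop :=
  (forall (a : R) q q', Q q -> Q q' -> G (a *: q + q') = a * G q + G q') /\
  exists C : R, forall q, Q q -> `|G q| <= C * grad_norm q.

(* [sup] is real-valued, and [0] on the empty set, that is when [Q] is zero. *)
Definition dual_norm (Q : set (sobolev R n)) (G : sobolev R n -> R) : R :=
  sup [set G q | q in [set q | Q q /\ grad_norm q = 1]].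

Definition pairing (h : V -> R) : sobolev R n -> R :=
  fun q => \int[lambda]_(x in Omega) (h x * q.1 x).

End sobolev.

Section problems.
Variables (R : realType) (n : nat) (Omega : set 'rV[R]_n).
Local Notation V := 'rV[R]_n.
Local Notation lambda := (lebesgue_row R n).
Variables (Q : set (sobolev R n)) (F u_b : 'I_n -> V -> R)
  (p_b : sobolev R n) (G : sobolev R n -> R).
Implicit Types (u : 'I_n -> sobolev R n) (p : sobolev R n).

Definition momentum_equation u p : Prop :=
  forall phi : 'I_n -> sobolev R n, (forall j, H10 Omega (phi j)) ->
    \int[lambda]_(x in Omega) (\sum_i \sum_j (u j).2 i x * (phi j).2 i x) +
    \int[lambda]_(x in Omega) (\sum_j p.2 j x * (phi j).1 x) =
    \int[lambda]_(x in Omega) (\sum_j F j x * (phi j).1 x).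

Definition boundary_conditions u p : Prop :=
  (forall j, has_trace Omega (u j) (u_b j)) /\ Q (p - p_b).

Definition grad_pairing p : sobolev R n -> R :=
  fun psi => \int[lambda]_(x in Omega) (\sum_i p.2 i x * psi.2 i x).

Definition PP_solution u p : Prop :=
  [/\ forall j, H1 Omega (u j), H1 Omega p, momentum_equation u p,
      forall psi, Q psi -> grad_pairing p psi = G psi &
      boundary_conditions u p].

Definition ES_solution (eps : R) u p : Prop :=
  [/\ forall j, H1 Omega (u j), H1 Omega p, momentum_equation u p,
      forall psi, Q psi ->
        eps * grad_pairing p psi + pairing Omega (divergence u) psi =
        eps * G psi &
      boundary_conditions u p].

End problems.

(* Main.v *)
(* The difference w = u_eps - u_PP has zero trace, hence lies in H^1_0.  Testing
   the momentum equations with w and the mass equations with r = p_eps - p_PP,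
   and integrating by parts, gives
     |grad w|^2 = - (grad r, w) = (r, div w),
     eps |grad r|^2 + (r, div w) = - <div u_PP, r>,
   so that eps |grad r| <= |div u_PP|_{Q*}, and |grad w| is bounded by |grad r|
   thanks to the Poincare inequality on H^1_0.

   A function w of H^1 with zero trace lies in H^1_0: it is approximated in H^1
   by smooth functions s that are small in L^2(Gamma), and s is multiplied by a
   cut-off function which vanishes near Gamma, is 1 away from the strip of width
   O(h) along Gamma, and has gradient O(1/h).  The error is controlled by
     int_{strip h} s^2 <= C (h int_Gamma s^2 + h^2 int_{strip Ch} |grad s|^2),
   which is proved in Lipschitz charts by integrating along the axis of the chart;
   the projection on Gamma along that axis is compared with Hausdorff measure by
   covering. *)
Require Import Defs.
From mathcomp Require Import all_boot all_order all_algebra.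
From mathcomp Require Import all_classical all_reals all_analysis.
From mathcomp Require Import measurable_realfun ring lra zify.
Import Order.TTheory GRing.Theory Num.Theory.
Import numFieldNormedType.Exports.
Local Open Scope classical_set_scope.
Local Open Scope ring_scope.
Set Implicit Arguments.
Unset Strict Implicit.
Unset Printing Implicit Defensive.

(** * Lebesgue measure on row vectors *)

(** The obstacle is that a trace is known only through approximation in [L^2(Gamma)], whereas the
    weak formulation accepts only limits of test functions. The cut-off produces a term [h^-2] times
    the integral of [s^2] over the strip, and the strip inequality has just the powers of [h] that
    turn it into [h^-1] times the boundary integral plus the gradient energy of [s] near [Gamma].
    The latter is small because that of [w] is; hence [h] is fixed first, and [s] is chosen
    afterwards with a boundary integral small compared with [h]. Only one inequality between
    Lebesgue and Hausdorff measure is needed: a tube is bounded by a constant times its height times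
    the measure of its base. Neither the area formula nor rectifiability enters. Integration along
    the axis of a chart rests on translation invariance, without any change of coordinates. *)

Section row_measure.
Variables (R : realType).

Lemma row_norm_le n (x : 'rV[R]_n) (r : R) : 0 <= r ->
  (`|x| <= r) = [forall i, `|x ord0 i| <= r].
Proof.
move=> r0; rewrite [`|x|]mx_normrE; apply/bigmax_leP/forallP.
  by move=> [_ h] i; apply: (h (ord0, i)).
by move=> h; split=> // -[i j] _ /=; rewrite ord1; exact: h.
Qed.

Lemma row_norm_coord n (x : 'rV[R]_n) i : `|x ord0 i| <= `|x|.
Proof. by move: (lexx `|x|); rewrite {1}row_norm_le// => /forallP. Qed.

Lemma row_norm_lt n (x : 'rV[R]_n) (r : R) : 0 < r ->
  (forall i, `|x ord0 i| < r) -> `|x| < r.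
Proof.
move=> r0 h; rewrite [`|x|]mx_normrE; apply/bigmax_ltP; split=> // -[i j] _ /=.
by rewrite ord1.
Qed.

Lemma measurable_row_ball n (x : 'rV[R]_n) (r : R) :
  measurable [set y : 'rV[R]_n | `|y - x| < r].
Proof.
have [r0|r0] := leP r 0.
  rewrite (_ : mkset _ = set0)//; apply/seteqP; split => //= y.
  by move=> /lt_le_trans /(_ r0); rewrite normr_lt0.
rewrite (_ : mkset _ = \bigcap_(i in [set: 'I_n])
    ((fun y : 'rV[R]_n => y ord0 i) @^-1` `]x ord0 i - r, x ord0 i + r[)).
  apply: fin_bigcap_measurable; first exact: finite_finset.
  by move=> i _; rewrite -[X in measurable X]setTI; exact: measurable_coord.
apply/seteqP; split => [y /= yr i _ /=|y /= h].
  have := le_lt_trans (row_norm_coord (y - x) i) yr.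
  by rewrite !mxE in_itv /= ltr_norml => /andP[h1 h2]; apply/andP; split; lra.
apply: row_norm_lt => // i; have := h i Logic.I; rewrite /= in_itv/= !mxE.
by move=> /andP[h1 h2]; rewrite ltr_norml; apply/andP; split; lra.
Qed.

(** The sigma-algebra is generated by the coordinates, so [U] is written as a countable union of
    sup-norm balls, which are boxes, with rational centres and radii [1 / (p + 1)]. Balls not
    contained in [U] are replaced by [set0], which keeps the index type countable. *)
Lemma open_measurable_row n (U : set 'rV[R]_n) : open U -> measurable U.
Proof.
move=> oU.
pose B (p : 'rV[rat]_n * nat) : set 'rV[R]_n :=
  [set y | `|y - map_mx ratr p.1| < p.2.+1%:R^-1].
have -> : U = \bigcup_(p in [set: 'rV[rat]_n * nat])
    (if asbool (B p `<=` U) then B p else set0).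
  apply/seteqP; split=> [x Ux|x [p _]]; last by case: asboolP => // h; exact: h.
  have : nbhs x U by exact: open_nbhs_nbhs.
  move=> /nbhs_ballP[e /= e0 xeU].
  (* With a radius below [e / 2], a ball that contains [x] has all its points within [e] of [x]. *)
  have e20 : 0 < e / 2 by lra.
  have [k _ /(_ k (leqnn k)) /= ke] := near_infty_natSinv_lt (PosNum e20).
  have k0 : 0 < k.+1%:R^-1 :> R by [].
  set d : R := k.+1%:R^-1 in ke k0.
  have /choice[q qP] : forall i, exists q : rat, `|x ord0 i - ratr q| < d.
    move=> i; have [|q] := @rat_in_itvoo R (x ord0 i - d) (x ord0 i + d); first lra.
    rewrite in_itv/= => /andP[h1 h2]; exists q; rewrite ltr_norml; apply/andP; split; lra.
  pose p : 'rV[rat]_n := \row_i q i.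
  have xp : `|x - map_mx ratr p| < d.
    by apply: row_norm_lt => // i; rewrite !mxE; exact: qP.
  exists (p, k) => //; case: asboolP => [_ //|]; case => y /= yB; apply: xeU.
  rewrite -ball_normE /=.
  rewrite (_ : x - y = (x - map_mx ratr p) - (y - map_mx ratr p)); last first.
    by rewrite opprB addrA subrK.
  rewrite (le_lt_trans (ler_normB _ _))//; have ke' : d < e / 2 by []; have yB' : `|y - map_mx ratr p| < d by []; lra.
apply: countable_bigcupT_measurable; first exact: countableP.
by move=> p; case: asboolP => // _; exact: measurable_row_ball.
Qed.

Lemma closed_measurable_row n (U : set 'rV[R]_n) : closed U -> measurable U.
Proof.
by move=> cU; rewrite -(setCK U); apply: measurableC; apply: open_measurable_row; rewrite openC.
Qed.

Lemma continuous_measurable_row n (f : 'rV[R]_n -> R) :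
  continuous f -> measurable_fun [set: 'rV[R]_n] f.
Proof.
move=> cf mD; apply: (measurability _ (measurable_realfun.RGenOInfty.measurableE R)) => //.
move=> _ [_ [a ->] <-]; rewrite setTI; apply: open_measurable_row.
by apply: open_comp => //; exact: interval_open.
Qed.

Lemma continuous_measurable_row_fun n m (f : 'rV[R]_n -> 'rV[R]_m) :
  continuous f -> measurable_fun [set: 'rV[R]_n] f.
Proof.
move=> cf; apply: (@measurable_fun_row R m _ _ f) => i; apply: continuous_measurable_row.
by move=> x; apply: (@continuous_comp _ _ _ f (fun v : 'rV[R]_m => v ord0 i)); [exact: cf|exact: (@coord_continuous R 1 m ord0 i)].
Qed.

(** Stated coordinate by coordinate, and not through the norm, so that it splits as an interval
    times a smaller cube under [row_cons]. *)
Definition row_cube n (a : 'rV[R]_n) (r : R) : set 'rV[R]_n :=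
  [set y | forall i, `|y ord0 i - a ord0 i| <= r].

Lemma measurable_row_cube n (a : 'rV[R]_n) (r : R) : measurable (row_cube a r).
Proof.
rewrite (_ : row_cube _ _ = \bigcap_(i in [set: 'I_n])
    ((fun y : 'rV[R]_n => y ord0 i) @^-1` `[a ord0 i - r, a ord0 i + r])).
  apply: fin_bigcap_measurable; first exact: finite_finset.
  by move=> i _; rewrite -[X in measurable X]setTI; exact: measurable_coord.
apply/seteqP; split => [y /= yr i _ /=|y /= h i].
  have := yr i; rewrite in_itv/= ler_norml => /andP[h1 h2]; apply/andP; split; lra.
have := h i Logic.I; rewrite /= in_itv/=.
by move=> /andP[h1 h2]; rewrite ler_norml; apply/andP; split; lra.
Qed.

Lemma lebesgue_row_cube n (a : 'rV[R]_n) (r : R) : 0 <= r ->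
  (lebesgue_row R n (row_cube a r) <= ((2 * r) ^+ n)%:E)%E.
Proof.
move=> r0; elim: n a => [|n ih] a.
  rewrite /lebesgue_row /= expr0 diracE; case: (_ \in _) => //=; by rewrite lee_fin ler01.
have -> : lebesgue_row R n.+1 (row_cube a r) =
  (@lebesgue_measure R \x lebesgue_row R n)%E
   (`[a ord0 ord0 - r, a ord0 ord0 + r]%classic `*`
    row_cube (\row_j a ord0 (lift ord0 j)) r).
  rewrite /lebesgue_row /= /lebesgue_row_step /pushforward; congr (_ _).
  apply/seteqP; split=> -[t y] /=.
    move=> h; split.
      have := h ord0; rewrite row_cons0 /= in_itv/= ler_norml => /andP[h1 h2]; apply/andP; split; lra.
    by move=> i; have := h (lift ord0 i); rewrite row_consS mxE.
  move=> [h1 h2] i; case: (unliftP ord0 i) => [j|] ->.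
    by rewrite row_consS; have := h2 j; rewrite mxE.
  by move: h1; rewrite row_cons0 /= in_itv/= ler_norml => /andP[h1 h3]; apply/andP; split; lra.
rewrite product_measure1E//.
  rewrite /= lebesgue_measure_itv/= exprS EFinM; apply: lee_pmul => //.
    by case: ifPn => //; rewrite lte_fin -EFinB lee_fin; lra.
  case: ifPn => _; first by rewrite -EFinB lee_fin; lra.
  by rewrite lee_fin; lra.
exact: measurable_row_cube.
Qed.

Lemma lebesgue_row_bounded n (A : set 'rV[R]_n) : measurable A -> bounded_set A ->
  (lebesgue_row R n A < +oo)%E.
Proof.
move=> mA [M [_ bM]].
have M0 : 0 <= `|M| + 1 by rewrite addr_ge0.
have MM : M < `|M| + 1 by rewrite (le_lt_trans (ler_norm M))// ltrDl.
apply: (@le_lt_trans _ _ (((2 * (`|M| + 1)) ^+ n)%:E)); last exact: ltry.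
apply: le_trans (lebesgue_row_cube 0 M0); apply: le_measure; rewrite ?inE//.
  exact: measurable_row_cube.
move=> y Ay /= i; rewrite mxE subr0; apply: le_trans (row_norm_coord y i) _.
exact: bM MM _ Ay.
Qed.

(** The push-forward is a measure that gives half-open intervals their length, and this
    characterizes Lebesgue measure. *)
Lemma lebesgue_measure_shift (a : R) (A : set R) : measurable A ->
  pushforward (@lebesgue_measure R) ((fun t : R => t + a) : _ -> measurableTypeR R) A =
  lebesgue_measure A.
Proof.
have ma : measurable_fun [set: measurableTypeR R]
    ((fun t : R => t + a) : _ -> measurableTypeR R) by apply: measurable_funD.
move=> mA.
pose pm : {measure set (measurableTypeR R) -> \bar R} :=
    measure_function_pushforward__canonical__measure_function_Measure
    (@lebesgue_measure R) ma.
apply/esym; apply: (@lebesgue_measure_unique R pm) => // _ [[b c]] _ <-.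
rewrite /= /pushforward.
rewrite (_ : _ @^-1` _ = `]b - a, c - a]%classic); last first.
  by apply/seteqP; split => x /=; rewrite !in_itv/= => /andP[? ?]; apply/andP; split; lra.
rewrite !lebesgue_measure_itv/= !lte_fin ltrD2r; case: ifPn => // _.
by rewrite -!EFinB; congr EFin; lra.
Qed.

Lemma measurable_row_shift n (a : 'rV[R]_n) :
  measurable_fun [set: 'rV[R]_n] (fun x => x + a).
Proof.
apply: continuous_measurable_row_fun => x.
by apply: (@cvgD R 'rV[R]_n _ (nbhs x) _ id (cst a)); [exact: cvg_id|exact: cvg_cst].
Qed.

(** Induction on the dimension: a translation acts separately on the two factors of a rectangle, and
    a product measure is determined by its values on rectangles. In dimension 0 every translation is
    the identity. *)
Lemma lebesgue_row_shift n (a : 'rV[R]_n) (A : set 'rV[R]_n) : measurable A ->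
  pushforward (lebesgue_row R n) (fun x => x + a) A = lebesgue_row R n A.
Proof.
elim: n a A => [|n ih] a A mA.
  rewrite /pushforward; congr (_ _); apply/seteqP; split => x /=;
    by rewrite (thinmx0 a) addr0.
pose a' : 'rV[R]_n := \row_j a ord0 (lift ord0 j).
pose phi (p : measurableTypeR R * 'rV[R]_n) : measurableTypeR R * 'rV[R]_n :=
  (p.1 + a ord0 ord0, p.2 + a').
have mphi : measurable_fun setT phi.
  apply/measurable_fun_pairP; split; rewrite /comp /=.
    by apply: measurable_funD => //; exact: measurable_fst.
  exact: (measurableT_comp (measurable_row_shift a') measurable_snd).
pose pm : {measure set (measurableTypeR R * 'rV[R]_n) -> \bar R} :=
    measure_function_pushforward__canonical__measure_function_Measure
    (@lebesgue_measure R \x lebesgue_row R n)%E mphi.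
have h : forall X, measurable X -> (@lebesgue_measure R \x lebesgue_row R n)%E X = pm X.
  apply: (@product_measure_unique _ _ _ _ _ _ _ pm) => B C mB mC.
  rewrite /= /pushforward.
  rewrite (_ : phi @^-1` _ = ((fun t => t + a ord0 ord0) @^-1` B) `*` ((fun x => x + a') @^-1` C))//.
  rewrite product_measure1E//; last first.
  - by rewrite -[X in measurable X]setTI; exact: measurable_row_shift.
  - rewrite -[X in measurable X]setTI; by apply: measurable_funD.
  by congr (_ * _)%E; [exact: lebesgue_measure_shift | exact: ih].
have mA' : measurable (@row_cons R n @^-1` A).
  by rewrite -[X in measurable X]setTI; exact: measurable_row_cons.
have := h _ mA'; rewrite /= /pushforward /lebesgue_row_step /pushforward => ->.
congr (_ _); apply/seteqP; split => -[t x] /=.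
all: rewrite (_ : row_cons (t, x) + a = row_cons (phi (t, x)))//.
all: apply/rowP => i; rewrite [LHS]mxE (_ : 0 = ord0); last exact: val_inj.
all: by case: (unliftP ord0 i) => [j|] ->; rewrite ?row_cons0 ?row_consS//= !mxE.
Qed.

End row_measure.

Section shift_tonelli.
Variables (R : realType) (n : nat).

Lemma integral_row_shift (a : 'rV[R]_n) (f : 'rV[R]_n -> \bar R) :
  measurable_fun setT f -> (forall x, 0 <= f x)%E ->
  (\int[lebesgue_row R n]_x f (x + a)%R = \int[lebesgue_row R n]_x f x)%E.
Proof.
move=> mf f0.
have := @ge0_integral_pushforward _ _ _ _ R _ (measurable_row_shift a) (lebesgue_row R n) setT f measurableT mf (fun x _ => f0 x).
rewrite preimage_setT /comp => <-.
pose pm : {measure set 'rV[R]_n -> \bar R} :=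
    measure_function_pushforward__canonical__measure_function_Measure
    (lebesgue_row R n) (measurable_row_shift a).
by apply: (@eq_measure_integral _ _ _ setT _ pm f) => A mA _; exact: lebesgue_row_shift.
Qed.

Lemma measurable_row_scale (v : 'rV[R]_n) :
  measurable_fun setT (fun p : 'rV[R]_n * measurableTypeR R => p.1 - p.2 *: v).
Proof.
apply: measurable_fun_row => i.
under eq_fun do rewrite !mxE.
apply: measurable_funB.
  exact: (measurableT_comp (measurable_coord i) measurable_fst).
by apply: measurable_funM => //; exact: measurable_snd.
Qed.

(** The restriction to [[0, T]] is moved from the domain of integration into the integrand, so that
    Tonelli's theorem applies on the whole product space. *)
Lemma measurable_shift_patch (v : 'rV[R]_n) (T : R) (f : 'rV[R]_n -> \bar R) :
  measurable_fun setT f ->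
  measurable_fun setT (fun p : 'rV[R]_n * measurableTypeR R =>
    ((fun p => f (p.1 - p.2 *: v)) \_ (setT `*` `[0%R, T])) p).
Proof.
move=> mf; apply/(measurable_restrictT _ _).1; first exact: measurableX.
apply: (measurable_funS measurableT) => //.
exact: (measurableT_comp mf (measurable_row_scale v)).
Qed.

Lemma shift_patchE (v x : 'rV[R]_n) (T : R) (f : 'rV[R]_n -> \bar R) :
  (\int[@lebesgue_measure R]_(t in `[0%R, T]) f (x - t *: v)%R =
   \int[@lebesgue_measure R]_t
    ((fun p : 'rV[R]_n * R => f (p.1 - p.2 *: v)%R) \_ (setT `*` `[0%R, T])) (x, t))%E.
Proof.
rewrite integral_mkcond; apply: eq_integral => t _.
rewrite /patch /=; congr (if _ then _ else _).
by apply/idP/idP; rewrite !inE => // -[].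
Qed.

Lemma measurable_shift_integral (v : 'rV[R]_n) (T : R) (f : 'rV[R]_n -> \bar R) :
  measurable_fun setT f -> (forall x, 0 <= f x)%E ->
  measurable_fun setT
    (fun x : 'rV[R]_n => \int[@lebesgue_measure R]_(t in `[0%R, T]) f (x - t *: v)%R)%E.
Proof.
move=> mf f0; under eq_fun do rewrite shift_patchE.
apply: (measurable_fun_fubini_tonelli_F (m2 := @lebesgue_measure R)).
  exact: (measurable_shift_patch v T mf).
by move=> p; rewrite /patch; case: ifP.
Qed.

(* Translation invariance of the measure: averaging along a segment does not
   change the total integral. *)
Lemma shift_tonelli (v : 'rV[R]_n) (T : R) (f : 'rV[R]_n -> \bar R) : 0 <= T ->
  measurable_fun setT f -> (forall x, 0 <= f x)%E ->
  (\int[lebesgue_row R n]_x \int[@lebesgue_measure R]_(t in `[0%R, T]) f (x - t *: v)%R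
    = T%:E * \int[lebesgue_row R n]_x f x)%E.
Proof.
move=> T0 mf f0.
pose F (p : 'rV[R]_n * measurableTypeR R) : \bar R :=
  ((fun p => f (p.1 - p.2 *: v)) \_ (setT `*` `[0%R, T])) p.
have F0 p : (0 <= F p)%E by rewrite /F /patch; case: ifP.
have mF : measurable_fun setT F by exact: (measurable_shift_patch v T mf).
have := fubini_tonelli (m1 := lebesgue_row R n) (m2 := @lebesgue_measure R) F mF F0.
rewrite (_ : (fun x => _) = (fun x => \int[@lebesgue_measure R]_(t in `[0%R, T]) f (x - t *: v)%R)%E); last first.
  by apply/funext => x; rewrite shift_patchE.
move=> ->.
rewrite (_ : (fun t => _) = (cst (\int[lebesgue_row R n]_x f x)%E) \_ `[0%R, T]); last first.
  apply/funext => t; rewrite /patch; case: ifPn => ht.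
    rewrite -(integral_row_shift (- (t *: v)) mf f0); apply: eq_integral => x _.
    by rewrite /F /patch ifT//; rewrite inE; split => //; rewrite inE in ht.
  rewrite integral0_eq// => x _; rewrite /F /patch ifF//.
  apply/negbTE; apply: contra ht; rewrite !inE => -[]//.
rewrite -integral_mkcond integral_cst// muleC; congr (_ * _)%E.
rewrite /= lebesgue_measure_itv/= lte_fin; case: ltP => [_|]; first by rewrite -EFinB subr0.
by move=> h; have -> : T = 0 by lra.
Qed.
End shift_tonelli.

(** * Discriminants and the finite Cauchy-Schwarz inequality *)

Section real_cs.
Variable R : realType.

Lemma discriminant_le (a b c : R) : 0 <= c ->
  (forall t, 0 <= a + 2 * t * b + t ^+ 2 * c) -> b ^+ 2 <= a * c.
Proof.
move=> c0 h; have [c1|c1] := eqVneq c 0.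
  have [->|b0] := eqVneq b 0; first by rewrite c1 expr0n mulr0.
  (* The polynomial is affine here, and takes the value [-1] at this point. *)
  have := h (- (a + 1) / (2 * b)); rewrite c1 mulr0 addr0.
  rewrite (_ : 2 * _ * b = - (a + 1)); first by lra.
  by field.
have c2 : 0 < c by rewrite lt_neqAle eq_sym c1.
(* The minimum of the quadratic polynomial. *)
have := h (- b / c); rewrite -(pmulr_lge0 _ c2).
rewrite (_ : (a + 2 * (- b / c) * b + (- b / c) ^+ 2 * c) * c = a * c - b ^+ 2); first by lra.
by field.
Qed.

Lemma cauchy_sum (I : finType) (a b : I -> R) :
  `|\sum_i a i * b i| <= Num.sqrt (\sum_i a i ^+ 2) * Num.sqrt (\sum_i b i ^+ 2).
Proof.
have sq0 (c : I -> R) : 0 <= \sum_i c i ^+ 2 by apply: sumr_ge0 => i _; exact: sqr_ge0.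
rewrite -sqrtrM// -sqrtr_sqr ler_sqrt ?mulr_ge0//; apply: discriminant_le => // t.
rewrite mulr_sumr mulr_sumr -!big_split/=; apply: sumr_ge0 => i _.
rewrite (_ : _ + _ = (a i + t * b i) ^+ 2); first exact: sqr_ge0.
by ring.
Qed.
End real_cs.

(** * The space L2 *)

Section L2.
Context d (T : measurableType d) (R : realType) (mu : {measure set T -> \bar R}).
Variables (D : set T) (mD : measurable D).
Implicit Types f g : T -> R.

(** On [Omega] with Lebesgue measure this is [l2norm] up to conversion. The measure is kept general
    because Cauchy-Schwarz is also applied on an interval of the line. *)
Definition nrm f : R := Num.sqrt (\int[mu]_(x in D) f x ^+ 2).
Definition ip f g : R := \int[mu]_(x in D) (f x * g x).

Lemma nrm_ge0 f : 0 <= nrm f. Proof. exact: sqrtr_ge0. Qed.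

Lemma L2_intM f g : L2 mu D f -> L2 mu D g ->
  mu.-integrable D (EFin \o (fun x => f x * g x)).
Proof.
move=> [mf if2] [mg ig2].
apply: (@le_integrable _ _ _ mu D mD _ (EFin \o (fun x => f x ^+ 2 + g x ^+ 2))).
- by apply/measurable_EFinP; exact: measurable_funM.
- move=> x _ /=; rewrite lee_fin [leRHS]ger0_norm ?addr_ge0 ?sqr_ge0//.
  by rewrite ler_norml; apply/andP; split; nra.
- by have := integrableD mD if2 ig2; apply: eq_integrable.
Qed.

Lemma L2_D f g : L2 mu D f -> L2 mu D g -> L2 mu D (fun x => f x + g x).
Proof.
move=> hf hg; have ifg := L2_intM hf hg; case: hf hg => mf if2 [mg ig2].
split; first exact: measurable_funD.
have := integrableD mD (integrableD mD if2 ig2) (integrableZl mD 2 ifg).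
by apply: eq_integrable => // x _ /=; rewrite -EFinM -!EFinD; congr EFin; ring.
Qed.

Lemma L2_Z (a : R) f : L2 mu D f -> L2 mu D (fun x => a * f x).
Proof.
move=> [mf if2]; split; first exact: measurable_funM.
have := integrableZl mD (a ^+ 2) if2.
by apply: eq_integrable => // x _ /=; rewrite -EFinM; congr EFin; ring.
Qed.

Lemma L2_eq f g : {in D, f =1 g} -> L2 mu D f -> L2 mu D g.
Proof.
move=> fg [mf if2]; split; first exact: eq_measurable_fun mf.
by apply: eq_integrable if2 => // x xD /=; rewrite fg.
Qed.

Lemma L2_B f g : L2 mu D f -> L2 mu D g -> L2 mu D (fun x => f x - g x).
Proof.
move=> hf hg; apply: L2_eq (L2_D hf (L2_Z (-1) hg)) => x _; by rewrite mulN1r.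
Qed.

Lemma L2_0 : L2 mu D (fun=> 0).
Proof.
split; first exact: measurable_cst.
by rewrite (_ : _ \o _ = cst 0%E); [exact: integrable0|apply/funext => x /=; rewrite expr0n].
Qed.

Lemma L2_sum (I : finType) (f : I -> T -> R) :
  (forall i, L2 mu D (f i)) -> L2 mu D (fun x => \sum_i f i x).
Proof.
move=> h.
elim: (index_enum I) => [|i s ih].
  by apply: L2_eq L2_0 => x _; rewrite big_nil.
by apply: L2_eq (L2_D (h i) ih) => x _; rewrite big_cons.
Qed.

Lemma nrm_sq f : nrm f ^+ 2 = \int[mu]_(x in D) f x ^+ 2.
Proof. by rewrite sqr_sqrtr//; apply: Rintegral_ge0 => x _; exact: sqr_ge0. Qed.

Lemma nrm_ip f : nrm f ^+ 2 = ip f f.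
Proof. by rewrite nrm_sq; apply: eq_Rintegral => x _; rewrite expr2. Qed.

(** [Rintegral] sends an infinite integral to [0]; integrability is what makes the real and the
    extended integrals agree. *)
Lemma nrm_sqE f : L2 mu D f -> ((nrm f ^+ 2)%:E = \int[mu]_(x in D) (f x ^+ 2)%:E)%E.
Proof. by move=> [_ h]; rewrite nrm_sq /Rintegral fineK//; exact: (integrable_fin_num _ h). Qed.

Lemma eq_ip f f' g g' : {in D, f =1 f'} -> {in D, g =1 g'} -> ip f g = ip f' g'.
Proof. by move=> h h'; apply: eq_Rintegral => x xD; rewrite h// h'. Qed.

Lemma eq_nrm f g : {in D, f =1 g} -> nrm f = nrm g.
Proof. by move=> h; congr Num.sqrt; apply: eq_Rintegral => x xD; rewrite h. Qed.

Lemma ipC f g : ip f g = ip g f.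
Proof. by apply: eq_Rintegral => x _; rewrite mulrC. Qed.

Lemma ipDl f g h : L2 mu D f -> L2 mu D g -> L2 mu D h ->
  ip (fun x => f x + g x) h = ip f h + ip g h.
Proof.
move=> hf hg hh; rewrite /ip -RintegralD//; try exact: L2_intM.
by apply: eq_Rintegral => x _; rewrite mulrDl.
Qed.

Lemma ipZl a f h : L2 mu D f -> L2 mu D h -> ip (fun x => a * f x) h = a * ip f h.
Proof.
move=> hf hh; rewrite /ip -RintegralZl//; try exact: L2_intM.
by apply: eq_Rintegral => x _; rewrite mulrA.
Qed.

Lemma ipBl f g h : L2 mu D f -> L2 mu D g -> L2 mu D h ->
  ip (fun x => f x - g x) h = ip f h - ip g h.
Proof.
move=> hf hg hh; rewrite /ip -RintegralB//; try exact: L2_intM.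
by apply: eq_Rintegral => x _; rewrite mulrBl.
Qed.

Lemma ipDr f g h : L2 mu D f -> L2 mu D g -> L2 mu D h ->
  ip h (fun x => f x + g x) = ip h f + ip h g.
Proof. by move=> *; rewrite ipC ipDl// ![ip _ h]ipC. Qed.

Lemma ipBr f g h : L2 mu D f -> L2 mu D g -> L2 mu D h ->
  ip h (fun x => f x - g x) = ip h f - ip h g.
Proof. by move=> *; rewrite ipC ipBl// ![ip _ h]ipC. Qed.

Lemma ipZr a f h : L2 mu D f -> L2 mu D h -> ip h (fun x => a * f x) = a * ip h f.
Proof. by move=> *; rewrite ipC ipZl// ipC. Qed.

Lemma Rintegral_sum (I : finType) (f : I -> T -> R) :
  (forall i, mu.-integrable D (EFin \o f i)) ->
  \int[mu]_(x in D) (\sum_i f i x) = \sum_i \int[mu]_(x in D) f i x.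
Proof.
move=> h.
suff : forall s : seq I, mu.-integrable D (EFin \o (fun x => \sum_(i <- s) f i x)) /\
   \int[mu]_(x in D) (\sum_(i <- s) f i x) = \sum_(i <- s) \int[mu]_(x in D) f i x.
  by move=> /(_ (index_enum I)) [].
elim => [|i s [ih1 ih2]].
  split.
    rewrite (_ : _ \o _ = cst 0%E); first exact: integrable0.
    by apply/funext => x /=; rewrite big_nil.
  rewrite big_nil (_ : (fun x => _) = (fun=> 0)); last by apply/funext => x; rewrite big_nil.
  by rewrite Rintegral_cst// mul0r.
split.
  have := integrableD mD (h i) ih1.
  by apply: eq_integrable => // x _ /=; rewrite big_cons EFinD.
rewrite big_cons -ih2 -RintegralD//; apply: eq_Rintegral => x _; by rewrite big_cons.
Qed.

Lemma cauchy_schwarz f g : L2 mu D f -> L2 mu D g -> `|ip f g| <= nrm f * nrm g.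
Proof.
move=> hf hg.
have p0 : 0 <= nrm f * nrm g by rewrite mulr_ge0 ?nrm_ge0.
rewrite -(ler_pXn2r (n := 2)) ?nnegrE// real_normK ?num_real// exprMn.
apply: discriminant_le => [|t]; first exact: sqr_ge0.
have := sqr_ge0 (nrm (fun x => f x + t * g x)).
have hg' := L2_Z t hg.
rewrite nrm_ip ipDl ?ipDr//; try exact: L2_D.
rewrite !ipZl// ?ipZr// (ipC g f) -!nrm_ip.
by move=> h; apply: le_trans h _; rewrite le_eqVlt; apply/orP; left; apply/eqP; ring.
Qed.

Lemma nrm_D f g : L2 mu D f -> L2 mu D g -> nrm (fun x => f x + g x) <= nrm f + nrm g.
Proof.
move=> hf hg.
rewrite -(ler_pXn2r (n := 2)) ?nnegrE ?addr_ge0 ?nrm_ge0//.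
rewrite nrm_ip ipDl ?ipDr//; try exact: L2_D.
have := cauchy_schwarz hf hg; rewrite ler_norml => /andP[_ h].
rewrite -!nrm_ip (ipC g f); nra.
Qed.

Lemma nrm_Z a f : L2 mu D f -> nrm (fun x => a * f x) = `|a| * nrm f.
Proof.
move=> hf; apply/eqP; rewrite -(eqrXn2 (n := 2)) ?mulr_ge0 ?nrm_ge0//.
rewrite nrm_ip ipZl ?ipZr//; last exact: L2_Z.
by rewrite exprMn real_normK ?num_real// nrm_ip expr2 mulrA.
Qed.

Lemma nrm_B f g : L2 mu D f -> L2 mu D g -> nrm (fun x => f x - g x) <= nrm f + nrm g.
Proof.
move=> hf hg; have -> : (fun x => f x - g x) = (fun x => f x + (-1) * g x).
  by apply/funext => x; rewrite mulN1r.
apply: le_trans (nrm_D hf (L2_Z _ hg)) _; by rewrite nrm_Z// normrN1 mul1r.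
Qed.

End L2.

(** * Hausdorff measure *)

Section hausdorff_metric.
Variables (R : realType) (n k : nat).
Local Notation V := 'rV[R]_n.
Local Notation H := (@hausdorff R n k).
Local Open Scope ereal_scope.

Lemma hausdorff_gauge0 (delta : R) : @hausdorff_gauge R n k delta set0 = 0.
Proof. by rewrite /hausdorff_gauge eqxx. Qed.

Lemma diam_ub (E : set V) x y : E x -> E y -> (enorm (x - y))%:E <= diam E.
Proof. by move=> Ex Ey; apply: ereal_sup_ubound; exists x => //; exists y. Qed.

Lemma hausdorff_gauge_ge0 (delta : R) (E : set V) : 0 <= hausdorff_gauge k delta E.
Proof.
rewrite /hausdorff_gauge; case: ifPn => // /set0P[x Ex].
case: ifPn => // _; apply: expe_ge0; apply: le_trans (diam_ub Ex Ex).
by rewrite lee_fin sqrtr_ge0.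
Qed.

(** Recovers the size restriction on the pieces of a cover: the gauge encodes it by the value [+oo],
    so it holds for each nonempty piece of a cover of finite total gauge. *)
Lemma hausdorff_gauge_fin (delta : R) (E : set V) : hausdorff_gauge k delta E < +oo ->
  E = set0 \/ (diam E <= delta%:E /\ hausdorff_gauge k delta E = diam E ^+ k).
Proof.
rewrite /hausdorff_gauge; case: ifPn => [/eqP|E0]; first by left.
by case: ifPn => //; right.
Qed.

Lemma le_hausdorff_gauge (d d' : R) (E : set V) : (d' <= d)%R ->
  hausdorff_gauge k d E <= hausdorff_gauge k d' E.
Proof.
move=> dd; rewrite /hausdorff_gauge; case: ifPn => // _.
case: ifPn => h; last by case: ifPn => // /le_trans h'; rewrite h' ?lee_fin in h.
by case: ifPn => // _; rewrite leey.
Qed.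

Lemma le_mu_ext_gauge (d d' : R) (E : set V) : (d' <= d)%R ->
  mu_ext (hausdorff_gauge k d) E <= mu_ext (hausdorff_gauge k d') E.
Proof.
move=> dd; apply: le_ereal_inf_tmp => _ [F cF <-].
apply: ereal_inf_le; exists (\sum_(0 <= i <oo) hausdorff_gauge k d (F i)); first by exists F.
apply: lee_nneseries => i *; [exact: hausdorff_gauge_ge0|exact: le_hausdorff_gauge].
Qed.

Lemma le_mu_ext_hausdorff (d : R) (E : set V) : (0 < d)%R ->
  mu_ext (hausdorff_gauge k d) E <= H E.
Proof. by move=> d0; apply: ereal_sup_ubound; exists d. Qed.

Lemma nneseries_term_le (u : nat -> \bar R) i : (forall j, 0 <= u j) ->
  u i <= \sum_(0 <= j <oo) u j.
Proof.
move=> u0; apply: le_trans (nneseries_lim_ge i.+1 _) => //.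
by rewrite big_nat_recr//= leeDr// sume_ge0.
Qed.

(** A piece of diameter at most [d < eta] cannot meet both sets, so every cover of the union of
    finite total gauge splits into a cover of [A] and a cover of [B]. *)
Lemma mu_ext_gauge_separated (d eta : R) (A B : set V) : (d < eta)%R ->
  (forall x y, A x -> B y -> (eta <= enorm (x - y))%R) ->
  mu_ext (hausdorff_gauge k d) A + mu_ext (hausdorff_gauge k d) B <=
  mu_ext (hausdorff_gauge k d) (A `|` B).
Proof.
move=> de sep; apply: le_ereal_inf_tmp => _ [F [mF AF] <-].
have [->|] := eqVneq (\sum_(0 <= i <oo) hausdorff_gauge k d (F i)) +oo; first by rewrite leey.
rewrite -ltey => fin.
have finF i : hausdorff_gauge k d (F i) < +oo.
  by apply: le_lt_trans fin; apply: nneseries_term_le => j; exact: hausdorff_gauge_ge0.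
(* Pieces that meet [A] are kept for [A], all others for [B]; a discarded piece becomes [set0], of
   gauge [0]. *)
pose FA i := if asbool (F i `&` A !=set0) then F i else set0.
pose FB i := if asbool (F i `&` A !=set0) then set0 else F i.
have gE i : hausdorff_gauge k d (F i) = hausdorff_gauge k d (FA i) + hausdorff_gauge k d (FB i).
  by rewrite /FA /FB; case: asboolP; rewrite hausdorff_gauge0 ?adde0 ?add0e.
rewrite (eq_eseriesr (g := fun i => hausdorff_gauge k d (FA i) + hausdorff_gauge k d (FB i))); last first.
  by move=> i _; exact: gE.
rewrite nneseriesD; try by move=> *; exact: hausdorff_gauge_ge0.
apply: leeD.
  apply: ereal_inf_le; exists (\sum_(0 <= i <oo) hausdorff_gauge k d (FA i)) => //.
  exists FA => //; split.
    by move=> i; rewrite /FA; case: asboolP.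
  move=> x Ax; have [i _ Fix] := AF x (or_introl Ax); exists i => //.
  by rewrite /FA; case: asboolP => // -[]; exists x.
apply: ereal_inf_le; exists (\sum_(0 <= i <oo) hausdorff_gauge k d (FB i)) => //.
exists FB => //; split.
  by move=> i; rewrite /FB; case: asboolP.
move=> x Bx; have [i _ Fix] := AF x (or_intror Bx); exists i => //.
rewrite /FB; case: asboolP => // -[y [Fiy Ay]].
have [Fi0|[dF _]] := hausdorff_gauge_fin (finF i); first by rewrite Fi0 in Fix.
have := le_trans (diam_ub Fiy Fix) dF; rewrite lee_fin.
by move=> /(le_trans (sep _ _ Ay Bx)); rewrite leNgt de.
Qed.

(** The two suprema on the left may be approached at different scales [d1] and [d2]. A common scale
    below both and below [eta] does, since the outer measure grows when the scale decreases. An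
    infinite right-hand side is set apart so that terms can be subtracted. *)
Lemma hausdorff_separated (eta : R) (A B : set V) : (0 < eta)%R ->
  (forall x y, A x -> B y -> (eta <= enorm (x - y))%R) ->
  H A + H B <= H (A `|` B).
Proof.
move=> e0 sep.
have [->|] := eqVneq (H (A `|` B)) +oo; first by rewrite leey.
rewrite -ltey => fin.
have finA : H A \is a fin_num.
  rewrite ge0_fin_numE ?outer_measure_ge0//; apply: le_lt_trans fin.
  by apply: le_outer_measure => x; left.
have finB : H B \is a fin_num.
  rewrite ge0_fin_numE ?outer_measure_ge0//; apply: le_lt_trans fin.
  by apply: le_outer_measure => x; right.
rewrite -leeBrDr//; apply: ge_ereal_sup => _ [d1 d10 <-].
have main d2 : (0 < d2)%R -> mu_ext (hausdorff_gauge k d1) A + mu_ext (hausdorff_gauge k d2) B <= H (A `|` B).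
  move=> d20 /=; pose d := Num.min (Num.min d1 d2) (eta / 2)%R.
  have d0 : (0 < d)%R by rewrite /d !lt_min d10 d20 divr_gt0.
  apply: le_trans (le_mu_ext_hausdorff _ d0).
  have de : (d < eta)%R.
    by apply: (@le_lt_trans _ _ (eta / 2)%R); [rewrite /d ge_min lexx orbT|lra].
  apply: le_trans (mu_ext_gauge_separated de sep); apply: leeD; apply: le_mu_ext_gauge.
    by rewrite /d !ge_min lexx.
  by rewrite /d !ge_min lexx orbT.
have fin1 : mu_ext (hausdorff_gauge k d1) A \is a fin_num.
  rewrite ge0_fin_numE; last exact: (@mu_ext_ge0 _ _ _ _ (hausdorff_gauge_ge0 d1) A).
  apply: le_lt_trans (le_mu_ext_hausdorff _ d10) _.
  by rewrite ltey_eq finA.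
rewrite leeBrDr// addeC -leeBrDr//; apply: ge_ereal_sup => _ [d2 d20 <-].
by rewrite leeBrDr// addeC; exact: main.
Qed.

End hausdorff_metric.

Section caratheodory.
Variables (R : realType) (n k : nat).
Local Notation V := 'rV[R]_n.
Local Notation H := (@hausdorff R n k).
Variables (phi : V -> R) (phi1 : forall x y, `|phi x - phi y| <= enorm (x - y)) (c : R).
Local Open Scope ereal_scope.

Let e (m : nat) : R := m.+1%:R^-1.
Let e_decr m : (e m.+1 < e m)%R.
Proof. by rewrite /e ltf_pV2 ?posrE ?ltr0n// ltr_nat. Qed.
Let e_le m p : (m <= p)%N -> (e p <= e m)%R.
Proof. by move=> mp; rewrite /e lef_pV2 ?posrE ?ltr0n// ler_nat. Qed.
Let ring_ (X : set V) m : set V := X `&` [set x | (c + e m.+1 <= phi x < c + e m)%R].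

Let sum_rings (X : set V) b N : (\sum_(j < N) H (ring_ X (2 * j + b)%N) <= H X).
Proof.
pose U N := [set x | exists2 j, (j < N)%N & ring_ X (2 * j + b)%N x].
suff h : (\sum_(j < N) H (ring_ X (2 * j + b)%N) <= H (U N)).
  by apply: le_trans h _; apply: le_outer_measure => x [j _ []].
elim: N => [|N ih]; first by rewrite big_ord0 outer_measure_ge0.
rewrite big_ord_recr /=.
have -> : U N.+1 = U N `|` ring_ X (2 * N + b)%N.
  apply/seteqP; split => x.
    move=> [j]; rewrite ltnS leq_eqVlt => /orP[/eqP ->|jN]; first by right.
    by left; exists j.
  by move=> [[j jN h]|h]; [exists j => //; exact: ltnW|exists N].
apply: le_trans (leeD2r _ ih) _.
(* Between the new ring and the earlier ones of the same parity lies the ring of index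
   [2 * N + b - 1], whose width is the gap. At index [0] the truncated predecessor would give the
   gap [0]; the term [1] keeps it positive, and there is then no earlier ring. *)
apply: (@hausdorff_separated _ _ _ ((e (2 * N + b).-1 - e (2 * N + b)) + (if (2 * N + b == 0)%N then 1 else 0))%R).
  case: (2 * N + b)%N => [|p] /=; first by rewrite subrr add0r.
  by rewrite addr0 subr_gt0 e_decr.
move=> x y [j jN [_ /andP[hx _]]] [_ /andP[_ hy]].
apply: le_trans (phi1 x y); apply: le_trans (ler_norm _).
have := e_le (m := (2 * j + b).+1) (p := (2 * N + b).-1).
have -> : ((2 * j + b).+1 <= (2 * N + b).-1)%N by lia.
have -> : (2 * N + b == 0)%N = false by lia.
move=> /(_ isT); rewrite /= in hx hy *; lra.
Qed.

(* Caratheodory's criterion: the slices of a set between successive levels of a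
   1-Lipschitz [phi] are pairwise far apart when their indices have the same
   parity, so that their measures are summable. *)
Lemma caratheodory_sublevel : caratheodory_measurable H [set x | (phi x <= c)%R].
Proof.
apply: le_caratheodory_measurable => X.
change (H (X `&` [set x | (phi x <= c)%R]) + H (X `&` ~` [set x | (phi x <= c)%R]) <= H X).
have [->|] := eqVneq (H X) +oo; first by rewrite leey.
rewrite -ltey => fin.
have finX : H X \is a fin_num by rewrite ge0_fin_numE ?outer_measure_ge0.
(* The even and the odd rings contribute at most [H X] each. *)
have ser : \sum_(0 <= i <oo) H (ring_ X i) < +oo.
  apply: (@le_lt_trans _ _ (H X + H X)); last by rewrite lte_add_pinfty.
  apply: lime_le.
    by apply: is_cvg_nneseries => i *; exact: outer_measure_ge0.
  apply: nearW => N.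
  have : \sum_(0 <= i < N) H (ring_ X i) <= \sum_(0 <= i < N.*2) H (ring_ X i).
    apply: lee_sum_nneg_natr => //; last by rewrite -addnn leq_addr.
    by move=> i *; exact: outer_measure_ge0.
  move=> /le_trans; apply.
  have -> : \sum_(0 <= i < N.*2) H (ring_ X i) =
     \sum_(j < N) H (ring_ X (2 * j + 0)%N) + \sum_(j < N) H (ring_ X (2 * j + 1)%N).
    elim: N => [|N ih]; first by rewrite !big_ord0 big_geq// adde0.
    rewrite doubleS 2?big_nat_recr//= ih !big_ord_recr/= mul2n addn0 addn1.
    rewrite -!addeA; congr (_ + _); rewrite addeC -!addeA; congr (_ + _); by rewrite addeC.
  by apply: leeD; exact: sum_rings.
have tail := nneseries_tail_cvg ser (fun i _ => outer_measure_ge0 _ _).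
(* The part of [X] above level [c] is covered by [Y], which is at distance at least [e m] from the
   sublevel set, and by the rings of index at least [m], whose total is the tail of a convergent
   series. *)
have bound m : H (X `&` [set x | (phi x <= c)%R]) + H (X `&` ~` [set x | (phi x <= c)%R]) <=
   H X + \sum_(m <= i <oo) H (ring_ X i).
  pose Y := X `&` [set x | (c + e m <= phi x)%R].
  have h1 : H (X `&` [set x | (phi x <= c)%R]) + H Y <= H X.
    apply: (@le_trans _ _ (H ((X `&` [set x | (phi x <= c)%R]) `|` Y))); last first.
      by apply: le_outer_measure => x [[]|[]].
    apply: (@hausdorff_separated _ _ _ (e m)); first by rewrite /e invr_gt0 ltr0n.
    move=> x y [_ /= hx] [_ /= hy]; apply: le_trans (phi1 x y).
    by rewrite distrC; apply: le_trans (ler_norm _); lra.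
  have h2 : H (X `&` ~` [set x | (phi x <= c)%R]) <= H Y + \sum_(m <= i <oo) H (ring_ X i).
    apply: (@le_trans _ _ (H (Y `|` \bigcup_i (ring_ X (i + m)%N)))).
      apply: le_outer_measure => x [Xx /= /negP]; rewrite -ltNge => hx.
      have [h|h] := leP (c + e m)%R (phi x); [by left|right].
      have h0 : (0 < phi x - c)%R by lra.
      have [p _ /(_ p (leqnn p)) hp] := near_infty_natSinv_lt (PosNum h0).
      have hp' : (e p < phi x - c)%R by [].
      have ex : exists p, (c + e p <= phi x)%R by exists p; lra.
      (* By minimality of [q] the point lies below level [c + e q.-1], hence in the ring of index
         [q - 1]; and [m < q] because it lies below level [c + e m]. *)
      pose q := ex_minn ex.
      have : (c + e q <= phi x)%R /\ (forall p, (c + e p <= phi x)%R -> (q <= p)%N).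
        by rewrite /q; case: ex_minnP.
      move=> [q1 q2].
      have mq : (m < q)%N.
        rewrite ltnNge; apply/negP => qm; have := e_le qm; lra.
      exists (q.-1 - m)%N => //; rewrite subnK; last by lia.
      split => //=; rewrite prednK; last by lia.
      rewrite q1 /= ltNge; apply/negP => /q2; lia.
    apply: le_trans (outer_measureU2 _ _ _) _; apply: leeD => //.
    apply: le_trans (outer_measure_sigma_subadditive _ _) _.
    by rewrite -[leRHS](nneseries_addn m)// => i; exact: outer_measure_ge0.
  apply: le_trans (leeD (lexx _) h2) _; rewrite addeA.
  exact: leeD.
have lim : (fun m => H X + \sum_(m <= i <oo) H (ring_ X i)) @ \oo --> H X + 0.
  by apply: cvgeD => //; [rewrite fin_num_adde_defr|exact: cvg_cst].
rewrite -[leRHS]adde0; apply: (cvge_ge _ lim).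
by apply: nearW => m; exact: bound.
Qed.

End caratheodory.

(** * Comparison of the Euclidean norm with the sup norm *)

Section enorm.
Variables (R : realType) (n : nat).
Implicit Types x y : 'rV[R]_n.

Lemma dot_ge0 x : 0 <= dot x x.
Proof. by apply: sumr_ge0 => i _; rewrite -expr2 sqr_ge0. Qed.

Lemma enorm_ge0 x : 0 <= enorm x. Proof. exact: sqrtr_ge0. Qed.

Lemma coord_le_enorm x i : `|x ord0 i| <= enorm x.
Proof.
rewrite -sqrtr_sqr ler_sqrt ?dot_ge0// /dot (bigD1 i)//= expr2 lerDl.
by apply: sumr_ge0 => j _; rewrite -expr2 sqr_ge0.
Qed.

Lemma row_norm_le_enorm x : `|x| <= enorm x.
Proof.
by rewrite row_norm_le ?enorm_ge0//; apply/forallP => i; exact: coord_le_enorm.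
Qed.

(** With [row_norm_le_enorm], this translates between the sup norm, which defines balls and strips,
    and the Euclidean norm of the charts and of Hausdorff measure. The crude constant [n]
    suffices. *)
Lemma enorm_le x : enorm x <= n%:R * `|x|.
Proof.
rewrite -(ler_pXn2r (n := 2)) ?nnegrE ?enorm_ge0 ?mulr_ge0//.
rewrite sqr_sqrtr ?dot_ge0// exprMn.
apply: (@le_trans _ _ (\sum_(i < n) `|x| ^+ 2)).
  apply: ler_sum => i _; rewrite -expr2 -real_normK ?num_real//.
  by rewrite lerXn2r ?nnegrE// row_norm_coord.
rewrite sumr_const card_ord -[leLHS]mulr_natl; apply: ler_wpM2r; first exact: sqr_ge0.
by rewrite -natrX ler_nat; case: n => // m; rewrite expnS expn1 leq_pmulr.
Qed.

Lemma dotBl x y z : dot (x - y) z = dot x z - dot y z.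
Proof. by rewrite /dot -sumrB; apply: eq_bigr => i _; rewrite !mxE mulrBl. Qed.

Lemma dotZl t x z : dot (t *: x) z = t * dot x z.
Proof. by rewrite /dot mulr_sumr; apply: eq_bigr => i _; rewrite !mxE mulrA. Qed.

Lemma dot_enorm1 x : enorm x = 1 -> dot x x = 1.
Proof. by move=> e1; rewrite -[dot x x]sqr_sqrtr ?dot_ge0// -/(enorm x) e1 expr1n. Qed.

Lemma dot_le x y : `|dot x y| <= enorm x * enorm y.
Proof.
have sqE (z : 'rV[R]_n) : enorm z = Num.sqrt (\sum_i z ord0 i ^+ 2).
  by congr Num.sqrt; apply: eq_bigr => i _; rewrite expr2.
by rewrite !sqE; exact: cauchy_sum.
Qed.

End enorm.

(** * From inequalities between measures to inequalities between integrals *)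

Section measure_compare.
Local Open Scope ereal_scope.
Context d (T : measurableType d) (R : realType) (mu : {measure set T -> \bar R}).

Lemma ge0_integral_mrestr (D : set T) (mD : measurable D) (f : T -> \bar R) :
  measurable_fun setT f -> (forall x, 0 <= f x) ->
  \int[mrestr mu mD]_x f x = \int[mu]_(x in D) f x.
Proof.
move=> mf f0.
rewrite (@ge0_negligible_integral _ _ _ (mrestr mu mD) setT (~` D))//; last 2 first.
- exact: measurableC.
- by rewrite /= /mrestr setICl measure0.
rewrite setTD setCK; apply: eq_measure_integral => A mA AD.
by rewrite /= /mrestr; congr (mu _); exact/setIidPl.
Qed.

End measure_compare.

Section measure_image.
Local Open Scope ereal_scope.
Context d (T : measurableType d) (R : realType) (mu : {measure set T -> \bar R}).

(** The last hypothesis says that one push-forward on [T'] is dominated by [c] times the other, and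
    domination passes to integrals of nonnegative functions. The map [Q] is meant for the identity
    from the Caratheodory sigma-algebra to that of row vectors, two structures on the same
    points. *)
Lemma ge0_integral_image_le d' (T' : measurableType d') d'' (T'' : measurableType d'')
  (mu'' : {measure set T'' -> \bar R})
  (P : T -> T') (Q : T'' -> T') (D : set T) (D'' : set T'') (c : R) (f : T' -> \bar R) :
  measurable D -> measurable D'' -> measurable_fun setT P -> measurable_fun setT Q ->
  (0 <= c)%R -> measurable_fun setT f -> (forall x, 0 <= f x) ->
  (forall A, measurable A -> mu (D `&` P @^-1` A) <= c%:E * mu'' (D'' `&` Q @^-1` A)) ->
  \int[mu]_(x in D) f (P x) <= c%:E * \int[mu'']_(x in D'') f (Q x).
Proof.
move=> mD mD'' mP mQ c0 mf f0 h.
have mfP : measurable_fun setT (f \o P) by exact: measurableT_comp.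
have mfQ : measurable_fun setT (f \o Q) by exact: measurableT_comp.
have -> := esym (ge0_integral_mrestr mu mD mfP (fun x => f0 (P x))).
have -> := esym (ge0_integral_mrestr mu'' mD'' mfQ (fun x => f0 (Q x))).
pose p1 : {measure set T' -> \bar R} :=
  measure_function_pushforward__canonical__measure_function_Measure (mrestr mu mD) mP.
pose p2 : {measure set T' -> \bar R} :=
  measure_function_pushforward__canonical__measure_function_Measure (mrestr mu'' mD'') mQ.
have := @ge0_le_measure_integral _ _ R p1 (mscale (NngNum c0) p2) _ f setT measurableT f0 mf.
rewrite ge0_integral_mscale//=.
rewrite (@ge0_integral_pushforward _ _ _ _ _ _ mP (mrestr mu mD))//.
rewrite (@ge0_integral_pushforward _ _ _ _ _ _ mQ (mrestr mu'' mD''))//.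
rewrite !preimage_setT; apply => A mA.
by rewrite /p1 /p2 /mscale /= /pushforward /mrestr ![_ `&` D]setIC ![_ `&` D'']setIC; exact: h.
Qed.
End measure_image.

Section surface.
Variables (R : realType) (n : nat).
Local Notation CT := (caratheodory_type (@hausdorff R n n.-1)).

(** Coordinates are 1-Lipschitz for the Euclidean norm, so their sublevel sets satisfy
    Caratheodory's criterion, and these sets generate the sigma-algebra of row vectors. *)
Lemma measurable_surface_id : measurable_fun [set: CT] (fun x : CT => x : 'rV[R]_n).
Proof.
apply: measurable_fun_row => i mD.
apply: (measurability _ (measurable_realfun.RGenOInfty.measurableE R)) => //.
move=> _ [_ [a ->] <-]; rewrite setTI.
rewrite (_ : _ @^-1` _ = ~` [set x : CT | (x : 'rV[R]_n) ord0 i <= a]); last first.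
  apply/seteqP; split => x /=; rewrite in_itv/= andbT ltNge; [by move=> /negP|by move/negP].
apply: measurableC.
apply: (@caratheodory_sublevel R n n.-1 (fun x => x ord0 i)) => x y.
by have := coord_le_enorm (x - y) i; rewrite !mxE.
Qed.

Lemma measurable_surface (A : set 'rV[R]_n) : measurable A -> measurable (A : set CT).
Proof.
by move=> mA; have := measurable_surface_id measurableT mA; rewrite setTI.
Qed.

Lemma measurable_fun_surface (D : set 'rV[R]_n) (f : 'rV[R]_n -> R) :
  measurable_fun setT f -> measurable_fun (D : set CT) f.
Proof.
move=> mf; apply: (measurable_funS measurableT) => //.
exact: (measurableT_comp mf measurable_surface_id).
Qed.

End surface.

(** * Lebesgue measure of a tube against Hausdorff measure of its base *)

Section thickening.
Variables (R : realType) (k : nat) (k0 : (0 < k)%N).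
Local Notation V := 'rV[R]_k.+1.
Variables (e : V) (e1 : enorm e = 1) (T : R) (T0 : 0 < T).
Local Open Scope ereal_scope.

Let thick (F : set V) := [set x : V | exists2 t, (0 <= t <= T)%R & F (x - t *: e)%R].
(** A piece of diameter [d <= T] is swept inside at most [2 * T / d] cubes of side [4 * d], and [(2
    * T / d) * (4 * d) ^+ k.+1 = C * d ^+ k]. *)
Let C : R := 2 * 4 ^+ k.+1 * T.
Let C0 : (0 < C)%R. Proof. by rewrite /C !mulr_gt0// exprn_gt0. Qed.

(** The swept set is enclosed in a measurable set [B], so that its own measurability never has to be
    discussed. *)
Let le_thick_measure (F : set V) (d : R) : (0 < d <= T)%R -> diam F <= d%:E ->
  exists2 B, measurable B /\ thick F `<=` B & lebesgue_row R k.+1 B <= (C * d ^+ k)%:E.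
Proof.
move=> /andP[d0 dT] dF.
have [->|/set0P[a Fa]] := eqVneq F set0.
  exists set0; first by split => // x [t].
  by rewrite measure0 lee_fin !mulr_ge0 ?exprn_ge0// ltW.
pose N := (Num.trunc (T / d)).+1.
have Td : (0 <= T / d)%R by rewrite divr_ge0 ?ltW.
have mc b r : measurable (@row_cube R k.+1 b r) by exact: measurable_row_cube.
(* The half-side [2 * d] allows [d] for the diameter of [F] and [d] for rounding [t] down to a
   multiple of [d], the coordinates of [e] being at most [1] in absolute value. *)
pose Bf (i : nat) := row_cube (a + (i%:R * d) *: e)%R (2 * d)%R.
exists (\big[setU/set0]_(i < N) Bf i).
  split; first by apply: bigsetU_measurable => i _; exact: mc.
  move=> x [t /andP[t0 tT] Fx].
  have td : (0 <= t / d)%R by rewrite divr_ge0// ltW.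
  have /andP[m1 m2] := trunc_itv td.
  set m := Num.trunc (t / d) in m1 m2.
  have mN : (m < N)%N.
    rewrite ltnS; apply: Num.Theory.le_truncn.
    by rewrite ler_pM2r ?invr_gt0.
  rewrite -(bigcup_mkord N Bf); exists m => // i.
  rewrite -natr1 in m2; rewrite ler_pdivlMr// in m1; rewrite ltr_pdivrMr// in m2.
  have h1 : (`|(x - t *: e - a) ord0 i| <= d)%R.
    rewrite -lee_fin; apply: le_trans (le_trans (diam_ub Fx Fa) dF).
    by rewrite lee_fin coord_le_enorm.
  have h2 : (`|e ord0 i| <= 1)%R by rewrite -e1 coord_le_enorm.
  move: h1; rewrite !mxE => h1.
  rewrite (_ : (_ - _ = (x ord0 i - t * e ord0 i - a ord0 i) + (t - m%:R * d) * e ord0 i)%R); last by ring.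
  apply: le_trans (ler_normD _ _) _; rewrite normrM.
  have h3 : (`|t - m%:R * d| <= d)%R by rewrite ger0_norm; lra.
  have : (`|t - m%:R * d| * `|e ord0 i| <= d * 1)%R by apply: ler_pM.
  lra.
apply: (@le_trans _ _ (\sum_(i < N) ((2 * (2 * d)) ^+ k.+1)%:E)).
  apply: (@le_trans _ _ (\sum_(i < N) lebesgue_row R k.+1 (Bf i))).
    apply: (content_subadditive (lebesgue_row R k.+1)) => //.
      by move=> i _; exact: mc.
    by apply: bigsetU_measurable => i _; exact: mc.
  apply: lee_sum => i _; apply: lebesgue_row_cube; lra.
rewrite sumEFin lee_fin sumr_const card_ord -[leLHS]mulr_natl /N -natr1.
have /andP[h _] := trunc_itv Td.
apply: (@le_trans _ _ ((2 * T / d) * (2 * (2 * d)) ^+ k.+1)%R).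
  apply: ler_wpM2r; first by rewrite exprn_ge0// !mulr_ge0// ltW.
  have : (1 <= T / d)%R by rewrite ler_pdivlMr// mul1r.
  by rewrite -mulrA; lra.
rewrite le_eqVlt; apply/orP; left; apply/eqP.
rewrite mulrA (_ : (2 * 2 = 4 :> R)%R); last by ring.
rewrite exprMn [(d ^+ k.+1)%R]exprS /C; field.
by rewrite gt_eqF.
Qed.

(** [F] is a single point, so the previous bound holds for the segment it sweeps with every small
    [d]; as [k > 0], [d ^+ k] tends to [0]. *)
Let thick_null (F : set V) : diam F <= 0 -> F !=set0 ->
  exists2 B, measurable B /\ thick F `<=` B & lebesgue_row R k.+1 B = 0.
Proof.
move=> dF [a Fa].
have Fsub : F `<=` [set a].
  move=> x Fx; apply/eqP; rewrite -subr_eq0 -normr_le0.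
  by apply: le_trans (row_norm_le_enorm _) _; rewrite -lee_fin; apply: le_trans dF; exact: diam_ub.
pose B := (fun t : R => a + t *: e)%R @` `[0%R, T].
have mB : measurable B.
  apply: closed_measurable_row; apply: compact_closed; first exact: norm_hausdorff.
  apply: continuous_compact; last exact: segment_compact.
  apply: continuous_subspaceT => t.
  apply: (@cvgD R V _ (nbhs t) _ (cst a) (fun t => t *: e)%R); first exact: cvg_cst.
  by apply: cvgZr_tmp; exact: cvg_id.
exists B.
  split => // x [t tT /Fsub h]; exists t; first by rewrite /= in_itv.
  by rewrite -h subrK.
have small d : (0 < d <= T)%R -> lebesgue_row R k.+1 B <= (C * d ^+ k)%:E.
  move=> d0.
  have dF' : diam [set a] <= d%:E.
    apply: ge_ereal_sup => _ [x -> [y -> <-]].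
    by rewrite subrr lee_fin /enorm /dot big1 ?sqrtr0; [lra|move=> i _; rewrite mxE mul0r].
  have [B' [mB' sub]] := le_thick_measure d0 dF'; apply: le_trans.
  apply: le_measure; rewrite ?inE// => _ [t tT <-]; apply: sub; exists t => //.
  by rewrite /= addrK.
apply/eqP; rewrite eq_le measure_ge0 andbT; apply/lee_addgt0Pr => eps eps0.
rewrite add0e.
(* [d <= 1] gives [d ^+ k <= d], and [d <= eps / C] then concludes; [d <= T] is required by the
   bound. *)
pose d : R := Num.min (Num.min T 1%R) (eps / C)%R.
have d0 : (0 < d)%R by rewrite /d !lt_min T0 ltr01 divr_gt0.
have dT : (d <= T)%R by rewrite /d !ge_min lexx.
have d1 : (d <= 1)%R by rewrite /d !ge_min lexx orbT.
have dC : (d <= eps / C)%R by rewrite /d !ge_min lexx !orbT.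
apply: le_trans (small d _) _; first by rewrite d0.
rewrite lee_fin mulrC -ler_pdivlMr//; apply: le_trans dC.
case: k k0 => // k' _; rewrite exprS -[leRHS]mulr1 ler_pM2l// exprn_ile1// ltW//.
Qed.

(* Each piece of a cover of [A], of diameter [d > 0], sweeps a tube covered by
   [T / d + 1] cubes of size [O(d)]; a piece of diameter [0] has gauge [0] and
   sweeps a segment, which is negligible in dimension [k.+1 >= 2]. *)
Lemma thickening_le (E A : set V) : measurable E ->
  (forall x, E x -> exists2 t, (0 <= t <= T)%R & A (x - t *: e)%R) ->
  lebesgue_row R k.+1 E <= (2 * 4 ^+ k.+1 * T)%:E * hausdorff k A.
Proof.
move=> mE EA.
apply: (@le_trans _ _ (C%:E * mu_ext (hausdorff_gauge k T) A)); last first.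
  by apply: lee_pmul => //; [rewrite lee_fin ltW|exact: (@mu_ext_ge0 _ _ _ _ (hausdorff_gauge_ge0 k T) A)|exact: le_mu_ext_hausdorff].
rewrite muleC -lee_pdivrMr//; apply: le_ereal_inf_tmp => _ [F [mF AF] <-].
rewrite lee_pdivrMr// muleC.
have [->|] := eqVneq (\sum_(0 <= i <oo) hausdorff_gauge k T (F i)) +oo.
  by rewrite gt0_muley ?lte_fin// leey.
rewrite -ltey => fin.
have finF i : hausdorff_gauge k T (F i) < +oo.
  by apply: le_lt_trans fin; apply: nneseries_term_le => j; exact: hausdorff_gauge_ge0.
have /choice[B hB] : forall i, exists B, [/\ measurable B, thick (F i) `<=` B &
    lebesgue_row R k.+1 B <= C%:E * hausdorff_gauge k T (F i)].
  move=> i; have [F0|Fn0] := eqVneq (F i) set0.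
    exists set0; split => //; first by rewrite F0 => x [].
    by rewrite measure0 mule_ge0 ?hausdorff_gauge_ge0// lee_fin ltW.
  have [F0|[dF ->]] := hausdorff_gauge_fin (finF i); first by rewrite F0 eqxx in Fn0.
  have [a Fa] : F i !=set0 by exact/set0P.
  have d0 : 0 <= diam (F i).
    by apply: le_trans (diam_ub Fa Fa); rewrite lee_fin enorm_ge0.
  have [d dE] : exists d, diam (F i) = d%:E.
    exists (fine (diam (F i))); rewrite fineK// ge0_fin_numE//.
    by apply: le_lt_trans dF _; exact: ltry.
  have : (0 <= d)%R by rewrite -lee_fin -dE.
  rewrite le_eqVlt => /orP[/eqP d0'|d0'].
    have dF0 : diam (F i) <= 0 by rewrite dE -d0'.
    have [B [mB sB] B0] := thick_null dF0 (ex_intro _ a Fa); exists B; split => //; rewrite B0.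
    by apply: mule_ge0; [rewrite lee_fin (ltW C0)|exact: expe_ge0].
  have dT : (0 < d <= T)%R by rewrite d0' -lee_fin -dE.
  have dF' : diam (F i) <= d%:E by rewrite dE.
  have [B [mB sB] hB] := le_thick_measure dT dF'.
  by exists B; split => //; rewrite dE -EFin_expe -EFinM.
rewrite -nneseriesZl; last by move=> *; exact: hausdorff_gauge_ge0.
apply: (@le_trans _ _ (\sum_(0 <= i <oo) lebesgue_row R k.+1 (B i))).
  apply: measure_sigma_subadditive => //; first by move=> i; case: (hB i).
  move=> x /EA[t tT Ax]; have [i _ Fi] := AF _ Ax; exists i => //.
  by case: (hB i) => _ + _; apply; exists t.
by apply: lee_nneseries => i *; [exact: measure_ge0|case: (hB i)].
Qed.

End thickening.

(** * Differential calculus along lines *)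

Section line_derivative.
Variables (R : realType) (V : normedModType R).
Implicit Types (f : V -> R) (x v : V).

(** The two difference quotients coincide. The chain rule, the mean value theorem and Fermat's rule
    in one variable thus become available along lines. *)
Lemma is_derive_line f x v (l : R) :
  is_derive x v f l <-> is_derive (0 : R) (1 : R) (fun h : R => f (h *: v + x)) l.
Proof.
have E : (fun h : R => h^-1 *: (((fun h => f (h *: v + x)) \o shift (0 : R)) (h *: (1 : R)) - f (0 *: v + x))) =
  (fun h : R => h^-1 *: ((f \o shift x) (h *: v) - f x)).
  apply/funext => h /=; rewrite scale0r add0r addr0; congr (_ *: (f (_ *: _ + _) - _)).
  by rewrite -[RHS]mulr1.
by split=> -[d e]; split; rewrite /derivable /derive ?E// in d e *.
Qed.

Lemma is_derive_small f x v (l : R) :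
  (forall eps, 0 < eps -> exists2 rho, 0 < rho & forall h : R, `|h| < rho ->
      `|f (h *: v + x) - f x - h * l| <= eps * `|h|) ->
  is_derive x v f l.
Proof.
move=> H.
have c : (fun h : R => h^-1 *: ((f \o shift x) (h *: v) - f x)) @ (0 : R)^' --> l.
  apply/cvgrPdist_le => eps eps0; have [rho rho0 h] := H _ eps0.
  near=> t.
  have t0 : t != 0 by near: t; exact: nbhs_dnbhs_neq.
  have tr : `|t| < rho.
    near: t; apply: dnbhs0_lt; exact: rho0.
  have := h t tr => ht.
  rewrite distrC /=.
  rewrite (_ : t^-1 *: _ - l = t^-1 * (f (t *: v + x) - f x - t * l)); last first.
    by rewrite mulrBr mulKf.
  by rewrite normrM normfV mulrC ler_pdivrMr ?normr_gt0.
by split; [apply/cvg_ex; exists l|exact: cvg_lim].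
Unshelve. all: by end_near. Qed.

End line_derivative.

Section strict_derivative.
Variables (R : realType) (n : nat).
Local Notation V := 'rV[R]_n.
Implicit Types (f : V -> R) (x v : V).

(* Unlike directional derivatives, strict ones are additive in the direction
   without any differentiability assumption. *)
Definition strict_derive f x v (l : R) : Prop :=
  forall eps, 0 < eps -> exists2 rho, 0 < rho & forall (z : V) (h : R),
     `|z - x| < rho -> `|h| < rho -> `|f (h *: v + z) - f z - h * l| <= eps * `|h|.

Lemma strict_derive_is_derive f x v l : strict_derive f x v l -> is_derive x v f l.
Proof.
move=> H; apply: is_derive_small => eps eps0; have [rho rho0 h] := H _ eps0.
exists rho => // t tr.
by apply: h => //; rewrite subrr normr0.
Qed.

Lemma strict_derive0 f x : strict_derive f x 0 0.
Proof.
move=> eps eps0; exists 1 => // z h _ _.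
by rewrite scaler0 add0r subrr mulr0 subrr normr0 mulr_ge0 // ltW.
Qed.

(** The increment along [v + w] is split at [h *: v + z]. The estimate along [w] is then used at a
    base point other than [z], which the uniformity in the base point allows; the radius keeps this
    point within [r2] of [x]. *)
Lemma strict_deriveD f x v w l m :
  strict_derive f x v l -> strict_derive f x w m -> strict_derive f x (v + w) (l + m).
Proof.
move=> Hv Hw eps eps0.
have e20 : 0 < eps / 2 by rewrite divr_gt0.
have [r1 r10 h1] := Hv _ e20; have [r2 r20 h2] := Hw _ e20.
pose r := Num.min (r1 / 2) (r2 / (2 * (1 + `|v|))).
have v1 : 0 < 1 + `|v| by rewrite ltr_pwDl.
have s2 : 0 < r2 / (2 * (1 + `|v|)) by rewrite divr_gt0// mulr_gt0.
exists (Num.min (Num.min r1 (r2 / 2)) (r2 / (2 * (1 + `|v|)))).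
  by rewrite !lt_min r10 s2 divr_gt0.
move=> z h; rewrite !lt_min => /andP[/andP[z1 z2] z3] /andP[/andP[t1 t2] t3].
have A := h1 z h z1 t1.
have B : `|f (h *: w + (h *: v + z)) - f (h *: v + z) - h * m| <= eps / 2 * `|h|.
  apply: h2; last by apply: lt_le_trans t2 _; lra.
  rewrite -addrA (le_lt_trans (ler_normD _ _))// normrZ.
  have : `|h| * `|v| <= r2 / 2.
    rewrite ltr_pdivlMr ?mulr_gt0// in t3.
    have := normr_ge0 h; have := normr_ge0 v; nra.
  lra.
rewrite (_ : h *: (v + w) + z = h *: w + (h *: v + z)); last first.
  by rewrite scalerDr addrCA addrA.
set a := f _ in B *; set b := f (h *: v + z) in A B *.
rewrite (_ : a - f z - h * (l + m) = (b - f z - h * l) + (a - b - h * m)); last by ring.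
apply: le_trans (ler_normD _ _) _; lra.
Qed.

Lemma strict_deriveZ f x v l (c : R) :
  strict_derive f x v l -> strict_derive f x (c *: v) (c * l).
Proof.
move=> H eps eps0.
have c1 : 0 < 1 + `|c| by rewrite ltr_pwDl.
have [r r0 h] := H _ (divr_gt0 eps0 c1).
have s0 : 0 < r / (1 + `|c|) by rewrite divr_gt0.
exists (Num.min r (r / (1 + `|c|))); first by rewrite lt_min r0.
move=> z t; rewrite !lt_min => /andP[z1 _] /andP[_ t2].
have tc : `|t * c| < r.
  rewrite ltr_pdivlMr// in t2; rewrite normrM.
  have := normr_ge0 t; have := normr_ge0 c; nra.
have := h z (t * c) z1 tc; rewrite scalerA mulrA => /le_trans; apply.
rewrite normrM mulrAC ler_pdivrMr// -!mulrA ler_pM2l//.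
have := normr_ge0 t; have := normr_ge0 c; nra.
Qed.

(** By the mean value theorem the increment is a derivative at an intermediate point of the segment
    times [h]; that point is close to [x], where the directional derivative is continuous. *)
Lemma strict_derive_partial f x v :
  (forall z, derivable f z v) -> {for x, continuous (fun z => 'D_v f z)} ->
  strict_derive f x v ('D_v f x).
Proof.
move=> df cf eps eps0.
have /cvgrPdist_le/(_ _ eps0)/nbhs_ballP[d /= d0 hd] := cf.
have v1 : 0 < 1 + `|v| by rewrite ltr_pwDl.
have s0 : 0 < d / 2 / (1 + `|v|) by rewrite !divr_gt0.
exists (Num.min (d / 2) (d / 2 / (1 + `|v|))); first by rewrite lt_min s0 divr_gt0.
move=> z t; rewrite !lt_min => /andP[z1 _] /andP[_ t2].
pose phi (s : R) := f (s *: v + z).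
have dphi (s : R) : is_derive s 1 phi ('D_v f (s *: v + z)).
  apply/is_derive_line; have /is_derive_line := derivableP (df (s *: v + z)).
  rewrite (_ : (fun h => f _) = (fun h : R => phi (h *: 1 + s)))//.
  by apply/funext => h; rewrite /phi scalerDl addrA -[h *: 1]/(h * 1) mulr1.
have cphi (a b : R) : {within `[a, b], continuous phi}.
  apply: continuous_subspaceT => s; apply: differentiable_continuous.
  by apply/derivable1_diffP; have [] := dphi s.
have close (s : R) : `|s| <= `|t| -> `|'D_v f x - 'D_v f (s *: v + z)| <= eps.
  move=> st; apply: hd; rewrite -ball_normE /= opprD addrCA (le_lt_trans (ler_normD _ _))//.
  rewrite normrN normrZ distrC.
  have : `|s| * `|v| < d / 2.
    rewrite ltr_pdivlMr// in t2; apply: le_lt_trans t2.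
    have := normr_ge0 s; have := normr_ge0 v; nra.
  lra.
have main : exists2 s, `|s| <= `|t| & phi t - phi 0 = 'D_v f (s *: v + z) * t.
  have [t0|t0|t0] := ltgtP 0 t.
  - have [s] := MVT t0 (fun s _ => dphi s) (cphi 0 t).
    rewrite in_itv/= => /andP[s1 s2]; rewrite subr0 => h; exists s => //.
    by rewrite !gtr0_norm// ltW.
  - have [s] := MVT t0 (fun s _ => dphi s) (cphi t 0).
    rewrite in_itv/= => /andP[s1 s2]; rewrite sub0r mulrN => h; exists s.
      by rewrite !ltr0_norm// lerN2 ltW.
    by rewrite -[RHS]opprK -h opprB.
  - by exists 0; rewrite -t0 ?normr0// mulr0 subrr.
have [s /close cs] := main; rewrite /phi scale0r add0r => ->.
rewrite mulrC -mulrBr normrM mulrC ler_wpM2r// distrC//.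
Qed.

End strict_derivative.

(** * Calculus of the classes [Ck] *)

Section Ck_theory.
Variables (R : realType) (n : nat).
Local Notation V := 'rV[R]_n.
Implicit Types (f g : V -> R) (x v : V).

Lemma Ck_continuous k f : Ck k f -> continuous f.
Proof. by case: k => [|k] // []. Qed.

Lemma Ck_pred k f : Ck k.+1 f -> Ck k f.
Proof.
elim: k f => [|k ih] f [cf df] //; split => // i.
by have [d c] := df i; split => //; exact: ih.
Qed.

Lemma Ck_cst k (c : R) : Ck k (fun _ : V => c).
Proof.
elim: k c => [|k ih] c; first exact: cst_continuous.
split; first exact: cst_continuous.
move=> i; split; first by move=> x; exact: derivable_cst.
rewrite (_ : partial i _ = fun=> 0); first exact: ih.
by apply/funext => x; rewrite /partial derive_cst.
Qed.

Lemma continuous_addf f g : continuous f -> continuous g -> continuous (fun x => f x + g x).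
Proof. by move=> cf cg x; exact: (continuousD (cf x) (cg x)). Qed.

Lemma continuous_mulf f g : continuous f -> continuous g -> continuous (fun x => f x * g x).
Proof. by move=> cf cg x; exact: (continuousM (cf x) (cg x)). Qed.

Lemma Ck_D k f g : Ck k f -> Ck k g -> Ck k (fun x => f x + g x).
Proof.
elim: k f g => [|k ih] f g; first exact: continuous_addf.
move=> [cf df] [cg dg]; split; first exact: continuous_addf.
move=> i; have [d1 c1] := df i; have [d2 c2] := dg i; split.
  by move=> x; exact: derivableD.
rewrite (_ : partial i _ = fun x => partial i f x + partial i g x); first exact: ih.
by apply/funext => x; rewrite /partial (deriveD (d1 x) (d2 x)).
Qed.

Lemma Ck_M k f g : Ck k f -> Ck k g -> Ck k (fun x => f x * g x).
Proof.
elim: k f g => [|k ih] f g; first exact: continuous_mulf.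
move=> hf hg; have pf := Ck_pred hf; have pg := Ck_pred hg.
case: hf hg => [cf df] [cg dg]; split; first exact: continuous_mulf.
move=> i; have [d1 c1] := df i; have [d2 c2] := dg i; split.
  by move=> x; exact: derivableM.
rewrite (_ : partial i _ = fun x => f x * partial i g x + g x * partial i f x).
  by apply: Ck_D; exact: ih.
by apply/funext => x; rewrite /partial (deriveM (d1 x) (d2 x)).
Qed.

Lemma Ck_sum k (I : Type) (s : seq I) (f : I -> V -> R) :
  (forall i, Ck k (f i)) -> Ck k (fun x => \sum_(i <- s) f i x).
Proof.
move=> h; elim: s => [|i s ih].
  rewrite (_ : (fun x => _) = fun=> 0); first exact: Ck_cst.
  by apply/funext => x; rewrite big_nil.
rewrite (_ : (fun x => _) = fun x => f i x + \sum_(j <- s) f j x); first exact: Ck_D.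
by apply/funext => x; rewrite big_cons.
Qed.

Lemma is_derive_coord x v i : is_derive x v (fun y : V => y ord0 i) (v ord0 i).
Proof.
apply: is_derive_small => eps eps0; exists 1 => // h _.
by rewrite !mxE addrK subrr normr0 mulr_ge0// ltW.
Qed.

Lemma Ck_coord k i : Ck k (fun x : V => x ord0 i).
Proof.
case: k => [|k]; first by move=> x; exact: coord_continuous.
split; first by move=> x; exact: coord_continuous.
move=> j; split; first by move=> x; have [] := is_derive_coord x (delta_mx ord0 j) i.
rewrite (_ : partial j _ = fun=> (delta_mx ord0 j : V) ord0 i); first exact: Ck_cst.
by apply/funext => x; have [_] := is_derive_coord x (delta_mx ord0 j) i.
Qed.

(** The one-variable counterpart of [Ck], shaped so that the chain rule [Ck_comp] goes by induction
    on [k]. *)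
Fixpoint Dk (k : nat) (h : R -> R) : Prop :=
  if k is k'.+1 then
    continuous h /\ (forall y : R, derivable h y 1) /\ Dk k' h^`()%classic
  else continuous h.

Lemma is_derive_compf (h : R -> R) f x v (a b : R) :
  is_derive (f x) 1 h a -> is_derive x v f b -> is_derive x v (fun y => h (f y)) (a * b).
Proof.
move=> dh df; apply/is_derive_line.
have df' := (is_derive_line _ _ _ _).1 df.
have dh' : is_derive (f ((0 : R) *: v + x)) 1 h a by rewrite scale0r add0r.
exact: (@is_derive1_comp _ h (fun t : R => f (t *: v + x)) 0 a b dh' df').
Qed.

Lemma continuous_compf (h : R -> R) f : continuous h -> continuous f -> continuous (fun x => h (f x)).
Proof. by move=> ch cf x; apply: (@continuous_comp _ _ _ f h); [exact: cf|exact: ch]. Qed.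

Lemma Ck_comp k (h : R -> R) f : Dk k h -> Ck k f -> Ck k (fun x => h (f x)).
Proof.
elim: k h f => [|k ih] h f; first exact: continuous_compf.
move=> [ch [dh Dh]] hf; have pf := Ck_pred hf; case: hf => cf df.
split; first exact: continuous_compf.
move=> i; have [d c] := df i.
have D x := is_derive_compf (derivableP (dh (f x))) (derivableP (d x)).
split; first by move=> x; have [] := D x.
rewrite (_ : partial i _ = fun x => h^`()%classic (f x) * partial i f x).
  by apply: Ck_M => //; exact: ih.
by apply/funext => x; have [_] := D x; rewrite /partial derive1E.
Qed.

(** Continuity makes the partial derivatives strict, and strict derivatives add up along the
    expansion of [v] in the canonical basis. *)
Lemma is_derive_C1 f x v : Ck 1 f -> is_derive x v f (\sum_i v ord0 i * partial i f x).
Proof.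
move=> [cf df].
have key (s : seq 'I_n) : strict_derive f x (\sum_(i <- s) v ord0 i *: delta_mx ord0 i)
   (\sum_(i <- s) v ord0 i * partial i f x).
  elim: s => [|i s ih]; first by rewrite !big_nil; exact: strict_derive0.
  rewrite !big_cons; apply: strict_deriveD => //; apply: strict_deriveZ.
  by have [d c] := df i; apply: strict_derive_partial => //; exact: c.
have := key (index_enum 'I_n).
by rewrite -(row_sum_delta v) => /strict_derive_is_derive.
Qed.

Lemma is_derive_C1_line f x v (t : R) : Ck 1 f ->
  is_derive t 1 (fun s : R => f (x - s *: v)) (- \sum_i v ord0 i * partial i f (x - t *: v)).
Proof.
move=> Cf; apply/is_derive_line.
have /is_derive_line := is_derive_C1 (x - t *: v) (- v) Cf.
rewrite (_ : (fun h => f _) = fun h : R => f (x - (h *: 1 + t) *: v)); last first.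
  apply/funext => h; congr f.
  by rewrite scalerN scalerDl opprD addrCA -[h *: 1]/(h * 1) mulr1.
move=> h; apply: is_derive_eq h _.
by rewrite -sumrN; apply: eq_bigr => i _; rewrite mxE mulNr.
Qed.

(** The fundamental theorem of calculus along the segment, followed by Cauchy-Schwarz against the
    constant [1], whose squared norm on [[0, T]] is the factor [T]. The case [T = 0] is apart since
    the fundamental theorem is applied with [0 < T]. *)
Lemma C1_line_integral f x v (T : R) : Ck 1 f -> 0 <= T ->
  (((f x - f (x - T *: v)) ^+ 2)%:E <=
   T%:E * \int[@lebesgue_measure R]_(t in `[0%R, T])
     ((\sum_i v ord0 i * partial i f (x - t *: v)%R) ^+ 2)%:E)%E.
Proof.
move=> Cf; rewrite le_eqVlt => /orP[/eqP <-|T0].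
  by rewrite scale0r subr0 subrr expr0n /= mul0e.
set h := fun t : R => \sum_i v ord0 i * partial i f (x - t *: v).
pose F := fun s : R => - f (x - s *: v).
have dF (t : R) : is_derive t 1 F (h t).
  by rewrite -[h t]opprK; apply: is_deriveN; exact: is_derive_C1_line.
have cline : continuous (fun t : R => x - t *: v).
  move=> t; apply: (@cvgB R V _ (nbhs t) _ (cst x) (fun t => t *: v)); first exact: cvg_cst.
  by apply: cvgZr_tmp; exact: cvg_id.
have ci i : continuous (fun t : R => v ord0 i * partial i f (x - t *: v)).
  move=> t; have cp : {for t, continuous (fun t : R => partial i f (x - t *: v))}.
    apply: (@continuous_comp _ _ _ (fun t : R => x - t *: v) (partial i f)); first exact: cline.
    by case: Cf => _ /(_ i)[_ /(_ (x - t *: v))].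
  exact: (continuousM (cvg_cst (v ord0 i)) cp).
have ch : continuous h.
  by move=> t; apply: cvg_big => [|i _]; [exact: add_continuous|exact: ci].
have cF : continuous F.
  by move=> t; apply: differentiable_continuous; apply/derivable1_diffP; have [] := dF t.
have FTC := @continuous_FTC2 R h F 0 T T0.
have LR : derivable_oo_LRcontinuous F 0 T.
  split.
  - by move=> t _; have [] := dF t.
  - by apply: cvg_at_right_filter; exact: cF.
  - by apply: cvg_at_left_filter; exact: cF.
have F' : {in `]0, T[, F^`()%classic =1 h}.
  by move=> t _; rewrite derive1E; have [_] := dF t.
have {}FTC := FTC (continuous_subspaceT ch) LR F'.
have mI : measurable (`[0%R, T]%classic : set (measurableTypeR R)) by exact: measurable_itv.
have L2c (g : R -> R) : continuous g -> L2 (@lebesgue_measure R) `[0%R, T]%classic g.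
  move=> cg; split.
    by apply: (measurable_funS measurableT) => //; exact: continuous_measurable_fun.
  apply: continuous_compact_integrable; first exact: segment_compact.
  apply: continuous_subspaceT => t; rewrite (_ : (fun y : R => _) = (fun y : R => g y * g y)).
    exact: (continuousM (cg t) (cg t)).
  by apply/funext => s; rewrite expr2.
have L1 : L2 (@lebesgue_measure R) `[0%R, T]%classic (cst 1).
  by apply: L2c => t; exact: cvg_cst.
have Lh := L2c h ch.
have CS := cauchy_schwarz mI L1 Lh.
have ipE : ip (@lebesgue_measure R) `[0%R, T]%classic (cst 1) h = f x - f (x - T *: v).
  rewrite /ip (_ : (fun y : R => _) = h); last by apply/funext => t; rewrite /= mul1r.
  by rewrite /Rintegral FTC -EFinB /= /F scale0r subr0 opprK addrC.
have n1 : nrm (@lebesgue_measure R) `[0%R, T]%classic (cst 1) ^+ 2 = T.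
  rewrite nrm_sq (_ : (fun y : R => _) = cst 1); last by apply/funext => t; rewrite /= expr1n.
  by rewrite Rintegral_cst// mul1r /= lebesgue_measure_itv/= lte_fin T0 /= oppr0 addr0.
rewrite -(nrm_sqE mI Lh) -EFinM lee_fin -ipE -[X in X * _]n1 -exprMn -real_normK ?num_real//.
by rewrite lerXn2r ?nnegrE// mulr_ge0 ?nrm_ge0.
Qed.

End Ck_theory.

(** * Cut-off functions *)

Section smooth_step.
Variable R : realType.

Lemma expR_ge_monomial k (y : R) : 0 <= y -> y ^+ k <= k`!%:R * expR y.
Proof.
move=> y0; case: k => [|k].
  by rewrite expr0 mul1r; apply: le_trans (expR_ge1Dx y); rewrite lerDl.
have := expR_ge1Dxn k y0 => h.
have f0 : 0 < (k.+1)`!%:R :> R by rewrite ltr0n fact_gt0.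
rewrite -ler_pdivrMl//; rewrite mulrC; lra.
Qed.

Lemma horner_expR_bound (p : {poly R}) :
  exists2 C, 0 <= C & forall y, 0 <= y -> `|p.[y] * expR (- y)| <= C.
Proof.
exists (\sum_(i < size p) `|p`_i| * i`!%:R).
  by apply: sumr_ge0 => i _; rewrite mulr_ge0.
move=> y y0; rewrite normrM (ger0_norm (expR_ge0 _)) expRN ler_pdivrMr ?expR_gt0//.
rewrite horner_coef mulr_suml; apply: le_trans (ler_norm_sum _ _ _) _.
apply: ler_sum => i _; rewrite normrM -mulrA ler_wpM2l// normrX (ger0_norm y0).
exact: expR_ge_monomial.
Qed.

(* The derivative of a function of this form is again of this form. *)
Definition flat (p : {poly R}) (x : R) : R :=
  if 0 < x then p.[x^-1] * expR (- x^-1) else 0.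

Lemma flat_bound p : exists2 C, 0 <= C & forall x, `|flat p x| <= C.
Proof.
have [C C0 h] := horner_expR_bound p; exists C => // x; rewrite /flat.
by case: ifPn => x0; [apply: h; rewrite invr_ge0 ltW|rewrite normr0].
Qed.

(** The bound for [p * 'X^2], read at [x^-1], gains the factor [x ^+ 2]. Quadratic smallness is what
    makes the derivative at the origin exist and vanish. *)
Lemma flat_le_sqr p : exists2 C, 0 <= C & forall x, `|flat p x| <= C * x ^+ 2.
Proof.
have [C C0 h] := horner_expR_bound (p * 'X^2); exists C => // x; rewrite /flat.
case: ifPn => x0; last by rewrite normr0 mulr_ge0// sqr_ge0.
have y0 : 0 <= x^-1 by rewrite invr_ge0 ltW.
have := h _ y0; rewrite hornerM hornerXn mulrAC normrM [`|x^-1 ^+ 2|]ger0_norm ?exprn_ge0//.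
by rewrite exprVn ler_pdivrMr// exprn_gt0.
Qed.

(** With [y = x^-1], whose derivative is [- y ^+ 2], the function [p(y) exp(-y)] has derivative
    [y ^+ 2 * (p(y) - p'(y)) * exp(-y)]. *)
Lemma is_derive_flat p (x : R) : is_derive x 1 (flat p) (flat ('X^2 * (p - p^`())) x).
Proof.
have [x0|x0|->] := ltgtP x 0.
- rewrite {2}/flat ltNge (ltW x0)/=; apply: (@near_eq_is_derive _ _ _ (cst 0)).
  near=> y; rewrite /flat ltNge.
  by have -> : y <= 0 by apply: ltW; near: y; exact: lt_nbhsl.
- rewrite {2}/flat x0; apply: (@near_eq_is_derive _ _ _ (fun y : R => p.[y^-1] * expR (- y^-1))).
    near=> y; rewrite /flat ifT//.
    by near: y; exact: lt_nbhsr.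
  have xn0 : x != 0 by rewrite gt_eqF.
  have dinv : is_derive x 1 (fun y : R => y^-1) (- x ^- 2).
    by apply: is_derive_eq (@is_deriveV R id x 1 1 xn0 (is_derive_id x 1)) _; exact: mulr1.
  have dp := is_derive1_comp (is_derive_poly p x^-1) dinv.
  have dN : is_derive x 1 (fun y : R => - y^-1) (- - x ^- 2) by exact: is_deriveN.
  have de := @is_derive1_comp R expR (fun y : R => - y^-1) x _ _ (is_derive_expR _) dN.
  apply: is_derive_eq (is_deriveM dp de) _.
  rewrite /= hornerM hornerXn hornerD hornerN -![_ *: _]/(_ * _) derivE exprVn; ring.
- have [C C0 h] := flat_le_sqr p.
  rewrite {2}/flat ltxx; apply: is_derive_small => eps eps0.
  exists (eps / (1 + C)); first by rewrite divr_gt0// ltr_pwDl.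
  move=> t; rewrite ltr_pdivlMr; last by rewrite ltr_pwDl.
  move=> tC; rewrite mulr0 subr0 -[t *: 1]/(t * 1) mulr1 addr0 {2}/flat ltxx subr0.
  apply: le_trans (h t) _; rewrite -real_normK ?num_real// expr2 mulrA ler_wpM2r//.
  have := normr_ge0 t; nra.
Unshelve. all: by end_near. Qed.

Lemma Dk_flat k p : Dk k (flat p).
Proof.
have c q : continuous (flat q).
  by move=> x; apply: differentiable_continuous; apply/derivable1_diffP; have [] := is_derive_flat q x.
elim: k p => [|k ih] p //=; split => //; split.
  by move=> x; have [] := is_derive_flat p x.
rewrite (_ : derive1 _ = flat ('X^2 * (p - p^`()))) //.
by apply/funext => x; rewrite derive1E; have [_] := is_derive_flat p x.
Qed.

Let flat1E (x : R) : 0 < x -> flat 1 x = expR (- x^-1).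
Proof. by move=> x0; rewrite /flat x0 hornerC mul1r. Qed.

Let flat1_ge0 (x : R) : 0 <= flat 1 x.
Proof.
by rewrite /flat; case: ifPn => // _; rewrite hornerC mul1r expR_ge0.
Qed.

Let flat1_homo : {homo flat 1 : x y / x <= y}.
Proof.
move=> x y xy; have [x0|x0] := ltP 0 x; last by rewrite {1}/flat ltNge x0.
have y0 := lt_le_trans x0 xy.
by rewrite !flat1E// ler_expR lerN2 lef_pV2.
Qed.

Let e : R := expR 1.
Let e_flat1 : e * flat 1 1 = 1.
Proof. by rewrite flat1E// invr1 /e -expRD subrr expR0. Qed.

Let e0 : 0 < e := expR_gt0 1.

(** A smooth transition from [0] to [1] without a quotient. For [t <= 0] the inner term
    [e * flat 1 (1 - t)] is at least [1], so the outer argument is nonpositive and the outer [flat]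
    vanishes; for [1 <= t] the inner term is [0] and the value is [e * flat 1 1 = 1]. *)
Definition step (t : R) : R := e * flat 1 (1 - e * flat 1 (1 - t)).

Lemma step_ge0 t : 0 <= step t.
Proof. by rewrite /step mulr_ge0// ltW. Qed.

Lemma step_le1 t : step t <= 1.
Proof.
rewrite /step -[leRHS]e_flat1 ler_pM2l//; apply: flat1_homo.
by rewrite gerBl mulr_ge0// ltW.
Qed.

Let step_inner (t : R) : t <= 0 -> 1 - e * flat 1 (1 - t) <= 0.
Proof.
move=> t0; rewrite subr_le0 -[leLHS]e_flat1 ler_pM2l//; apply: flat1_homo; lra.
Qed.

Lemma step_eq0 t : t <= 0 -> step t = 0.
Proof. by move=> t0; rewrite /step {1}/flat ltNge step_inner//= mulr0. Qed.

Lemma step_eq1 t : 1 <= t -> step t = 1.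
Proof.
move=> t1; rewrite /step [flat 1 (1 - t)]/flat ifF ?mulr0 ?subr0//.
by apply/negbTE; rewrite -leNgt; lra.
Qed.

Lemma step_derive : exists (M : R) (dstep : R -> R),
  [/\ 0 <= M, forall t : R, is_derive t (1 : R) step (dstep t), forall t, `|dstep t| <= M &
      forall t, t <= 0 -> dstep t = 0].
Proof.
(* The polynomial attached to the derivative of [flat 1]; the chain rule uses it twice, and [flat q]
   is bounded. *)
pose q : {poly R} := 'X^2 * (1 - 1^`()).
have [C C0 hC] := flat_bound q.
exists (e * C * (e * C)), (fun t => e * (flat q (1 - e * flat 1 (1 - t)) * (e * flat q (1 - t)))).
split.
- by rewrite !mulr_ge0// ltW.
- move=> t.
  have d1 : is_derive t 1 (fun t : R => 1 - t) (-1).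
    by apply: is_derive_eq (is_deriveB (is_derive_cst (1 : R) t 1) (is_derive_id t 1)) _; exact: sub0r.
  have d2 := @is_derive1_comp R (flat 1) (fun t : R => 1 - t) t _ _ (is_derive_flat 1 (1 - t)) d1.
  have d3 : is_derive t 1 (fun t => 1 - e * flat 1 (1 - t)) (e * flat q (1 - t)).
    have := is_deriveB (is_derive_cst (1 : R) t 1) (is_deriveM (is_derive_cst e t (1 : R)) d2).
    move=> d; apply: is_derive_eq d _.
    by rewrite -![_ *: _]/(_ * _) /q /=; ring.
  have d4 := @is_derive1_comp R (flat 1) (fun t : R => 1 - e * flat 1 (1 - t)) t _ _
    (is_derive_flat 1 (1 - e * flat 1 (1 - t))) d3.
  have := is_deriveM (is_derive_cst e t (1 : R)) d4.
  move=> d; apply: is_derive_eq d _.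
  by rewrite -![_ *: _]/(_ * _) /q /=; ring.
- move=> t; rewrite !normrM (ger0_norm (ltW e0)) mulrA.
  by rewrite ler_pM ?mulr_ge0 ?(ltW e0)// ler_pM2l.
- by move=> t t0; rewrite {1}/flat ltNge step_inner//= mul0r mulr0.
Qed.

Lemma Ck_step n k (g : 'rV[R]_n -> R) : Ck k g -> Ck k (fun x => step (g x)).
Proof.
move=> hg; apply: Ck_M; first exact: Ck_cst.
have Ck1B (f : 'rV[R]_n -> R) : Ck k f -> Ck k (fun x => 1 - f x).
  move=> hf; rewrite (_ : (fun x => _) = fun x => 1 + (-1) * f x).
    by apply: Ck_D; [exact: Ck_cst|apply: Ck_M => //; exact: Ck_cst].
  by apply/funext => x; rewrite mulN1r.
apply: (Ck_comp (Dk_flat k 1)); apply: (Ck1B); apply: Ck_M; first exact: Ck_cst.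
by apply: (Ck_comp (Dk_flat k 1)); exact: Ck1B.
Qed.
End smooth_step.

Section crossing.
Variables (R : realType) (n : nat).
Local Notation V := 'rV[R]_n.

(** The point sought is where the segment first leaves [Omega]: it is outside because [Omega] is
    open, and it is a limit of earlier points of the segment, which are inside. *)
Lemma segment_boundary (Omega : set V) (x y : V) : open Omega -> Omega x -> ~ Omega y ->
  exists2 p, boundary Omega p & `|x - p| <= `|x - y|.
Proof.
move=> oO Ox Oy.
pose g (t : R) := t *: (y - x) + x.
have cg : continuous g.
  move=> t; apply: (@cvgD R V _ (nbhs t) _ (fun t => t *: (y - x)) (cst x)).
    by apply: cvgZr_tmp; exact: cvg_id.
  exact: cvg_cst.
pose B := [set t : R | 0 <= t <= 1 /\ ~ Omega (g t)].
have B1 : B 1 by split; [rewrite ler01 lexx|rewrite /g scale1r subrK].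
have hB : has_inf B by split; [exists 1|exists 0 => t [/andP[]]].
pose t0 := inf B.
have t00 : 0 <= t0 by apply: lb_le_inf; [exists 1|move=> t [/andP[]]].
have t01 : t0 <= 1 by apply: ge_inf => //; case: hB.
have below t : 0 <= t < t0 -> Omega (g t).
  move=> /andP[u0 u1]; apply: contrapT => h.
  have : t0 <= t.
    apply: ge_inf; first by case: hB.
    by split => //; rewrite u0 (le_trans (ltW u1)).
  by rewrite leNgt u1.
have near_in t : Omega (g t) -> exists2 d, 0 < d & forall s, `|t - s| < d -> Omega (g s).
  move=> Ogt; have : nbhs (g t) Omega by exact: open_nbhs_nbhs.
  move=> /(cg t) /nbhs_ballP[d /= d0 hd]; exists d => // s ts; exact: hd.
have notO : ~ Omega (g t0).
  move=> /near_in[d d0 hd].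
  have [s Bs sd] := inf_adherent d0 hB.
  have ts : t0 <= s by apply: ge_inf => //; case: hB.
  case: Bs => _; apply; apply: hd; rewrite distrC ger0_norm ?subr_ge0//.
  by rewrite ltrBlDl.
have t0pos : 0 < t0.
  rewrite lt_neqAle t00 andbT; apply/eqP => h; apply: notO.
  by rewrite -h /g scale0r add0r.
exists (g t0); last first.
  rewrite /g opprD addrCA subrr addr0 normrN normrZ ger0_norm// distrC.
  by rewrite ler_piMl.
split; last by move=> /interior_subset.
move=> W /(cg t0) /nbhs_ballP[d /= d0 hd].
pose s := Num.max 0 (t0 - d / 2).
have s0 : 0 <= s by rewrite /s le_max lexx.
have st : s < t0 by rewrite /s gt_max t0pos; lra.
exists (g s); split; first by apply: below; rewrite s0.
apply: hd; rewrite /ball /= ger0_norm ?subr_ge0 ?ltW//.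
have : t0 - d / 2 <= s by rewrite /s le_max lexx orbT.
lra.
Qed.
End crossing.

Section lattice.
Variables (R : realType) (n : nat).
Local Notation V := 'rV[R]_n.

Lemma card_near_le (N D : nat) (y : R) :
  (#|[set m : 'I_N | (`|y - m%:R| <= D%:R)%R]%SET| <= (2 * D).+2)%N.
Proof.
case: N => [|N]; first by rewrite (leq_trans (max_card _))// card_ord.
pose b := Num.trunc (Num.max 0 (y - D%:R)).
have /andP[b1 b2] : b%:R <= Num.max 0 (y - D%:R) < b.+1%:R.
  by apply: trunc_itv; rewrite le_max lexx.
pose f (k : 'I_(2 * D).+2) : 'I_N.+1 := inord (b + k).
apply: (@leq_trans #|f @: [set: 'I_(2 * D).+2]%SET|); last first.
  by apply: leq_trans (leq_imset_card _ _) _; rewrite cardsT card_ord.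
apply: subset_leq_card; apply/fintype.subsetP => m; rewrite inE ler_norml => /andP[m1 m2].
have bm : (b <= m)%N.
  rewrite -(ler_nat R); apply: le_trans b1 _; rewrite ge_max ler0n /=; lra.
have mb : (m < b.+1 + 2 * D)%N.
  have b3 : y - D%:R < b.+1%:R by apply: le_lt_trans b2; rewrite le_max lexx orbT.
  rewrite -(ltr_nat R) natrD natrM; lra.
have hk : (m - b < (2 * D).+2)%N by lia.
apply/imsetP; exists (Ordinal hk) => //; apply/val_inj.
by rewrite /f /= inordK subnKC.
Qed.

(** The bound is independent of [N]. This matters because [N] will grow like the size of the domain
    divided by [h], while the number of overlapping bumps has to stay bounded. *)
Lemma card_lattice_le (N D : nat) (y : 'I_n -> R) :
  (#|[set a : {ffun 'I_n -> 'I_N} | [forall j, (`|y j - (a j)%:R| <= D%:R)%R]]%SET| <= (2 * D).+2 ^ n)%N.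
Proof.
rewrite (eq_card (B := mem (family (fun j => mem [set m : 'I_N | (`|y j - m%:R| <= D%:R)%R]%SET)))); last first.
  move=> a; rewrite !inE; apply/forallP/familyP => h j; have := h j; by rewrite inE.
rewrite card_family.
have : (\prod_j #|[set m : 'I_N | (`|y j - m%:R| <= D%:R)%R]%SET| <= \prod_(j < n) (2 * D).+2)%N.
  by apply: leq_prod => j _; exact: card_near_le.
rewrite prod_nat_const card_ord; apply: leq_trans.
by rewrite foldrE big_map enumT.
Qed.

Lemma is_derive_seq_sum (I : Type) (s : seq I) (f : I -> V -> R) (df : I -> R) (x v : V) :
  (forall i, is_derive x v (f i) (df i)) ->
  is_derive x v (fun y => \sum_(i <- s) f i y) (\sum_(i <- s) df i).
Proof.
move=> H; elim: s => [|i s ih].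
  rewrite big_nil (_ : (fun y => _) = cst 0); first exact: is_derive_cst.
  by apply/funext => y; rewrite big_nil.
rewrite big_cons (_ : (fun y => _) = f i + (fun y => \sum_(j <- s) f j y)).
  exact: is_deriveD.
by apply/funext => y; rewrite big_cons.
Qed.

(* [eta] is [step] of the sum of the bumps centred at the points of the lattice
   [h Z^n] whose neighbourhood of size [O(h)] lies in [Omega]; at each point only
   boundedly many bumps are nonzero. *)
Lemma cutoff : exists (K M : R), [/\ 0 < K, 0 < M &
  forall (Omega : set V) (h : R), open Omega -> bounded_set Omega -> 0 < h ->
  exists eta : V -> R, [/\ test_function Omega eta,
    forall x, 0 <= eta x <= 1,
    forall x, Omega x -> (forall y, boundary Omega y -> K * h <= `|x - y|) -> eta x = 1 &
    forall x i, `|partial i eta x| <= M / h]].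
Proof.
have [MS [dS [MS0 dSP dSb dS0]]] := step_derive R.
(* [D = 2 * r] for the [r] below: a bump is nonzero only where [q a x <= D], which forces each
   coordinate of [x] to be within [D * h] of the centre. *)
pose D : nat := (2 * n.+1)%N.
pose W := ((2 * D).+2 ^ n)%N.
(* In the gradient bound, the outer [step] gives [MS], at most [W] bumps are active, and each has
   partial derivatives at most [MS * (2 * D) / h]; the summand [1] only ensures positivity. *)
exists D.+2%:R, (1 + MS * (W%:R * (MS * (2 * D%:R)))); split.
- by rewrite ltr0n.
- by rewrite ltr_pwDl// !mulr_ge0.
move=> Omega h oO [B [_ bB]] h0.
pose B1 := `|B| + 1.
have xB (x : V) : Omega x -> forall j, `|x ord0 j| <= B1.
  move=> Ox j; apply: le_trans (row_norm_coord x j) _; apply: bB => //.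
  by rewrite /B1 (le_lt_trans (ler_norm B))// ltrDl.
have B10 : 0 <= B1 by rewrite /B1 addr_ge0.
pose m := (Num.trunc (B1 / h)).+1.
have mB : B1 / h < m%:R.
  by have /andP[] := trunc_itv (divr_ge0 B10 (ltW h0)).
(* Lattice indices are natural numbers shifted by [m], so that they cover all the cells from
   [- B1 / h] to [B1 / h]. *)
pose N := (m + m).+1.
pose c (a : {ffun 'I_n -> 'I_N}) (j : 'I_n) : R := (a j)%:R - m%:R.
pose z (a : {ffun 'I_n -> 'I_N}) : V := \row_j (h * c a j).
pose q a (x : V) : R := \sum_(j < n) (x ord0 j / h - c a j) ^+ 2.
pose r : R := n.+1%:R.
have r0 : 0 < r by rewrite ltr0n.
pose b a (x : V) : R := step (2 - q a x / r).
pose deep a := `[< row_cube (z a) (D%:R * h) `<=` Omega >].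
pose Phi (x : V) : R := \sum_(a <- [seq a <- index_enum {ffun 'I_n -> 'I_N} | deep a]) b a x.
pose eta x := step (Phi x).
have q_ge0 a x : 0 <= q a x by apply: sumr_ge0 => j _; exact: sqr_ge0.
have coord_le_q a (x : V) j : (x ord0 j / h - c a j) ^+ 2 <= q a x.
  by rewrite /q (bigD1 j)//= lerDl; apply: sumr_ge0 => i _; exact: sqr_ge0.
have q_small a (x : V) : q a x <= 2 * r -> forall j, `|x ord0 j / h - c a j| <= D%:R.
  move=> qr j; have := le_trans (coord_le_q a x j) qr.
  have -> : 2 * r = D%:R by rewrite /r /D natrM.
  rewrite -real_normK ?num_real// => hq.
  have D1 : 1 <= D%:R :> R by rewrite ler1n /D.
  have := normr_ge0 (x ord0 j / h - c a j); nra.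
have Cq a k : Ck k (q a).
  apply: (@Ck_sum R n k _ (index_enum 'I_n) (fun j (x : V) => (x ord0 j / h - c a j) ^+ 2)) => j.
  have lin : Ck k (fun x : V => x ord0 j * h^-1 + - c a j).
    by apply: Ck_D; [apply: Ck_M; [exact: Ck_coord|exact: Ck_cst]|exact: Ck_cst].
  by have := Ck_M lin lin; congr (Ck k _); apply/funext => x; rewrite expr2.
have Cin a k : Ck k (fun x => 2 - q a x / r).
  rewrite (_ : (fun x => _) = fun x => 2 + (- r^-1) * q a x).
    by apply: Ck_D; [exact: Ck_cst|apply: Ck_M => //; exact: Ck_cst].
  by apply/funext => x; rewrite mulNr mulrC.
have Cb a k : Ck k (b a) by apply: Ck_step; exact: Cin.
have CPhi k : Ck k Phi by apply: Ck_sum => a.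
have Ceta k : Ck k eta by apply: Ck_step.
have b_ge0 a x : 0 <= b a x by exact: step_ge0.
have b_supp a x : b a x != 0 -> q a x <= 2 * r.
  move=> bx; rewrite leNgt; apply/negP => qx; move/eqP: bx; apply; apply: step_eq0.
  by rewrite subr_le0 ler_pdivlMr// ltW.
have Phi_supp x : eta x != 0 -> exists2 a, deep a & q a x <= 2 * r.
  move=> ex; have : Phi x != 0.
    by apply: contra_neq ex => h'; rewrite /eta h' step_eq0.
  move=> Px; apply: contrapT => H; move/eqP: Px; apply.
  rewrite /Phi big_filter big1// => a da; apply: contrapT => /eqP /b_supp qa.
  by apply: H; exists a.
have cube_q a (x : V) : (forall j, `|x ord0 j / h - c a j| <= D%:R) -> row_cube (z a) (D%:R * h) x.
  move=> H j; rewrite mxE.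
  rewrite (_ : _ - _ = (x ord0 j / h - c a j) * h); last by field; rewrite gt_eqF.
  by rewrite normrM (gtr0_norm h0) ler_pM2r.
have cube_closed (p : V) (s : R) : closed (row_cube p s).
  rewrite (_ : row_cube p s = \bigcap_(j in [set: 'I_n])
      ((fun y : V => y ord0 j) @^-1` `[p ord0 j - s, p ord0 j + s])).
    apply: closed_bigI => j _; apply: closed_comp; last exact: itv_closed.
    by move=> y _; exact: coord_continuous.
  apply/seteqP; split => [y /= yr j _ /=|y /= H j].
    have := yr j; rewrite in_itv/= ler_norml => /andP[h1 h2]; apply/andP; split; lra.
  have := H j Logic.I; rewrite /= in_itv/=.
  by move=> /andP[h1 h2]; rewrite ler_norml; apply/andP; split; lra.
have supp_sub : closure [set x | eta x != 0] `<=` Omega.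
  (* A finite union of closed cubes contained in [Omega], hence a closed set that contains the
     closure of the support. *)
  pose S := \bigcup_(a in [set a | deep a]) row_cube (z a) (D%:R * h).
  have cS : closed S by apply: closed_bigcup => //; exact: finite_finset.
  apply: (@subset_trans _ S); last by move=> x [a /asboolP H] /H.
  rewrite closureE => x; apply; split => // y /= /Phi_supp[a da qa].
  by exists a => //; apply: cube_q; exact: q_small.
exists eta; split.
- split => //.
    apply: bounded_closed_compact; last exact: closed_closure.
    exists B; split; first exact: num_real.
    by move=> x Bx y /supp_sub; exact: bB.
- by move=> x; rewrite step_ge0 step_le1.
- move=> x Ox far.
  have yj j : 0 <= x ord0 j / h + m%:R.
    have := xB x Ox j; rewrite ler_norml => /andP[h1 _].
    have : - (B1 / h) <= x ord0 j / h by rewrite -mulNr ler_pM2r ?invr_gt0.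
    lra.
  have yN j : (Num.trunc (x ord0 j / h + m%:R) < N)%N.
    have := xB x Ox j; rewrite ler_norml => /andP[_ h1].
    have h2 : x ord0 j / h <= B1 / h by rewrite ler_pM2r ?invr_gt0.
    have /andP[t1 _] := trunc_itv (yj j).
    rewrite /N -(ltr_nat R) -natr1 natrD; lra.
  pose a : {ffun 'I_n -> 'I_N} := [ffun j => Ordinal (yN j)].
  have ca j : `|x ord0 j / h - c a j| <= 1.
    have /andP[t1 t2] := trunc_itv (yj j); rewrite -natr1 in t2.
    rewrite /c ffunE /= ler_norml; apply/andP; split; lra.
  have qa : q a x <= n%:R.
    apply: (@le_trans _ _ (\sum_(j < n) 1)); last by rewrite sumr_const card_ord.
    apply: ler_sum => j _; rewrite -real_normK ?num_real//.
    by rewrite -[leRHS](expr1n _ 2) lerXn2r ?nnegrE.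
  have ba : b a x = 1.
    apply: step_eq1.
    have : q a x / r <= 1 by rewrite ler_pdivrMr// mul1r (le_trans qa)// ler_nat.
    by move: (q a x / r) => t ht; lra.
  (* A point [y] of the cube is within [(D + 1) * h] of [x], its centre being within [h] of [x]. If
     [y] were outside [Omega], the segment from [x] to [y] would meet the boundary closer to [x]
     than [(D + 2) * h]. *)
  have da : deep a.
    apply/asboolP => y hy; apply: contrapT => Oy.
    have [p bp xp] := segment_boundary oO Ox Oy.
    have := le_trans (far p bp) xp; rewrite leNgt => /negP; apply.
    apply: (@le_lt_trans _ _ (D.+1%:R * h)); last by rewrite ltr_pM2r// ltr_nat.
    rewrite row_norm_le ?mulr_ge0 ?(ltW h0)//; apply/forallP => j.
    rewrite !mxE (_ : _ - _ = (x ord0 j / h - c a j) * h - (y ord0 j - z a ord0 j)); last first.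
      by rewrite mxE; field; rewrite gt_eqF.
    apply: le_trans (ler_normB _ _) _; rewrite normrM (gtr0_norm h0).
    have := hy j; have := ca j; rewrite -natr1 => h1 h2.
    have := ler_wpM2r (ltW h0) h1; lra.
  apply: step_eq1; rewrite /Phi big_filter (bigD1 a)//= ba lerDl.
  by apply: sumr_ge0 => *; exact: b_ge0.
move=> x i.
have dPhi := (CPhi 1%N).2 i; have dq a := (Cq a 1%N).2 i; have din a := (Cin a 1%N).2 i.
have db a := (Cb a 1%N).2 i.
have pq a : partial i (q a) x = 2 * (x ord0 i / h - c a i) / h.
  have D1 j : is_derive x (delta_mx ord0 i) (fun y : V => (y ord0 j / h - c a j) ^+ 2)
     ((j == i)%:R * (2 * (x ord0 i / h - c a i) / h)).
    have d0 := is_derive_coord x (delta_mx ord0 i) j.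
    have d1 := is_deriveB (is_deriveM d0 (is_derive_cst (h^-1) x (delta_mx ord0 i))) (is_derive_cst (c a j) x (delta_mx ord0 i)).
    have d2 := is_deriveM d1 d1.
    rewrite (_ : (fun y : V => _) = (((fun y : V => y ord0 j) * cst h^-1 - cst (c a j)) * ((fun y : V => y ord0 j) * cst h^-1 - cst (c a j)))); last first.
      by apply/funext => y; rewrite expr2.
    apply: is_derive_eq d2 _.
    rewrite -![_ *: _]/(_ * _) mxE eqxx /= !fctE.
    by case: eqVneq => [->|_]; rewrite ?mulr1n ?mulr0n /=; ring.
  have : is_derive x (delta_mx ord0 i) (q a) (\sum_(j < n) ((j == i)%:R * (2 * (x ord0 i / h - c a i) / h))).
    have := @is_derive_sum R V R n (fun j (y : V) => (y ord0 j / h - c a j) ^+ 2) x (delta_mx ord0 i) _ D1.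
    by congr (is_derive _ _ _ _); apply/funext => y; rewrite /q fct_sumE.
  move=> [_]; rewrite /partial => ->.
  rewrite (bigD1 i)//= eqxx mul1r big1 ?addr0// => j /negbTE ->; by rewrite mul0r.
have pb a : `|partial i (b a) x| <=
   ([forall j, `|(x ord0 j / h + m%:R) - (a j)%:R| <= D%:R]%:R) * (MS * (2 * D%:R) / h).
  have Din : is_derive x (delta_mx ord0 i) (fun y => 2 - q a y / r) (- (partial i (q a) x / r)).
    have := is_deriveB (is_derive_cst (2 : R) x (delta_mx ord0 i)) (is_deriveM (derivableP ((dq a).1 x)) (is_derive_cst (r^-1) x (delta_mx ord0 i))).
    move=> d; apply: is_derive_eq d _; rewrite -![_ *: _]/(_ * _) /partial /=; ring.
  have [_] := is_derive_compf (dSP (2 - q a x / r)) Din.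
  rewrite /partial -/(b a) => ->.
  have [qr|qr] := leP (q a x) (2 * r); last first.
    rewrite dS0; last by rewrite subr_le0 ler_pdivlMr// ltW.
    by rewrite mul0r normr0 !mulr_ge0// invr_ge0 ltW.
  have hj := q_small a x qr.
  have -> : [forall j, `|(x ord0 j / h + m%:R) - (a j)%:R| <= D%:R].
    apply/forallP => j; have := hj j.
    by rewrite /c (_ : _ - (_ - _) = x ord0 j / h + m%:R - (a j)%:R)//; ring.
  rewrite mul1r normrM normrN -/(partial i (q a) x) pq -[leRHS]mulrA; apply: ler_pM => //.
  rewrite !normrM !normfV (gtr0_norm h0) (gtr0_norm r0) (ger0_norm (ler0n R 2)).
  rewrite mulrAC ler_pM2r ?invr_gt0// ler_pdivrMr//.
  apply: (@le_trans _ _ (2 * D%:R)); first by rewrite ler_pM2l.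
  by rewrite ler_peMr ?mulr_ge0// /r ler1n.
have DPhi := is_derive_seq_sum [seq a <- index_enum {ffun 'I_n -> 'I_N} | deep a]
   (fun a => derivableP ((db a).1 x)).
have [_] := is_derive_compf (dSP (Phi x)) DPhi.
rewrite -/(partial i eta x) => ->.
rewrite normrM mulrDl mul1r -[X in _ + X]mulrA; apply: ler_wpDl; first by rewrite invr_ge0 ltW.
apply: ler_pM => //.
rewrite big_filter; apply: le_trans (ler_norm_sum _ _ _) _.
apply: (@le_trans _ _ (\sum_(a : {ffun 'I_n -> 'I_N})
   ([forall j, `|(x ord0 j / h + m%:R) - (a j)%:R| <= D%:R]%:R) * (MS * (2 * D%:R) / h))).
  rewrite [leLHS]big_mkcond; apply: ler_sum => a _; case: ifP => _; first exact: pb.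
  by rewrite !mulr_ge0// invr_ge0 ltW.
rewrite -mulr_suml -[leRHS]mulrA; apply: ler_wpM2r; first by rewrite !mulr_ge0// invr_ge0 ltW.
rewrite -natr_sum ler_nat -big_mkcond sum1_card.
apply: leq_trans (card_lattice_le N D (fun j => x ord0 j / h + m%:R)).
by rewrite subset_leq_card//; apply/fintype.subsetP => a; rewrite inE.
Qed.

End lattice.

(** * Estimates near the boundary *)

Section strip.
Variables (R : realType) (k : nat) (k0 : (0 < k)%N).
Local Notation n := k.+1.
Local Notation V := 'rV[R]_n.
Local Notation lambda := (lebesgue_row R n).
Local Notation sigma := (surface_measure R n).
Variables (Omega : set V) (oO : open Omega).
Local Notation Gamma := (boundary Omega).

Definition strip (U : set V) (delta : R) : set V :=
  [set x | Omega x /\ exists y, [/\ Gamma y, U y & `|x - y| < delta]].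

Definition grad_sq (s : V -> R) (x : V) : R := \sum_i partial i s x ^+ 2.

(** Only the left-hand side is localized to [U]. With the whole of [Gamma] and the full wider strip
    on the right, estimates for two sets add up to one for their union, and no partition of unity is
    needed. *)
Definition strip_estimate (U : set V) : Prop :=
  exists C delta0 : R, [/\ 0 < C, 0 < delta0 &
    forall delta, 0 < delta < delta0 -> forall s : V -> R, Ck 1 s ->
    (\int[lambda]_(x in strip U delta) (s x ^+ 2)%:E <=
     (C * delta)%:E * \int[sigma]_(x in Gamma) (s x ^+ 2)%:E +
     (C * delta ^+ 2)%:E * \int[lambda]_(x in strip setT (C * delta)) (grad_sq s x)%:E)%E].

Lemma open_strip U delta : open (strip U delta).
Proof.
rewrite (_ : strip U delta = Omega `&` \bigcup_(y in Gamma `&` U) ball y delta).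
  by apply: openI => //; apply: bigcup_open => y _; exact: ball_open.
apply/seteqP; split => [x [Ox [y [gy uy xy]]]|x [Ox [y [gy uy]]]].
  by split => //; exists y => //; rewrite -ball_normE /= distrC.
by rewrite -ball_normE /= => xy; split => //; exists y; split => //; rewrite distrC.
Qed.

Lemma measurable_strip U delta : measurable (strip U delta).
Proof. by apply: open_measurable_row; exact: open_strip. Qed.

Lemma closed_boundary : closed Gamma.
Proof.
rewrite /boundary setDE; apply: closedI; first exact: closed_closure.
by rewrite closedC; exact: open_interior.
Qed.

Lemma measurable_boundary : measurable Gamma.
Proof. by apply: closed_measurable_row; exact: closed_boundary. Qed.

Lemma grad_sq_ge0 s x : 0 <= grad_sq s x.
Proof. by apply: sumr_ge0 => i _; exact: sqr_ge0. Qed.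

Lemma continuous_grad_sq s : Ck 1 s -> continuous (grad_sq s).
Proof.
move=> [_ ds]; have h (I : seq 'I_n) : Ck 0 (fun x => \sum_(i <- I) partial i s x ^+ 2).
  apply: Ck_sum => i; have [_ c] := ds i.
  by have := @Ck_M R n 0 _ _ c c; congr (Ck _ _); apply/funext => x; rewrite expr2.
exact: h.
Qed.

Lemma measurable_sq_EFin (f : V -> R) D : continuous f ->
  measurable_fun D (fun x => (f x ^+ 2)%:E).
Proof.
move=> cf; apply/measurable_EFinP; apply: measurable_funX.
apply: (measurable_funS measurableT) => //; exact: continuous_measurable_row.
Qed.

Lemma measurable_grad_sq s D : Ck 1 s -> measurable_fun D (fun x => (grad_sq s x)%:E).
Proof.
move=> cs; apply/measurable_EFinP; apply: (measurable_funS measurableT) => //.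
by apply: continuous_measurable_row; exact: continuous_grad_sq.
Qed.

Lemma surface_integral_ge0 (s : V -> R) : (0 <= \int[sigma]_(x in Gamma) (s x ^+ 2)%:E)%E.
Proof. by apply: integral_ge0 => x _; rewrite lee_fin sqr_ge0. Qed.

Lemma le_strip U U' d d' : Gamma `&` U `<=` U' -> d <= d' -> strip U d `<=` strip U' d'.
Proof.
move=> UU dd x [Ox [y [gy uy xy]]]; split => //; exists y; split => //; first exact: UU.
exact: lt_le_trans dd.
Qed.

Lemma le_strip_grad s d d' : Ck 1 s -> d <= d' ->
  (\int[lambda]_(x in strip setT d) (grad_sq s x)%:E <=
   \int[lambda]_(x in strip setT d') (grad_sq s x)%:E)%E.
Proof.
move=> cs dd; apply: ge0_subset_integral; try exact: measurable_strip.
- exact: measurable_grad_sq.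
- by move=> x _; rewrite lee_fin grad_sq_ge0.
- exact: le_strip.
Qed.

Lemma strip_estimate_sub U U' : Gamma `&` U `<=` U' -> strip_estimate U' -> strip_estimate U.
Proof.
move=> UU [C [d0 [C0 d00 h]]]; exists C, d0; split => // delta dd s cs.
apply: le_trans (h _ dd s cs); apply: ge0_subset_integral; try exact: measurable_strip.
- by apply: measurable_sq_EFin; exact: Ck_continuous cs.
- by move=> x _; rewrite lee_fin sqr_ge0.
- exact: le_strip.
Qed.

Lemma strip_estimate0 : strip_estimate set0.
Proof.
exists 1, 1; split => // delta /andP[d0 _] s cs.
rewrite (_ : strip set0 delta = set0); last by apply/seteqP; split => // x [_ [y []]].
rewrite integral_set0 adde_ge0// mule_ge0//.
- by rewrite lee_fin mul1r ltW.
- exact: surface_integral_ge0.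
- by rewrite lee_fin mul1r sqr_ge0.
- by apply: integral_ge0 => x _; rewrite lee_fin grad_sq_ge0.
Qed.

Lemma strip_estimateU U U' : strip_estimate U -> strip_estimate U' ->
  strip_estimate (U `|` U').
Proof.
move=> [C [d0 [C0 d00 h]]] [C' [d0' [C0' d00' h']]].
exists (C + C'), (Num.min d0 d0'); split.
- by rewrite addr_gt0.
- by rewrite lt_min d00.
move=> delta; rewrite lt_min => /andP[dd /andP[dd1 dd2]] s cs.
have ms D : measurable_fun D (fun x => (s x ^+ 2)%:E).
  by apply: measurable_sq_EFin; exact: Ck_continuous cs.
have E : strip (U `|` U') delta `<=` strip U delta `|` (strip U' delta `\` strip U delta).
  move=> x [Ox [y [gy uy xy]]].
  have [hx|hx] := pselect (strip U delta x); [by left|right]; split => //.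
  case: uy => uy; last by split => //; exists y.
  by exfalso; apply: hx; split => //; exists y.
have mD : measurable (strip U' delta `\` strip U delta).
  by apply: measurableD; exact: measurable_strip.
have mU : measurable (strip U delta) by exact: measurable_strip.
apply: (@le_trans _ _ (\int[lambda]_(x in strip U delta) (s x ^+ 2)%:E +
   \int[lambda]_(x in strip U' delta) (s x ^+ 2)%:E)%E).
  apply: (@le_trans _ _ (\int[lambda]_(x in strip U delta `|` (strip U' delta `\` strip U delta)) (s x ^+ 2)%:E)%E).
    apply: ge0_subset_integral => //; try exact: measurable_strip.
      exact: measurableU.
    by move=> x _; rewrite lee_fin sqr_ge0.
  rewrite ge0_integral_setU//; last 2 first.
  - by move=> x _; rewrite lee_fin sqr_ge0.
  - by apply/disj_setPS => x [h1 [_ h2]].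
  apply: leeD => //; apply: ge0_subset_integral => //; try exact: measurable_strip.
  by move=> x _; rewrite lee_fin sqr_ge0.
have delta0 : 0 <= delta by rewrite ltW.
have g1 : C * delta <= (C + C') * delta by rewrite ler_wpM2r// lerDl ltW.
have g2 : C' * delta <= (C + C') * delta by rewrite ler_wpM2r// lerDr ltW.
have D1 : 0 < delta < d0 by rewrite dd.
have D2 : 0 < delta < d0' by rewrite dd.
apply: (@le_trans _ _ (((C * delta)%:E * \int[sigma]_(x in Gamma) (s x ^+ 2)%:E +
     (C * delta ^+ 2)%:E * \int[lambda]_(x in strip setT ((C + C') * delta)) (grad_sq s x)%:E) +
   ((C' * delta)%:E * \int[sigma]_(x in Gamma) (s x ^+ 2)%:E +
     (C' * delta ^+ 2)%:E * \int[lambda]_(x in strip setT ((C + C') * delta)) (grad_sq s x)%:E))%E).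
  apply: leeD.
    apply: le_trans (h _ D1 s cs) _; apply: leeD => //; apply: lee_wpmul2l; last exact: le_strip_grad.
    by rewrite lee_fin mulr_ge0 ?exprn_ge0// ltW.
  apply: le_trans (h' _ D2 s cs) _; apply: leeD => //; apply: lee_wpmul2l; last exact: le_strip_grad.
  by rewrite lee_fin mulr_ge0 ?exprn_ge0// ltW.
rewrite addeACA -!ge0_muleDl ?lee_fin ?mulr_ge0 ?exprn_ge0 ?(ltW C0) ?(ltW C0')//.
by rewrite -!EFinD -!mulrDl.
Qed.

Section chart.
Variables (x0 : V) (r L : R) (e : V) (g : V -> R).
Hypotheses (r0 : 0 < r) (e1 : enorm e = 1)
  (Lg : forall y z, `|g y - g z| <= L * enorm (y - z))
  (chart : forall x, enorm (x - x0) < r ->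
     (Omega x <-> g (x - dot x e *: e) < dot x e)).

Let tau (x : V) : R := dot x e - g (x - dot x e *: e).
(** A Lipschitz constant of [tau] for the sup norm: [n] for the component along [e], and
    [n * (1 + n)] for the projection orthogonal to [e], multiplied by [|L|] since no sign is imposed
    on [L]. *)
Let K : R := n%:R * (1 + `|L| * (1 + n%:R)).
Let r' : R := r / n%:R.
Let n0 : 0 < n%:R :> R. Proof. by rewrite ltr0n. Qed.
Let r'0 : 0 < r'. Proof. by rewrite /r' divr_gt0. Qed.
Let K0 : 0 < K. Proof. by rewrite /K mulr_gt0// ltr_pwDl// mulr_ge0// addr_ge0. Qed.

Let chart' x : `|x - x0| < r' -> (Omega x <-> 0 < tau x).
Proof.
move=> h; rewrite /tau subr_gt0; apply: chart; apply: le_lt_trans (enorm_le _) _.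
by rewrite -ltr_pdivlMl// mulrC.
Qed.

Let tau_lip x y : `|tau x - tau y| <= K * `|x - y|.
Proof.
rewrite /tau; set z := x - y.
have dz : `|dot z e| <= n%:R * `|z|.
  by apply: le_trans (dot_le z e) _; rewrite e1 mulr1 enorm_le.
rewrite (_ : _ - _ = dot z e - (g (x - dot x e *: e) - g (y - dot y e *: e))); last first.
  by rewrite /z dotBl; ring.
apply: le_trans (ler_normB _ _) _.
have E : (x - dot x e *: e) - (y - dot y e *: e) = z - dot z e *: e.
  by rewrite /z dotBl scalerBl !opprB addrACA [RHS]addrACA; congr (_ + _); rewrite addrC.
have hg : `|g (x - dot x e *: e) - g (y - dot y e *: e)| <= `|L| * (n%:R * (1 + n%:R) * `|z|).
  apply: le_trans (Lg _ _) _; rewrite E.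
  apply: (@le_trans _ _ (`|L| * enorm (z - dot z e *: e))).
    by rewrite ler_wpM2r ?enorm_ge0// ler_norm.
  rewrite ler_wpM2l//; apply: le_trans (enorm_le _) _.
  rewrite -mulrA ler_wpM2l//; apply: le_trans (ler_normB _ _) _; rewrite normrZ.
  have en : `|e| <= 1 by rewrite -e1 row_norm_le_enorm.
  have : `|dot z e| * `|e| <= n%:R * `|z| * 1 by apply: ler_pM.
  by rewrite mulr1 mulrDl mul1r => h; rewrite lerD2l.
apply: le_trans (lerD dz hg) _; rewrite /K le_eqVlt; apply/orP; left; apply/eqP; ring.
Qed.

(** Moving along [e] does not change the argument of [g]. *)
Let tau_shift x t : tau (x - t *: e) = tau x - t.
Proof.
have E : dot (x - t *: e) e = dot x e - t by rewrite dotBl dotZl dot_enorm1// mulr1.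
rewrite /tau E (_ : x - t *: e - (dot x e - t) *: e = x - dot x e *: e); first by ring.
by rewrite scalerBl opprB addrA subrK.
Qed.

Let en : `|e| <= 1. Proof. by rewrite -e1 row_norm_le_enorm. Qed.

Let continuous_tau : continuous tau.
Proof.
move=> x; apply/(@cvgrPdist_le _ _ _ (nbhs x) (nbhs_filter x)) => eps eps0; apply/nbhs_ballP; exists (eps / K) => /=.
  by rewrite divr_gt0.
move=> y; rewrite -ball_normE /= ltr_pdivlMr// mulrC => h.
exact: le_trans (tau_lip x y) (ltW h).
Qed.

(** By continuity of [tau], a positive height puts [y] in the interior of [Omega], and a negative
    one keeps a neighbourhood of [y] away from [Omega]. *)
Let boundary_tau y : Gamma y -> `|y - x0| < r' -> tau y = 0.
Proof.
move=> [cy iy] yr; apply: contrapT => /eqP.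
rewrite neq_lt => /orP[ty|ty]; last first.
  by apply: iy; apply: open_nbhs_nbhs; split => //; apply/chart'.
have n1 : nbhs y (tau @^-1` [set u | u < 0]).
  by apply: continuous_tau; exact: lt_nbhsl.
have n2 : nbhs y (ball x0 r').
  by apply: open_nbhs_nbhs; split; [exact: ball_open|rewrite -ball_normE /= distrC].
have [z [Oz [tz]]] := cy _ (filterI n1 n2); rewrite -ball_normE /= distrC => zr.
by move/(chart' zr): Oz; rewrite ltNge (ltW tz).
Qed.

Let tau_boundary p : tau p = 0 -> `|p - x0| < r' -> Gamma p.
Proof.
move=> tp pr; split; last first.
  by move=> /interior_subset /(chart' pr); rewrite tp ltxx.
move=> W /nbhs_ballP[d /= d0 hd].
pose t := Num.min (d / 2) ((r' - `|p - x0|) / 2).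
have q0 : 0 < r' - `|p - x0| by rewrite subr_gt0.
have t0 : 0 < t by rewrite /t lt_min !divr_gt0.
have td : t <= d / 2 by rewrite /t ge_min lexx.
have tr : t <= (r' - `|p - x0|) / 2 by rewrite /t ge_min lexx orbT.
have tn : `|t *: e| <= t by rewrite normrZ gtr0_norm// ler_piMr// ltW.
exists (p - (- t) *: e); split.
  apply/chart'; last by rewrite tau_shift tp sub0r opprK.
  rewrite scaleNr opprK addrAC (le_lt_trans (ler_normD _ _))//; lra.
apply: hd; rewrite -ball_normE /= scaleNr opprK opprD addNKr normrN; lra.
Qed.

(* [tau] is the height above the graph.  The values of [s] at [x] and at its
   projection [P x = x - tau x *: e] on [Gamma] differ by a line integral of the
   gradient. *)
Lemma strip_estimate_chart : strip_estimate [set y | `|y - x0| < r' / 4].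
Proof.
set U := mkset _.
pose C1 : R := 2 * 4 ^+ n.
have C10 : 0 < C1 by rewrite /C1 mulr_gt0// exprn_gt0.
(* The summands serve in turn the boundary term, the gradient term and the width of the larger
   strip; the last one makes [K < C] strict. *)
pose C := 2 * C1 * K + 2 * K ^+ 2 + K + 1.
have C0 : 0 < C.
  by rewrite /C !addr_gt0// ?mulr_gt0// exprn_gt0.
(* This gives [delta + T < r' / 4] for [T = K * delta], so that points of the strip, and their
   translates by at most [T] along the axis, stay in the chart. *)
exists C, (r' / 4 / (1 + K)); split => //.
  by rewrite !divr_gt0// ltr_pwDl// ltW.
move=> delta /andP[d0]; rewrite ltr_pdivlMr ?addr_gt0// => dr s cs.
pose T := K * delta.
have T0 : 0 < T by rewrite mulr_gt0.
have dT : delta + T < r' / 4 by rewrite /T; move: dr; rewrite mulrDr mulr1 (mulrC delta).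
have r'p : 0 < r' by [].
pose E := strip U delta.
have mE : measurable E by exact: measurable_strip.
have KC : K < C.
  have h1 : 0 < 2 * C1 * K by rewrite !mulr_gt0.
  have h2 : 0 < 2 * K ^+ 2 by rewrite mulr_gt0// exprn_gt0.
  by rewrite /C; move: (2 * C1 * K) (2 * K ^+ 2) h1 h2 => u v h1 h2; lra.
have inE x : E x -> [/\ Omega x, 0 < tau x, tau x <= T & `|x - x0| < r' / 4 + delta].
  move=> [Ox [y [gy uy xy]]].
  have xr : `|x - x0| < r' / 4 + delta.
    rewrite (_ : x - x0 = (x - y) + (y - x0)); last by rewrite addrA subrK.
    by apply: le_lt_trans (ler_normD _ _) _; rewrite addrC ltrD.
  have xr' : `|x - x0| < r' by apply: lt_trans xr _; move: (r') (T) r'p T0 d0 dT => u v *; lra.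
  have yr : `|y - x0| < r' by apply: lt_trans uy _; move: (r') r'p => u *; lra.
  split => //; first exact/(chart' xr').
  have := tau_lip x y; rewrite (boundary_tau gy yr) subr0 => /(le_trans (ler_norm _)) h.
  by apply: le_trans h _; rewrite /T ler_pM2l// ltW.
have near_shift x t : E x -> 0 <= t <= T -> `|x - t *: e - x0| < r'.
  move=> /inE[_ _ _ xr] /andP[t0 tT].
  rewrite addrAC; apply: le_lt_trans (ler_normB _ _) _; rewrite normrZ (ger0_norm t0).
  have : t * `|e| <= T by apply: le_trans tT; rewrite ler_piMr.
  move: (r') (T) (t * `|e|) xr r'p T0 d0 dT => u v w *; lra.
pose P x := x - tau x *: e.
have GP x : E x -> Gamma (P x).
  move=> Ex; have [Ox t0 tT _] := inE x Ex; apply: tau_boundary.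
    by rewrite /P tau_shift subrr.
  by apply: near_shift => //; rewrite ltW.
have shift_strip x t : E x -> 0 <= t -> t < tau x -> strip setT (C * delta) (x - t *: e).
  move=> Ex t0 tt; have [Ox tx0 tT _] := inE x Ex.
  have tT' : t <= T by apply: le_trans tT; exact: ltW.
  have xs : `|x - t *: e - x0| < r' by apply: near_shift => //; rewrite t0.
  split; first by apply/(chart' xs); rewrite tau_shift subr_gt0.
  exists (P x); split => //; first exact: GP.
  rewrite (_ : _ - P x = (tau x - t) *: e); last first.
    by rewrite /P opprB addrC addrA subrK -scalerBl.
  rewrite normrZ ger0_norm ?subr_ge0 ?ltW//.
  apply: (@le_lt_trans _ _ T); last by rewrite /T ltr_pM2r.
  by apply: (@le_trans _ _ (tau x - t)); [rewrite ler_piMr// subr_ge0 ltW|lra].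
have mP : measurable_fun [set: V] P.
  apply: measurable_fun_row => i; under eq_fun do rewrite !mxE.
  apply: measurable_funB; first exact: measurable_coord.
  by apply: measurable_funM => //; apply: continuous_measurable_row.
pose G : V -> \bar R := (fun x => (grad_sq s x)%:E) \_ (strip setT (C * delta)).
have mG : measurable_fun setT G.
  apply/(measurable_restrictT _ _).1; first exact: measurable_strip.
  exact: measurable_grad_sq.
have G0 x : (0 <= G x)%E by rewrite /G /patch; case: ifP => //; rewrite lee_fin grad_sq_ge0.
have cs0 := Ck_continuous cs.
have msq (f : V -> R) D : measurable_fun setT f -> measurable_fun D (fun x => (f x ^+ 2)%:E).
  move=> mf; apply/measurable_EFinP; apply: measurable_funX.
  exact: (measurable_funS measurableT).
have ms : measurable_fun setT s by exact: continuous_measurable_row.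
have msP : measurable_fun setT (s \o P) by exact: measurableT_comp.
pose I (x : V) := (\int[@lebesgue_measure R]_(t in `[0%R, T]) G (x - t *: e)%R)%E.
have I0 x : (0 <= I x)%E by apply: integral_ge0.
have mI : measurable_fun setT I by exact: measurable_shift_integral.
have pointwise x : E x -> ((s x ^+ 2)%:E <= (2 * s (P x) ^+ 2)%:E + (2 * T)%:E * I x)%E.
  move=> Ex; have [Ox t0 tT _] := inE x Ex.
  apply: (@le_trans _ _ ((2 * s (P x) ^+ 2)%:E + 2%:E * ((s x - s (P x)) ^+ 2)%:E)%E).
    by rewrite -EFinM -EFinD lee_fin; move: (s x) (s (P x)) => u v; have := sqr_ge0 (u - 2 * v); lra.
  apply: leeD => //; rewrite [(2 * T)%:E]EFinM -muleA; apply: lee_wpmul2l => //.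
  have := C1_line_integral x e cs (ltW t0); rewrite -/(P x) => /le_trans; apply.
  apply: (@le_trans _ _ ((tau x)%:E * I x)%E); last by apply: lee_wpmul2r.
  apply: lee_wpmul2l; first by rewrite lee_fin ltW.
  have cline : continuous (fun t : R => x - t *: e).
    move=> t; apply: (@cvgB R V _ (nbhs t) _ (cst x) (fun t => t *: e)); first exact: cvg_cst.
    by apply: cvgZr_tmp; exact: cvg_id.
  have mline : measurable_fun [set: measurableTypeR R] (fun t : R => x - t *: e).
    apply: measurable_fun_row => i; under eq_fun do rewrite !mxE.
    by apply: measurable_funB => //; apply: measurable_funM.
  have msum (D : set (measurableTypeR R)) :
      measurable_fun D (fun t : R => ((\sum_i e ord0 i * partial i s (x - t *: e)) ^+ 2)%:E).
    apply/measurable_EFinP; apply: measurable_funX; apply: measurable_sum => i.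
    apply: measurable_funM => //.
    apply: (measurable_funS measurableT) => //; apply: (measurableT_comp _ mline).
    by apply: continuous_measurable_row; case: cs => _ /(_ i)[].
  (* The endpoint [t = tau x] gives the point [P x] of [Gamma], which is not in the strip; it is
     removed as a null set. *)
  rewrite -integral_itv_bndo_bndc; last exact: msum.
  apply: (@le_trans _ _ (\int[@lebesgue_measure R]_(t in `[0%R, tau x[) G (x - t *: e)%R)%E).
    apply: ge0_le_integral => //.
    - by move=> t _; rewrite lee_fin sqr_ge0.
    - by apply: (measurable_funS measurableT) => //; exact: (measurableT_comp mG mline).
    - move=> t /=; rewrite in_itv/= => /andP[u0 u1].
      rewrite /G patchE mem_set; last exact: shift_strip.
      rewrite lee_fin -real_normK ?num_real//.
      have := cauchy_sum (fun i => e ord0 i) (fun i => partial i s (x - t *: e)).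
      have -> : Num.sqrt (\sum_i e ord0 i ^+ 2) = 1.
        by rewrite -e1; congr Num.sqrt; apply: eq_bigr => i _; rewrite expr2.
      rewrite mul1r => h.
      rewrite -[leRHS]sqr_sqrtr ?grad_sq_ge0// lerXn2r ?nnegrE// sqrtr_ge0.
  apply: ge0_subset_integral => //.
    by apply: (measurable_funS measurableT) => //; exact: (measurableT_comp mG mline).
  by move=> t /=; rewrite !in_itv/= => /andP[-> /ltW h]; exact: le_trans tT.
apply: (@le_trans _ _ (\int[lambda]_(x in E) ((2 * s (P x) ^+ 2)%:E + (2 * T)%:E * I x))%E).
  apply: ge0_le_integral => //.
  - by move=> x _; rewrite lee_fin sqr_ge0.
  - exact: msq.
  - apply: emeasurable_funD.
      apply/measurable_EFinP; apply: measurable_funM => //; apply: measurable_funX.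
      exact: (measurable_funS measurableT).
    by apply: measurable_funeM; exact: (measurable_funS measurableT).
rewrite ge0_integralD//; last 4 first.
- by move=> x _; rewrite lee_fin mulr_ge0// sqr_ge0.
- apply/measurable_EFinP; apply: measurable_funM => //; apply: measurable_funX.
  exact: (measurable_funS measurableT).
- by move=> x _; rewrite mule_ge0// lee_fin mulr_ge0// ltW.
- by apply: measurable_funeM; exact: (measurable_funS measurableT).
apply: leeD.
  under eq_integral do rewrite EFinM.
  rewrite ge0_integralZl//; last 2 first.
  - exact: msq.
  - by move=> x _; rewrite lee_fin sqr_ge0.
  have := @ge0_integral_image_le _ _ R lambda _ V _ (caratheodory_type (@hausdorff R n k))
     sigma P (fun x => x) E Gamma (C1 * T) (fun x => (s x ^+ 2)%:E) mE
     (measurable_surface measurable_boundary) mP (@measurable_surface_id R n).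
  move=> h; apply: (@le_trans _ _ (2%:E * ((C1 * T)%:E * \int[sigma]_(x in Gamma) (s x ^+ 2)%:E))%E).
    apply: lee_wpmul2l => //; apply: h.
    - by rewrite mulr_ge0// ltW.
    - exact: msq.
    - by move=> x; rewrite lee_fin sqr_ge0.
    (* The points of [E] that [P] sends into [A] lie in the tube of height [T] along [e] over the
       part of [Gamma] in [A]. *)
    - move=> A mA; apply: (thickening_le k0 e1 T0).
        by apply: measurableI => //; rewrite -[X in measurable X]setTI; exact: mP.
      move=> x [Ex Ax]; have [_ t0 tT _] := inE x Ex.
      by exists (tau x); [rewrite ltW|split; [exact: GP|exact: Ax]].
  rewrite muleA -EFinM; apply: lee_wpmul2r; first exact: surface_integral_ge0.
  rewrite lee_fin /T mulrA mulrA mulrA ler_pM2r// /C.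
  have K2 : 0 < 2 * K ^+ 2 by rewrite mulr_gt0// exprn_gt0.
  move: (2 * C1 * K) => u; move: (2 * K ^+ 2) K2 => v hv; move: (K) K0 => w hw; lra.
rewrite ge0_integralZl//; last 2 first.
- exact: (measurable_funS measurableT).
- by rewrite lee_fin mulr_ge0// ltW.
apply: (@le_trans _ _ ((2 * T)%:E * (T%:E * \int[lambda]_x G x))%E).
  apply: lee_wpmul2l; first by rewrite lee_fin mulr_ge0// ltW.
  rewrite -(shift_tonelli e (ltW T0) mG G0).
  exact: ge0_subset_integral.
rewrite muleA -EFinM -integral_mkcond; apply: lee_wpmul2r.
  by apply: integral_ge0 => x _; rewrite lee_fin grad_sq_ge0.
rewrite lee_fin /T (_ : 2 * (K * delta) * (K * delta) = 2 * K ^+ 2 * delta ^+ 2); last by ring.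
rewrite ler_pM2r ?exprn_gt0// /C.
have : 0 < 2 * C1 * K by rewrite !mulr_gt0.
have K2 : 0 < 2 * K ^+ 2 by rewrite mulr_gt0// exprn_gt0.
move: (2 * C1 * K) => u hu; move: (2 * K ^+ 2) K2 => v hv; move: (K) K0 => w hw; lra.
Qed.
End chart.
End strip.

(** * Energy of Sobolev functions on a bounded domain *)

Section bounded_domain.
Variables (R : realType) (k : nat).
Local Notation n := k.+1.
Local Notation V := 'rV[R]_n.
Local Notation lambda := (lebesgue_row R n).
Variables (Omega : set V) (oO : open Omega) (bO : bounded_set Omega).
Implicit Types (f g : V -> R) (u v : sobolev R n).

Lemma bounded_closure : bounded_set (closure Omega).
Proof.
case: bO => M [Mr hM]; exists M; split => // x Mx.
have cl : closed [set y : V | `|y| <= x].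
  apply: (@closed_comp _ _ (fun y : V => `|y|) [set t | t <= x]); last exact: closed_le.
  by move=> y _; exact: norm_continuous.
by rewrite closureE; apply: smallest_sub => // y Oy; exact: hM Mx _ Oy.
Qed.

Lemma compact_closure : compact (closure Omega).
Proof. by apply: bounded_closed_compact; [exact: bounded_closure|exact: closed_closure]. Qed.

Lemma compact_boundary : compact (boundary Omega).
Proof.
apply: bounded_closed_compact; last exact: closed_boundary.
case: bounded_closure => M [Mr hM]; exists M; split => // x Mx y [cy _].
exact: hM Mx _ cy.
Qed.

Lemma measurable_domain : measurable Omega.
Proof. exact: open_measurable_row. Qed.

Lemma continuous_bounded_on (f : V -> R) : continuous f ->
  [bounded f x | x in Omega].
Proof.
move=> cf.
have : compact (f @` closure Omega).
  by apply: continuous_compact; [exact: continuous_subspaceT|exact: compact_closure].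
move=> /compact_bounded[M [Mr hM]]; exists M; split => // x Mx y Oy.
by apply: (hM x Mx); exists y => //; exact: subset_closure.
Qed.

Lemma L2_continuous (f : V -> R) : continuous f -> L2 lambda Omega f.
Proof.
move=> cf; have mO := measurable_domain; split.
  by apply: (measurable_funS measurableT) => //; exact: continuous_measurable_row.
have cf2 : continuous (fun x => f x ^+ 2).
  by have := continuous_mulf cf cf; congr (continuous _); apply/funext => x; rewrite expr2.
apply: measurable_bounded_integrable => //.
- exact: lebesgue_row_bounded.
- by apply: (measurable_funS measurableT) => //; exact: continuous_measurable_row.
- exact: continuous_bounded_on.
Qed.

Definition energy (u : sobolev R n) (x : V) : R := u.1 x ^+ 2 + \sum_i u.2 i x ^+ 2.

(** The integrability half of [H1], which is all that norms require; it covers [of_smooth f] without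
    a proof that its partial derivatives are weak derivatives. *)
Definition H1L2 (u : sobolev R n) : Prop :=
  L2 lambda Omega u.1 /\ forall i, L2 lambda Omega (u.2 i).

Lemma energy_ge0 u x : 0 <= energy u x.
Proof. by rewrite addr_ge0 ?sqr_ge0// sumr_ge0// => i _; rewrite sqr_ge0. Qed.

Lemma integrable_energy u : H1L2 u -> lambda.-integrable Omega (EFin \o energy u).
Proof.
have mO := measurable_domain.
move=> [[_ h1] h2].
have hs : lambda.-integrable Omega (EFin \o (fun x => \sum_i u.2 i x ^+ 2)).
  have := integrable_sum mO (index_enum 'I_n) (P := xpredT) (h := fun i x => (u.2 i x ^+ 2)%:E)
    (fun i _ => (h2 i).2).
  by apply: eq_integrable => // x _; rewrite /= sumEFin.
by have := integrableD mO h1 hs; apply: eq_integrable => // x _.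
Qed.

Lemma measurable_energy u : H1L2 u -> measurable_fun Omega (EFin \o energy u).
Proof. by move=> /integrable_energy/measurable_int. Qed.

Lemma h1norm_sqE u : H1L2 u ->
  ((h1norm Omega u ^+ 2)%:E = \int[lambda]_(x in Omega) (energy u x)%:E)%E.
Proof.
move=> hu; have iu := integrable_energy hu; case: (hu) => h1 h2.
have mO := measurable_domain.
have gE : grad_norm Omega u ^+ 2 = \sum_i nrm lambda Omega (u.2 i) ^+ 2.
  by rewrite /grad_norm sqr_sqrtr// sumr_ge0// => i _; rewrite sqr_ge0.
rewrite /h1norm sqr_sqrtr ?addr_ge0 ?sqr_ge0// gE.
rewrite -[l2norm Omega u.1]/(nrm lambda Omega u.1) nrm_sq.
under eq_bigr do rewrite nrm_sq.
rewrite -Rintegral_sum//; last by move=> i; case: (h2 i).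
have hs : lambda.-integrable Omega (EFin \o (fun x => \sum_i u.2 i x ^+ 2)).
  have := integrable_sum mO (index_enum 'I_n) (P := xpredT) (h := fun i x => (u.2 i x ^+ 2)%:E)
    (fun i _ => (h2 i).2).
  by apply: eq_integrable => // x _; rewrite /= sumEFin.
rewrite -RintegralD//; last by case: h1.
rewrite /Rintegral fineK//; exact: (integrable_fin_num mO iu).
Qed.

Lemma h1norm_ge0 (u : sobolev R n) : 0 <= h1norm Omega u.
Proof. exact: sqrtr_ge0. Qed.

Lemma h1norm_le_energy u (eps : R) : H1L2 u -> 0 <= eps ->
  (\int[lambda]_(x in Omega) (energy u x)%:E <= (eps ^+ 2)%:E)%E ->
  h1norm Omega u <= eps.
Proof.
move=> hu e0; rewrite -h1norm_sqE// lee_fin.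
by rewrite ler_pXn2r// nnegrE h1norm_ge0.
Qed.

Lemma H1L2_B u v : H1L2 u -> H1L2 v -> H1L2 (u - v).
Proof.
have mO := measurable_domain.
move=> [u1 u2] [v1 v2]; split; first exact: (L2_B mO u1 v1).
by move=> i; exact: (L2_B mO (u2 i) (v2 i)).
Qed.

Lemma H1L2_of_smooth f : smooth f -> H1L2 (of_smooth f).
Proof.
move=> sf; split; first by apply: L2_continuous; exact: Ck_continuous (sf 0%N).
move=> i; apply: L2_continuous; by case: (sf 1%N) => _ /(_ i)[].
Qed.

Lemma H1_L2 u : H1 Omega u -> H1L2 u.
Proof. by move=> [u1 u2]; split => // i; case: (u2 i). Qed.

Lemma smooth_B f g : smooth f -> smooth g -> smooth (fun x => f x - g x).
Proof.
move=> sf sg m; rewrite (_ : (fun x => _) = fun x => f x + (-1) * g x).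
  by apply: Ck_D => //; apply: Ck_M => //; exact: Ck_cst.
by apply/funext => x; rewrite mulN1r.
Qed.

Lemma partial_B f g i x : smooth f -> smooth g ->
  partial i (fun x => f x - g x) x = partial i f x - partial i g x.
Proof.
move=> sf sg; have [_ /(_ i)[df _]] := sf 1%N; have [_ /(_ i)[dg _]] := sg 1%N.
exact: (deriveB (df x) (dg x)).
Qed.

Lemma partial_M f g i x : smooth f -> smooth g ->
  partial i (fun x => f x * g x) x = f x * partial i g x + g x * partial i f x.
Proof.
move=> sf sg; have [_ /(_ i)[df _]] := sf 1%N; have [_ /(_ i)[dg _]] := sg 1%N.
exact: (deriveM (df x) (dg x)).
Qed.

(** Fermat's rule, meant for a cut-off at the points where it equals [1]: its gradient vanishes
    there, even if it is not constant nearby. *)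
Lemma partial_max0 f i x : smooth f -> (forall y, f y <= f x) -> partial i f x = 0.
Proof.
move=> sf fx; have [_ /(_ i)[df _]] := sf 1%N.
pose phi (t : R) := f (t *: delta_mx ord0 i + x).
have dphi (t : R) : derivable phi t 1.
  have /is_derive_line := derivableP (df (t *: delta_mx ord0 i + x)).
  rewrite (_ : (fun h => f _) = (fun h : R => phi (h *: 1 + t))); last first.
    by apply/funext => h; rewrite /phi scalerDl addrA -[h *: 1]/(h * 1) mulr1.
  by move=> h; have [] := (is_derive_line phi t 1 _).2 h.
have h1 : -1 <= 1 :> R by lra.
have h2 : 0 \in `](-1 : R), 1[ by rewrite in_itv/=; apply/andP; split; lra.
have h3 t : t \in `](-1 : R), 1[ -> phi t <= phi 0.
  by move=> _; rewrite /phi scale0r add0r.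
have h := @derive1_at_max R phi (-1) 1 0 h1 (fun t _ => dphi t) h2 h3.
by have [] := (is_derive_line f x (delta_mx ord0 i) 0).2 h.
Qed.

(** A point of the open set [Omega] is at positive distance from the boundary, so the complements of
    the strips increase to [Omega]; monotone convergence and the finiteness of the total energy
    conclude. *)
Lemma strip_energy_small u (eps : R) : H1L2 u -> 0 < eps ->
  exists2 delta, 0 < delta &
   (\int[lambda]_(x in strip Omega setT delta) (energy u x)%:E <= eps%:E)%E.
Proof.
move=> hu e0; have mO := measurable_domain.
have iu := integrable_energy hu; have mu := measurable_energy hu.
pose S j := strip Omega setT (j.+1%:R^-1 : R).
pose F j := Omega `\` S j.
have mS j : measurable (S j) by exact: measurable_strip.
have mF j : measurable (F j) by exact: measurableD.
have SO j : S j `<=` Omega by move=> x [].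
have FO j : F j `<=` Omega by move=> x [].
have UF : \bigcup_j F j = Omega.
  apply/seteqP; split => [x [j _ []]//|x Ox].
  have : nbhs x Omega by exact: open_nbhs_nbhs.
  move=> /nbhs_ballP[r /= r0 xr].
  have [j _ /(_ j (leqnn j)) jr] := near_infty_natSinv_lt (PosNum r0).
  have jr' : j.+1%:R^-1 < r by [].
  exists j => //; split => // -[_ [y [[_ iy] _ xy]]]; apply: iy.
  apply: open_nbhs_nbhs; split => //; apply: xr; rewrite -ball_normE /=.
  exact: lt_trans jr'.
have cv := @ge0_nondecreasing_set_cvg_integral _ _ R F (EFin \o energy u) lambda.
have {cv} := cv _ mF _ _.
have h1 : {homo F : n m / (n <= m)%N >-> (n <= m)%O}.
  move=> i j ij; apply/subsetPset => x [Ox nS]; split => // Sx; apply: nS.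
  by apply: le_strip Sx => //; rewrite lef_pV2 ?posrE ?ltr0n// ler_nat.
have h2 i : measurable_fun (F i) (EFin \o energy u) by exact: (measurable_funS mO).
have h3 i x : F i x -> (0 <= (EFin \o energy u) x)%E by rewrite lee_fin energy_ge0.
move=> /(_ h1 h2 h3); rewrite UF => cv.
have fin := integrable_fin_num mO iu.
set I := (\int[lambda]_(x in Omega) _)%E in cv fin.
have : nbhs I [set y | (I - eps%:E < y)%E].
  apply: open_nbhs_nbhs; split; first exact: open_ereal_gt_ereal.
  by rewrite /= -[ltRHS]adde0 lteD2lE// lte_fin oppr_lt0.
move=> /cv [j _ /(_ j (leqnn j))] /= hj.
exists (j.+1%:R^-1) => //.
have E : I = (\int[lambda]_(x in F j) (EFin \o energy u) x + \int[lambda]_(x in S j) (EFin \o energy u) x)%E.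
  rewrite -ge0_integral_setU//; last 3 first.
  - by rewrite setDKU//; exact: SO.
  - by move=> x _; rewrite lee_fin energy_ge0.
  - by apply/disj_setPS => x [[_ h] /h].
  by rewrite setDKU//; exact: SO.
have finF : (\int[lambda]_(x in F j) (EFin \o energy u) x)%E \is a fin_num.
  by apply: (integrable_fin_num (mF j)); exact: (integrableS mO).
have finS : (\int[lambda]_(x in S j) (EFin \o energy u) x)%E \is a fin_num.
  by apply: (integrable_fin_num (mS j)); exact: (integrableS mO).
rewrite -[leLHS]/(\int[lambda]_(x in S j) (EFin \o energy u) x)%E.
move: hj; rewrite E -(fineK finF) -(fineK finS) -!EFinD lte_fin lee_fin; lra.
Qed.

End bounded_domain.

(** * Functions with zero trace *)

(** Used with [E] the cut-off, [a] and [b] values or derivatives of the smooth approximation and of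
    [w], and [c] the term with the gradient of the cut-off. The error splits as
    [E * (a - b) + (E - 1) * b + c]. *)
Lemma sqr_cutoff_le (R : realType) (E a b c : R) : 0 <= E <= 1 ->
  (E * a + c - b) ^+ 2 <= 3 * (a - b) ^+ 2 + 3 * b ^+ 2 + 3 * c ^+ 2.
Proof.
move=> /andP[E0 E1].
rewrite (_ : E * a + c - b = E * (a - b) + (E - 1) * b + c); last by ring.
have h1 : (E * (a - b)) ^+ 2 <= (a - b) ^+ 2.
  by rewrite exprMn ler_piMl ?sqr_ge0// exprn_ile1.
have h2 : ((E - 1) * b) ^+ 2 <= b ^+ 2.
  rewrite exprMn ler_piMl ?sqr_ge0//.
  by rewrite -sqrrN opprB expr2 mulr_ile1//; lra.
move: (E * (a - b)) h1 => p h1; move: ((E - 1) * b) h2 => q h2; move: (a - b) h1 => r h1.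
by have := sqr_ge0 (p - q); have := sqr_ge0 (p - c); have := sqr_ge0 (q - c); lra.
Qed.

Lemma ge0_integral_sqrB_le d (T : measurableType d) (R : realType)
    (mu : {measure set T -> \bar R}) (D : set T) (f g : T -> R) :
  measurable D -> measurable_fun D f -> measurable_fun D g ->
  (\int[mu]_(x in D) ((f x - g x) ^+ 2)%:E <=
   2%:E * \int[mu]_(x in D) (f x ^+ 2)%:E + 2%:E * \int[mu]_(x in D) (g x ^+ 2)%:E)%E.
Proof.
move=> mD mf mg.
have sq (h : T -> R) : measurable_fun D h -> measurable_fun D (fun x => (h x ^+ 2)%:E).
  by move=> mh; apply/measurable_EFinP; exact: measurable_funX.
have sq0 (h : T -> R) x : (0 <= (h x ^+ 2)%:E)%E by rewrite lee_fin sqr_ge0.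
have mf2 := sq f mf; have mg2 := sq g mg.
rewrite -!ge0_integralZl//.
rewrite -ge0_integralD//; last 4 first.
- by move=> x _; rewrite mule_ge0.
- exact: measurable_funeM.
- by move=> x _; rewrite mule_ge0.
- exact: measurable_funeM.
apply: (ge0_le_integral mu mD).
- by move=> x _; rewrite lee_fin sqr_ge0.
- by apply: (sq (fun x => f x - g x)); exact: measurable_funB.
- by apply: emeasurable_funD; exact: measurable_funeM.
move=> x _; rewrite -!EFinM -EFinD lee_fin.
by have := sqr_ge0 (f x + g x); lra.
Qed.

Section zero_trace.
Variables (R : realType) (k : nat) (k0 : (0 < k)%N).
Local Notation n := k.+1.
Local Notation V := 'rV[R]_n.
Local Notation lambda := (lebesgue_row R n).
Local Notation sigma := (surface_measure R n).
Variables (Omega : set V) (dom : bounded_lipschitz_domain Omega).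
Local Notation Gamma := (boundary Omega).
Implicit Types (f g : V -> R) (u v w : sobolev R n).

Let oO : open Omega. Proof. by case: dom. Qed.
Let bO : bounded_set Omega. Proof. by case: dom. Qed.
Let mO : measurable Omega. Proof. exact: measurable_domain. Qed.

Lemma strip_estimate_domain : strip_estimate Omega setT.
Proof.
have [_ _ _ _ lip] := dom.
have /choice[rho hrho] : forall x0, exists rho : R, Gamma x0 ->
    0 < rho /\ strip_estimate Omega [set y | `|y - x0| < rho].
  move=> x0; have [gx0|] := pselect (Gamma x0); last by exists 0.
  have [r [L [e [g [r0 e1 Lg ch]]]]] := lip x0 gx0.
  exists (r / n%:R / 4) => _; split; first by rewrite !divr_gt0// ltr0n.
  exact: (strip_estimate_chart k0 oO r0 e1 Lg ch).
have key (s : seq V) : {subset s <= Gamma} ->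
    strip_estimate Omega (\bigcup_(x in [set` s]) ball x (rho x)).
  elim: s => [|x s ih] sG.
    rewrite (_ : bigcup _ _ = set0); first exact: strip_estimate0.
    by apply/seteqP; split => // x [y].
  have xG : Gamma x by move: (sG x (mem_head _ _)); rewrite inE.
  have {}ih := ih (fun y ys => sG y (mem_behead (s := x :: s) ys)).
  apply: (strip_estimate_sub oO _ (strip_estimateU oO (hrho x xG).2 ih)).
  move=> y [_ [z]] /=; rewrite inE => /orP[/eqP ->|zs] bz.
    by left; move: bz; rewrite -ball_normE /= distrC.
  by right; exists z.
have := compact_boundary bO; rewrite compact_cover.
move=> /(_ V Gamma (fun x => ball x (rho x))) [].
- by move=> x _; exact: ball_open.
- by move=> x gx; exists x => //; have [? _] := hrho x gx; exact: ballxx.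
move=> D' DG cov.
have DG' : {subset (finmap.enum_fset D') <= Gamma} by move=> x xD; have := DG x xD.
apply: (strip_estimate_sub oO _ (key _ DG')) => x [gx _].
by have [y yD xy] := cov x gx; exists y.
Qed.

Lemma ge0_integral_energy_le (S : set V) u v w (a b : R) : measurable S -> S `<=` Omega ->
  H1L2 Omega u -> H1L2 Omega v -> H1L2 Omega w -> 0 <= a -> 0 <= b ->
  (forall x, S x -> energy u x <= a * energy v x + b * energy w x) ->
  (\int[lambda]_(x in S) (energy u x)%:E <=
   a%:E * \int[lambda]_(x in S) (energy v x)%:E + b%:E * \int[lambda]_(x in S) (energy w x)%:E)%E.
Proof.
move=> mS SO hu hv hw a0 b0 h.
have me z : H1L2 Omega z -> measurable_fun S (fun x => (energy z x)%:E).
  by move=> hz; apply: (measurable_funS mO) => //; exact: measurable_energy.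
have e0 z x : (0 <= (energy z x)%:E)%E by rewrite lee_fin energy_ge0.
rewrite -!ge0_integralZl//; try exact: me.
rewrite -ge0_integralD//; last 4 first.
- by move=> x _; rewrite mule_ge0.
- by apply: measurable_funeM; exact: me.
- by move=> x _; rewrite mule_ge0.
- by apply: measurable_funeM; exact: me.
apply: ge0_le_integral => //.
- exact: me.
- by apply: emeasurable_funD; apply: measurable_funeM; exact: me.
Qed.

(** Away from the strip the cut-off is [1] with zero gradient, and the error is that of [d]. In the
    strip the only dangerous term is [d] times the gradient of the cut-off; the strip estimate
    bounds it by the boundary integral over [delta] and the gradient of [d] in a wider strip, which
    is compared with that of [w]. *)
Lemma cutoff_energy : exists A C' delta1 : R, [/\ 0 < A, 0 < C', 0 < delta1 &
  forall w, H1L2 Omega w -> forall delta, 0 < delta < delta1 -> forall d : V -> R, smooth d ->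
  exists2 phi : V -> R, test_function Omega phi &
   (\int[lambda]_(x in Omega) (energy (of_smooth phi - w) x)%:E <=
    A%:E * \int[lambda]_(x in Omega) (energy (of_smooth d - w) x)%:E +
    A%:E * \int[lambda]_(x in strip Omega setT (C' * delta)) (energy w x)%:E +
    (A / delta)%:E * \int[sigma]_(x in Gamma) (d x ^+ 2)%:E)%E].
Proof.
have [K [M [K0 M0 cut]]] := cutoff R n.
have [C [delta1 [C0 delta10 est]]] := strip_estimate_domain.
pose B := M * K.
have B0 : 0 < B by rewrite mulr_gt0.
(* The factor [3 * n * (B / delta) ^+ 2] of the dangerous term times the [C * delta ^+ 2] of the
   strip estimate: the powers of [delta] cancel. *)
pose D := 3 * n%:R * B ^+ 2 * C.
have D0 : 0 < D by rewrite !mulr_gt0// ?exprn_gt0// ltr0n.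
exists (4 + 2 * D), (1 + C), delta1; split => //.
- by rewrite addr_gt0// mulr_gt0.
- by rewrite addr_gt0.
move=> w hw delta /andP[delta0 dd1] d sd.
(* At this scale the cut-off equals [1] at distance at least [delta] from the boundary, and its
   partial derivatives are at most [M * K / delta]. *)
have h0 : 0 < delta / K by rewrite divr_gt0.
have [eta [teta eta01 eta1 deta]] := cut Omega _ oO bO h0.
have seta : smooth eta by case: teta.
exists (fun x => eta x * d x).
  have [_ ce sube] := teta.
  have sub : closure [set x | eta x * d x != 0] `<=` closure [set x | eta x != 0].
    by apply: closureS => x /=; apply: contra_neq => ->; rewrite mul0r.
  split.
  - by move=> m; apply: Ck_M; [exact: seta|exact: sd].
  - by apply: (subclosed_compact _ ce sub); exact: closed_closure.
  - exact: subset_trans sube.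
set phi := fun x => eta x * d x.
have sphi : smooth phi by move=> m; apply: Ck_M; [exact: seta|exact: sd].
have hd : H1L2 Omega (of_smooth d - w) by apply: H1L2_B => //; exact: H1L2_of_smooth.
have hp : H1L2 Omega (of_smooth phi - w) by apply: H1L2_B => //; exact: H1L2_of_smooth.
pose S := strip Omega setT delta.
have mS : measurable S by exact: measurable_strip.
have SO : S `<=` Omega by move=> x [].
have mOS : measurable (Omega `\` S) by exact: measurableD.
have e0 z x : (0 <= (energy z x)%:E)%E by rewrite lee_fin energy_ge0.
have me z S' : S' `<=` Omega -> H1L2 Omega z -> measurable_fun S' (fun x => (energy z x)%:E).
  by move=> SO' hz; apply: (measurable_funS mO) => //; exact: measurable_energy.
set X := (\int[lambda]_(x in Omega) (energy (of_smooth d - w) x)%:E)%E.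
set Y := (\int[lambda]_(x in strip _ _ _) (energy w x)%:E)%E.
set Z := (\int[sigma]_(x in Gamma) _)%E.
have X0 : (0 <= X)%E by apply: integral_ge0.
have Y0 : (0 <= Y)%E by apply: integral_ge0.
have Z0 : (0 <= Z)%E by apply: integral_ge0 => x _; rewrite lee_fin sqr_ge0.
have out : (\int[lambda]_(x in Omega `\` S) (energy (of_smooth phi - w) x)%:E <= X)%E.
  apply: (@le_trans _ _ (\int[lambda]_(x in Omega `\` S) (energy (of_smooth d - w) x)%:E)%E); last first.
    by apply: ge0_subset_integral => //; exact: me.
  apply: ge0_le_integral => //; try by apply: me => // x [].
  move=> x [Ox nS]; rewrite lee_fin.
  have ex : eta x = 1.
    apply: eta1 => // y gy; rewrite mulrCA divff ?gt_eqF// mulr1 leNgt; apply/negP => h.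
    by apply: nS; split => //; exists y.
  have dex i : partial i eta x = 0.
    by apply: partial_max0 => // y; rewrite ex; have /andP[] := eta01 y.
  rewrite /energy /= -![(_ - _) x]/(_ x - _ x) /phi ex mul1r lerD2l.
  apply: ler_sum => i _.
  rewrite -![(_ - _) i x]/(partial i _ x - _ i x) (partial_M i x seta sd) dex ex mulr0 addr0 mul1r.
  exact: lexx.
have insd x : S x -> energy (of_smooth phi - w) x <=
    3 * energy (of_smooth d - w) x + 3 * energy w x + (3 * n%:R * (B / delta) ^+ 2) * d x ^+ 2.
  move=> [Ox _].
  pose bd i := d x * partial i eta x.
  have hb : \sum_i bd i ^+ 2 <= n%:R * (B / delta) ^+ 2 * d x ^+ 2.
    rewrite -mulrA mulr_natl -[in leRHS](card_ord n) -sumr_const; apply: ler_sum => i _.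
    rewrite /bd exprMn mulrC; apply: ler_wpM2r; first exact: sqr_ge0.
    rewrite -real_normK ?num_real// lerXn2r ?nnegrE ?divr_ge0 ?(ltW B0) ?(ltW delta0)//.
    by have := deta x i; rewrite /B invf_div mulrA.
  have t1 : (of_smooth phi - w).1 x ^+ 2 <= 3 * (of_smooth d - w).1 x ^+ 2 + 3 * w.1 x ^+ 2.
    have := sqr_cutoff_le (d x) (w.1 x) 0 (eta01 x).
    by rewrite expr0n /= mulr0 !addr0.
  have t2 i : (of_smooth phi - w).2 i x ^+ 2 <=
      3 * (of_smooth d - w).2 i x ^+ 2 + 3 * w.2 i x ^+ 2 + 3 * bd i ^+ 2.
    rewrite -![(_ - w).2 i x]/(partial i _ x - w.2 i x) (partial_M i x seta sd) -/(bd i).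
    exact: sqr_cutoff_le (eta01 x).
  rewrite /energy.
  apply: le_trans (lerD t1 (ler_sum _ (fun i _ => t2 i))) _.
  rewrite !big_split/= -!mulr_sumr.
  rewrite (_ : 3 * n%:R * _ * _ = 3 * (n%:R * (B / delta) ^+ 2 * d x ^+ 2)); last by ring.
  lra.
pose W := (\int[lambda]_(x in S) (d x ^+ 2)%:E)%E.
have W0 : (0 <= W)%E by apply: integral_ge0 => x _; rewrite lee_fin sqr_ge0.
have cd : continuous d by exact: Ck_continuous (sd 0%N).
have md S' : measurable_fun S' (fun x => (d x ^+ 2)%:E) by exact: measurable_sq_EFin.
have leCd : delta <= (1 + C) * delta by rewrite ler_peMl ?(ltW delta0)// lerDl (ltW C0).
have mS' r : measurable (strip Omega setT r) by exact: measurable_strip.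
have YS r : r <= (1 + C) * delta -> (\int[lambda]_(x in strip Omega setT r) (energy w x)%:E <= Y)%E.
  move=> rC; apply: ge0_subset_integral => //; first by apply: me => // x [].
  exact: le_strip.
have XS S' : measurable S' -> S' `<=` Omega ->
    (\int[lambda]_(x in S') (energy (of_smooth d - w) x)%:E <= X)%E.
  by move=> mS2 SO2; apply: ge0_subset_integral => //; exact: me.
pose q : R := 3 * n%:R * (B / delta) ^+ 2.
have q0 : 0 <= q by rewrite mulr_ge0 ?sqr_ge0// mulr_ge0.
have ins : (\int[lambda]_(x in S) (energy (of_smooth phi - w) x)%:E <= 3%:E * X + 3%:E * Y + q%:E * W)%E.
  apply: (@le_trans _ _ (\int[lambda]_(x in S) (3%:E * (energy (of_smooth d - w) x)%:E +
     3%:E * (energy w x)%:E + q%:E * (d x ^+ 2)%:E))%E).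
    apply: ge0_le_integral => //.
    - exact: me.
    - apply: emeasurable_funD; last exact: measurable_funeM.
      by apply: emeasurable_funD; apply: measurable_funeM; exact: me.
  rewrite ge0_integralD//; last 4 first.
  - by move=> x _; rewrite adde_ge0// mule_ge0.
  - by apply: emeasurable_funD; apply: measurable_funeM; exact: me.
  - by move=> x _; rewrite mule_ge0// lee_fin sqr_ge0.
  - exact: measurable_funeM.
  rewrite ge0_integralD//; last 4 first.
  - by move=> x _; rewrite mule_ge0.
  - by apply: measurable_funeM; exact: me.
  - by move=> x _; rewrite mule_ge0.
  - by apply: measurable_funeM; exact: me.
  rewrite !ge0_integralZl//; try exact: me; last first.
    by move=> x _; rewrite lee_fin sqr_ge0.
  apply: leeD; last exact: lexx.
  apply: leeD; apply: lee_wpmul2l; try by rewrite lee_fin.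
    exact: XS.
  exact: YS.
have hW : (W <= (C * delta)%:E * Z + (C * delta ^+ 2)%:E * (2%:E * X + 2%:E * Y))%E.
  have dd : 0 < delta < delta1 by rewrite delta0.
  apply: le_trans (est _ dd d (sd 1%N)) _; apply: leeD => //; apply: lee_wpmul2l.
    by rewrite lee_fin mulr_ge0 ?exprn_ge0// ltW.
  set S2 := strip _ _ _.
  have S2O : S2 `<=` Omega by move=> x [].
  have mS2 : measurable S2 by exact: mS'.
  apply: (@le_trans _ _ (2%:E * \int[lambda]_(x in S2) (energy (of_smooth d - w) x)%:E +
      2%:E * \int[lambda]_(x in S2) (energy w x)%:E)%E).
    rewrite -!ge0_integralZl//; try exact: me.
    rewrite -ge0_integralD//; last 4 first.
    - by move=> x _; rewrite mule_ge0.
    - by apply: measurable_funeM; exact: me.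
    - by move=> x _; rewrite mule_ge0.
    - by apply: measurable_funeM; exact: me.
    apply: ge0_le_integral; first exact: mS'.
    - by move=> x _; rewrite lee_fin grad_sq_ge0.
    - exact: measurable_grad_sq.
    - by apply: emeasurable_funD; apply: measurable_funeM; exact: me.
    move=> x _; rewrite -!EFinM -EFinD lee_fin /grad_sq /energy.
    have := sqr_ge0 ((of_smooth d - w).1 x); have := sqr_ge0 (w.1 x).
    have : \sum_i partial i d x ^+ 2 <= 2 * (\sum_i (of_smooth d - w).2 i x ^+ 2) + 2 * (\sum_i w.2 i x ^+ 2).
      rewrite !mulr_sumr -big_split/=; apply: ler_sum => i _.
      have sq (a b : R) : a ^+ 2 <= 2 * (a - b) ^+ 2 + 2 * b ^+ 2.
        by have := sqr_ge0 (a - 2 * b); lra.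
      exact: sq.
    lra.
  apply: leeD; apply: lee_wpmul2l; try by rewrite lee_fin.
    exact: XS.
  by apply: YS; rewrite ler_wpM2r ?(ltW delta0)// lerDr.
rewrite (_ : Omega = S `|` (Omega `\` S)); last by rewrite setDUK.
rewrite ge0_integral_setU//; last 2 first.
- by apply: me => //; rewrite setDUK.
- by apply/disj_setPS => x [h [_ /(_ h)]].
apply: le_trans (leeD ins out) _.
have Xf : X \is a fin_num by exact: (integrable_fin_num mO (integrable_energy oO hd)).
have Yf : Y \is a fin_num.
  apply: (integrable_fin_num (mS' _)); apply: (integrableS mO) => //; first by move=> x [].
  exact: integrable_energy.
clear out ins XS YS.
clearbody X Y Z W; clear phi sphi hp eta01 eta1 deta insd seta teta.
have A0 : 0 < 4 + 2 * D by rewrite addr_gt0// mulr_gt0.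
(* An infinite boundary integral makes the claim trivial. Otherwise all the quantities are finite
   and the inequality is one between reals. *)
move: Z0 hW; case: Z => [z| |] // z0 hW; last first.
  rewrite gt0_muley ?lte_fin ?divr_gt0// addey ?leey//.
  by rewrite -ltNye (lt_le_trans (ltNyr 0%R))// adde_ge0// mule_ge0// lee_fin ltW.
move: hW Y0; rewrite -(fineK Xf) -(fineK Yf).
move: (fine X) (fine Y) => a b; rewrite -!EFinM -!EFinD => hW; rewrite lee_fin => b0.
have Wf : W \is a fin_num by rewrite ge0_fin_numE//; apply: le_lt_trans hW _; exact: ltry.
move: hW; rewrite -(fineK Wf); move: (fine W) => c; rewrite -!EFinM -!EFinD !lee_fin => hW.
have {}hW : q * c <= q * (C * delta * z + C * delta ^+ 2 * (2 * a + 2 * b)) by rewrite ler_wpM2l.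
have qE : q * (C * delta * z + C * delta ^+ 2 * (2 * a + 2 * b)) =
    D * (z / delta) + 2 * (D * a) + 2 * (D * b).
  by rewrite /q /D; field; rewrite gt_eqF.
rewrite lee_fin in z0.
have zd : 0 <= z / delta by rewrite divr_ge0// ltW.
have Dz : 0 <= D * (z / delta) by rewrite mulr_ge0// ltW.
rewrite qE in hW; rewrite (_ : (4 + 2 * D) / delta * z = 4 * (z / delta) + 2 * (D * (z / delta))); last first.
  by field; rewrite gt_eqF.
rewrite !(mulrDl 4 (2 * D)) -!(mulrA 2 D).
move: (q * c) (z / delta) (D * a) (D * b) hW zd Dz => qc zd Da Db.
move: (D * zd) => Dz hW *; lra.
Qed.

(** Zero trace, with the approximating sequence replaced by one smooth function for each
    tolerance. *)
Definition small_trace w : Prop := forall eps : R, 0 < eps ->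
  exists2 d : V -> R, smooth d &
    (\int[lambda]_(x in Omega) (energy (of_smooth d - w) x)%:E <= eps%:E)%E /\
    (\int[sigma]_(x in Gamma) (d x ^+ 2)%:E <= eps%:E)%E.

Lemma H10_small_trace w : H1 Omega w -> small_trace w -> H10 Omega w.
Proof.
move=> hw tr; have hw2 := H1_L2 hw; split => //.
have [A [C' [delta1 [A0 C0 delta10 cut]]]] := cutoff_energy.
have approx (j : nat) : exists phi : V -> R, test_function Omega phi /\
    h1norm Omega (of_smooth phi - w) <= j.+1%:R^-1.
  pose e : R := j.+1%:R^-1; have e0 : 0 < e by rewrite invr_gt0 ltr0n.
  (* Each of the three terms of the cut-off estimate will be at most [A * e2 = e ^+ 2 / 3]. *)
  pose e2 : R := e ^+ 2 / (3 * A).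
  have e20 : 0 < e2 by rewrite divr_gt0 ?mulr_gt0 ?exprn_gt0.
  have [delta2 delta20 hd2] := strip_energy_small oO hw2 e20.
  pose delta := Num.min (delta1 / 2) (delta2 / C').
  have delta0 : 0 < delta by rewrite lt_min !divr_gt0.
  have dd : 0 < delta < delta1.
    rewrite delta0; apply: (@le_lt_trans _ _ (delta1 / 2)); last by lra.
    by rewrite /delta ge_min lexx.
  have dC : C' * delta <= delta2.
    by rewrite mulrC -ler_pdivlMr// /delta ge_min lexx orbT.
  (* The tolerance is chosen after [delta]: the part [e2 * delta] absorbs the factor [A / delta] of
     the boundary term. *)
  pose e3 := Num.min e2 (e2 * delta).
  have e30 : 0 < e3 by rewrite lt_min e20 mulr_gt0.
  have [d sd [d1 d2]] := tr _ e30.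
  have [phi tphi hphi] := cut w hw2 _ dd d sd.
  exists phi; split => //; apply: (h1norm_le_energy oO) => //.
  - apply: (H1L2_B oO) => //; apply: (H1L2_of_smooth oO bO); by case: tphi.
  apply: le_trans hphi _.
  have h1 : (A%:E * \int[lambda]_(x in Omega) (energy (of_smooth d - w) x)%:E <= (A * e2)%:E)%E.
    rewrite EFinM; apply: lee_wpmul2l; first by rewrite lee_fin ltW.
    by apply: le_trans d1 _; rewrite lee_fin /e3 ge_min lexx.
  have h2 : (A%:E * \int[lambda]_(x in strip Omega setT (C' * delta)) (energy w x)%:E <= (A * e2)%:E)%E.
    rewrite EFinM; apply: lee_wpmul2l; first by rewrite lee_fin ltW.
    apply: le_trans hd2; apply: ge0_subset_integral; try exact: (measurable_strip oO).
    - by apply: (measurable_funS mO) => //; [move=> x []|exact: (measurable_energy oO)].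
    - by move=> x _; rewrite lee_fin energy_ge0.
    - exact: le_strip.
  have h3 : ((A / delta)%:E * \int[sigma]_(x in Gamma) (d x ^+ 2)%:E <= (A * e2)%:E)%E.
    apply: (@le_trans _ _ ((A / delta)%:E * (e2 * delta)%:E)%E).
      apply: lee_wpmul2l; first by rewrite lee_fin divr_ge0// ltW.
      by apply: le_trans d2 _; rewrite lee_fin /e3 ge_min lexx orbT.
    by rewrite -EFinM lee_fin le_eqVlt; apply/orP; left; apply/eqP; field; rewrite gt_eqF.
  apply: le_trans (leeD (leeD h1 h2) h3) _.
  rewrite -!EFinD lee_fin -/e (_ : A * e2 = e ^+ 2 / 3); first lra.
  by rewrite /e2; move: (e) => e'; field; rewrite gt_eqF.
have /choice[s hs] := approx; exists s => [j|]; first by case: (hs j).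
apply/cvgrPdist_le => e e0; near=> j.
rewrite sub0r normrN ger0_norm ?h1norm_ge0//; apply: le_trans (hs j).2 _.
apply: ltW; near: j; exact: (near_infty_natSinv_lt (PosNum e0)).
Unshelve. all: by end_near. Qed.

Lemma energy_B_le u v x : energy (u - v) x <= 2 * energy u x + 2 * energy v x.
Proof.
have sq (a b : R) : (a - b) ^+ 2 <= 2 * a ^+ 2 + 2 * b ^+ 2 by have := sqr_ge0 (a + b); lra.
rewrite /energy !mulrDr addrACA !mulr_sumr -big_split/=; apply: lerD; first exact: sq.
by apply: ler_sum => i _; exact: sq.
Qed.

Lemma has_traceE u g (eps : R) : H1 Omega u -> has_trace Omega u g -> 0 < eps ->
  exists2 s : V -> R, smooth s &
    (\int[lambda]_(x in Omega) (energy (of_smooth s - u) x)%:E <= eps%:E)%E /\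
    (\int[sigma]_(x in Gamma) ((s x - g x) ^+ 2)%:E <= eps%:E)%E.
Proof.
move=> hu [_ [s [ss s1 s2]]] e0.
have n1 : \forall j \near \oo, h1norm Omega (of_smooth (s j) - u) < Num.sqrt eps.
  by apply: (cvgr_lt _ s1); rewrite sqrtr_gt0.
have n2 : \forall j \near \oo, (\int[sigma]_(x in Gamma) ((s j x - g x) ^+ 2)%:E < eps%:E)%E.
  have nb : nbhs (0%E : \bar R) [set y | (y < eps%:E)%E].
    apply: open_nbhs_nbhs; split; first exact: open_ereal_lt_ereal.
    by rewrite /= lte_fin.
  exact: (s2 _ nb).
have [j _ hj] := filterI n1 n2; have [h1 h2] := hj j (leqnn j).
exists (s j) => //; split; last exact: ltW.
rewrite -(h1norm_sqE oO); last first.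
  by apply: (H1L2_B oO); [exact: (H1L2_of_smooth oO bO)|exact: H1_L2].
rewrite lee_fin -[leRHS](sqr_sqrtr (ltW e0)) lerXn2r ?nnegrE ?h1norm_ge0 ?sqrtr_ge0//.
exact: ltW.
Qed.

(** The common trace [g] cancels in [s - t = (s - g) - (t - g)]. The tolerance [eps / 4] makes up
    for [(a - b) ^+ 2 <= 2 * a ^+ 2 + 2 * b ^+ 2]. *)
Lemma small_trace_B u v g : H1 Omega u -> H1 Omega v ->
  has_trace Omega u g -> has_trace Omega v g -> small_trace (u - v).
Proof.
move=> hu hv tu tv eps e0.
have e40 : 0 < eps / 4 by rewrite divr_gt0.
have [s ss [s1 s2]] := has_traceE hu tu e40.
have [t st [t1 t2]] := has_traceE hv tv e40.
have hsu : H1L2 Omega (of_smooth s - u).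
  by apply: (H1L2_B oO); [exact: (H1L2_of_smooth oO bO)|exact: H1_L2].
have htv : H1L2 Omega (of_smooth t - v).
  by apply: (H1L2_B oO); [exact: (H1L2_of_smooth oO bO)|exact: H1_L2].
have sst := smooth_B ss st.
exists (fun x => s x - t x) => //; split.
  have E x : energy (of_smooth (fun y => s y - t y) - (u - v)) x =
      energy ((of_smooth s - u) - (of_smooth t - v)) x.
    rewrite /energy; congr (_ ^+ 2 + _).
      rewrite -[LHS]/(s x - t x - (u.1 x - v.1 x)) -[RHS]/(s x - u.1 x - (t x - v.1 x)); ring.
    apply: eq_bigr => i _; congr (_ ^+ 2).
    rewrite -[LHS]/(partial i _ x - (u.2 i x - v.2 i x)) (partial_B i x ss st).
    rewrite -[RHS]/(partial i s x - u.2 i x - (partial i t x - v.2 i x)); ring.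
  under eq_integral do rewrite E.
  apply: le_trans (@ge0_integral_energy_le Omega _ (of_smooth s - u) (of_smooth t - v) 2 2 mO _ _ _ _ _ _ _) _ => //.
  - exact: (H1L2_B oO).
  - by move=> x _; exact: energy_B_le.
  apply: le_trans (leeD (lee_wpmul2l _ s1) (lee_wpmul2l _ t1)) _ => //.
  by rewrite -!EFinM -EFinD lee_fin; lra.
have mg := (tu.1).1; have mG : measurable (Gamma : set (caratheodory_type (@hausdorff R n k))).
  by apply: measurable_surface; exact: measurable_boundary.
have ms f : smooth f ->
    measurable_fun (Gamma : set (caratheodory_type (@hausdorff R n k))) (fun x => f x - g x).
  move=> sf; apply: measurable_funB; last exact: mg.
  by apply: measurable_fun_surface; apply: continuous_measurable_row; exact: Ck_continuous (sf 0%N).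
have E : (\int[sigma]_(x in Gamma) ((s x - t x) ^+ 2)%:E =
    \int[sigma]_(x in Gamma) (((s x - g x) - (t x - g x)) ^+ 2)%:E)%E.
  by apply: eq_integral => x _; congr (_ ^+ 2)%:E; ring.
rewrite E; apply: le_trans (ge0_integral_sqrB_le sigma mG (ms s ss) (ms t st)) _.
apply: le_trans (leeD (lee_wpmul2l _ s2) (lee_wpmul2l _ t2)) _; try by rewrite lee_fin.
by rewrite -!EFinM -EFinD lee_fin; lra.
Qed.

End zero_trace.

(** * Poincare inequality and error estimate *)

Section H10_theory.
Variables (R : realType) (k : nat).
Local Notation n := k.+1.
Local Notation V := 'rV[R]_n.
Local Notation lambda := (lebesgue_row R n).
Variables (Omega : set V) (oO : open Omega) (bO : bounded_set Omega).
Implicit Types (f g : V -> R) (u v w : sobolev R n).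
Local Notation nrm := (nrm lambda Omega).
Local Notation ip := (ip lambda Omega).

Let mO : measurable Omega. Proof. exact: measurable_domain. Qed.

Lemma grad_norm_sq u : grad_norm Omega u ^+ 2 = \sum_i nrm (u.2 i) ^+ 2.
Proof. by rewrite sqr_sqrtr// sumr_ge0// => i _; rewrite sqr_ge0. Qed.

Lemma h1norm_sq u : h1norm Omega u ^+ 2 = nrm u.1 ^+ 2 + grad_norm Omega u ^+ 2.
Proof. by rewrite sqr_sqrtr// addr_ge0// sqr_ge0. Qed.

Lemma grad_norm_ge0 u : 0 <= grad_norm Omega u. Proof. exact: sqrtr_ge0. Qed.

Lemma nrm_le_h1norm u : nrm u.1 <= h1norm Omega u.
Proof.
rewrite -(ler_pXn2r (n := 2)) ?nnegrE ?nrm_ge0 ?h1norm_ge0//.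
by rewrite h1norm_sq lerDl sqr_ge0.
Qed.

Lemma nrm_partial_le_grad_norm u i : nrm (u.2 i) <= grad_norm Omega u.
Proof.
rewrite -(ler_pXn2r (n := 2)) ?nnegrE ?nrm_ge0 ?grad_norm_ge0//.
rewrite grad_norm_sq (bigD1 i)//= lerDl.
by apply: sumr_ge0 => j _; rewrite sqr_ge0.
Qed.

Lemma nrm_partial_le_h1norm u i : nrm (u.2 i) <= h1norm Omega u.
Proof.
apply: le_trans (nrm_partial_le_grad_norm u i) _.
rewrite -(ler_pXn2r (n := 2)) ?nnegrE ?grad_norm_ge0 ?h1norm_ge0//.
by rewrite h1norm_sq lerDr sqr_ge0.
Qed.

Lemma test_function_out f y : test_function Omega f -> ~ Omega y -> f y = 0.
Proof.
move=> [_ _ sub] nO; apply: contrapT => /eqP fy; apply: nO; apply: sub.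
exact: subset_closure.
Qed.

Lemma partial_test_function_out f i y : test_function Omega f -> ~ Omega y -> partial i f y = 0.
Proof.
move=> [_ _ sub] nO; have oC : open (~` closure [set x | f x != 0]).
  by rewrite openC; exact: closed_closure.
have : nbhs y (~` closure [set x | f x != 0]).
  by apply: open_nbhs_nbhs; split => // /sub.
move=> ny; have E : \forall z \near y, f z = cst 0 z.
  near=> z; apply: contrapT => /eqP fz.
  have : (~` closure [set x | f x != 0]) z by near: z.
  by apply; exact: subset_closure.
by rewrite /partial (near_eq_derive _ E) derive_cst.
Unshelve. all: by end_near. Qed.

(** For a test function, follow the first axis until [Omega] has been left, where the function
    vanishes, and average the line integrals by translation invariance; one factor [T] comes from
    Cauchy-Schwarz and one from the average. Density then gives the general case. *)
Lemma poincare_H10 : exists2 T, 0 < T & forall w, H10 Omega w -> nrm w.1 <= T * nrm (w.2 ord0).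
Proof.
have [M [_ hM]] := bO.
pose B := `|M| + 1.
have B0 : 0 < B by rewrite ltr_wpDl.
have hB y : Omega y -> `|y ord0 ord0| <= B.
  move=> Oy; apply: le_trans (row_norm_coord y ord0) _; apply: hM => //.
  by rewrite /B (le_lt_trans (ler_norm M))// ltrDl.
(* First coordinates of points of [Omega] differ by at most [2 * B], so a shift by [T] leaves
   [Omega]. *)
pose T := 2 * B + 1.
have T0 : 0 < T by rewrite addr_gt0// mulr_gt0.
exists T => // w [hw [s ts cvs]].
have test f : test_function Omega f -> nrm f <= T * nrm (partial ord0 f).
  move=> tf; have sf : smooth f by case: tf.
  pose e : V := delta_mx ord0 ord0.
  have cf : continuous f by exact: Ck_continuous (sf 0%N).
  have cp : continuous (partial ord0 f) by case: (sf 1%N) => _ /(_ ord0)[].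
  pose G (x : V) := ((partial ord0 f x ^+ 2)%:E : \bar R).
  have mG : measurable_fun setT G by exact: measurable_sq_EFin.
  have G0 x : (0 <= G x)%E by rewrite lee_fin sqr_ge0.
  pose I (x : V) := (\int[@lebesgue_measure R]_(t in `[0%R, T]) G (x - t *: e)%R)%E.
  have I0 x : (0 <= I x)%E by apply: integral_ge0.
  have mI : measurable_fun setT I by exact: measurable_shift_integral.
  have pw x : Omega x -> ((f x ^+ 2)%:E <= T%:E * I x)%E.
    move=> Ox; have := C1_line_integral x e (sf 1%N) (ltW T0).
    rewrite (test_function_out (y := x - T *: e) tf) ?subr0; last first.
      move=> /hB; have := hB x Ox; rewrite !mxE !eqxx /= mulr1 !ler_norml /T => /andP[_ h1] /andP[h2 _].
      by move: (x ord0 ord0) h1 h2 => t h1 h2; lra.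
    move=> /le_trans; apply; apply: lee_wpmul2l; first by rewrite lee_fin ltW.
    rewrite le_eqVlt; apply/orP; left; apply/eqP; apply: eq_integral => t _.
    rewrite /G (bigD1 ord0)//= big1 ?addr0 => [|j jn0]; first by rewrite !mxE !eqxx mul1r.
    by rewrite mxE eqxx /= (negbTE jn0) mul0r.
  have L2f := L2_continuous oO bO cf; have L2p := L2_continuous oO bO cp.
  rewrite -(ler_pXn2r (n := 2)) ?nnegrE ?mulr_ge0 ?nrm_ge0 ?(ltW T0)//.
  rewrite -lee_fin exprMn [leRHS]EFinM (nrm_sqE mO L2f) (nrm_sqE mO L2p).
  apply: (@le_trans _ _ (\int[lambda]_(x in Omega) (T%:E * I x))%E).
    apply: (ge0_le_integral lambda mO).
    - by move=> x _; rewrite lee_fin sqr_ge0.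
    - exact: measurable_sq_EFin.
    - by apply: measurable_funeM; exact: (measurable_funS measurableT).
    - exact: pw.
  rewrite ge0_integralZl//; last 2 first.
  - exact: (measurable_funS measurableT).
  - by rewrite lee_fin ltW.
  rewrite expr2 EFinM -muleA; apply: lee_wpmul2l; first by rewrite lee_fin ltW.
  apply: (@le_trans _ _ (\int[lambda]_x I x)%E); first exact: ge0_subset_integral.
  rewrite (shift_tonelli e (ltW T0) mG G0); apply: lee_wpmul2l; first by rewrite lee_fin ltW.
  rewrite [leRHS]integral_mkcond le_eqVlt; apply/orP; left; apply/eqP; apply: eq_integral => x _.
  rewrite patchE; case: ifPn => // /negP h; rewrite /G (partial_test_function_out ord0 tf) ?expr0n//.
  by move=> Ox; apply: h; rewrite inE.
have [L1 L2w] := H1_L2 hw.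
apply/ler_addgt0Pr => eps eps0.
(* The approximation error enters once for the function and [T] times for its derivative. *)
have d0 : 0 < eps / (1 + T) by rewrite divr_gt0// addr_gt0.
have [j _ /(_ j (leqnn j)) hj] := cvgr_lt _ cvs _ d0.
have T1 : 0 < 1 + T by lra.
rewrite ltr_pdivlMr// in hj.
have sj := ts j; have ssj : smooth (s j) by case: sj.
have [S1 S2] := H1L2_of_smooth oO bO ssj.
have h1 : nrm (s j) <= T * nrm (partial ord0 (s j)) := test _ sj.
have a1 : nrm w.1 <= nrm (s j) + h1norm Omega (of_smooth (s j) - w).
  apply: le_trans (lerD (lexx _) (nrm_le_h1norm (of_smooth (s j) - w))).
  rewrite (_ : nrm w.1 = nrm (fun x => s j x - (s j x - w.1 x))); last first.
    by apply: eq_nrm => x _; ring.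
  exact: (nrm_B mO S1 (L2_B mO S1 L1)).
have a2 : nrm (partial ord0 (s j)) <= nrm (w.2 ord0) + h1norm Omega (of_smooth (s j) - w).
  apply: le_trans (lerD (lexx _) (nrm_partial_le_h1norm (of_smooth (s j) - w) ord0)).
  rewrite (_ : nrm (partial _ _) = nrm (fun x => w.2 ord0 x + (partial ord0 (s j) x - w.2 ord0 x))); last first.
    by apply: eq_nrm => x _; ring.
  exact: (nrm_D mO (L2w ord0) (L2_B mO (S2 ord0) (L2w ord0))).
have a3 : T * nrm (partial ord0 (s j)) <= T * (nrm (w.2 ord0) + h1norm Omega (of_smooth (s j) - w)).
  by rewrite ler_pM2l.
move: (h1norm _ _) (nrm (s j)) (nrm (partial _ _)) (nrm w.1) (nrm (w.2 ord0)) hj h1 a1 a3 => a b c d e.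
move=> *; lra.
Qed.

(** The defining identity of the weak derivative of [r] holds against test functions, and both sides
    are continuous in [w] for the [H^1] norm. *)
Lemma H10_weak_partial r w i : H1 Omega r -> H10 Omega w ->
  ip r.1 (w.2 i) = - ip (r.2 i) w.1.
Proof.
move=> hr [hw [s ts cvs]].
have [r1 r2] := H1_L2 hr; have [w1 w2] := H1_L2 hw.
apply/eqP; rewrite -subr_eq0 opprK -normr_le0; apply/ler_addgt0Pr => eps eps0; rewrite add0r.
pose A := nrm r.1 + nrm (r.2 i) + 1.
have A0 : 0 < A by rewrite ltr_wpDl// addr_ge0// nrm_ge0.
have d0 : 0 < eps / A by rewrite divr_gt0.
have [j _ /(_ j (leqnn j)) hj] := cvgr_lt _ cvs _ d0.
rewrite ltr_pdivlMr// in hj.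
have ssj : smooth (s j) by case: (ts j).
have [S1 S2] := H1L2_of_smooth oO bO ssj.
have wp : ip r.1 (partial i (s j)) = - ip (r.2 i) (s j).
  by have [_ wr] := hr; have [_] := wr i; apply.
have b1 := cauchy_schwarz mO r1 (L2_B mO (S2 i) (w2 i)).
have b2 := cauchy_schwarz mO (r2 i) (L2_B mO S1 w1).
rewrite (ipBr mO (S2 i) (w2 i) r1) in b1.
rewrite (ipBr mO S1 w1 (r2 i)) in b2.
have c1 := nrm_partial_le_h1norm (of_smooth (s j) - w) i.
have c2 := nrm_le_h1norm (of_smooth (s j) - w).
have e1 := le_trans b1 (ler_wpM2l (nrm_ge0 _ _ _) c1).
have e2 := le_trans b2 (ler_wpM2l (nrm_ge0 _ _ _) c2).
rewrite -[ip r.1 ((of_smooth (s j)).2 i)]/(ip r.1 (partial i (s j))) wp in e1.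
rewrite -[ip (r.2 i) ((of_smooth (s j)).1)]/(ip (r.2 i) (s j)) in e2.
have h0 := h1norm_ge0 Omega (of_smooth (s j) - w).
move: hj e1 e2 h0; rewrite /A !ler_norml.
move: (h1norm _ _) (nrm r.1) (nrm (r.2 i)) (ip (r.2 i) (s j)) (ip r.1 (w.2 i)) (ip (r.2 i) w.1).
move=> h p q x y z h1 /andP[h2 h3] /andP[h4 h5] h6; apply/andP; split; lra.
Qed.

Lemma H1_B u v : H1 Omega u -> H1 Omega v -> H1 Omega (u - v).
Proof.
move=> hu hv; have [L1 L2w] := H1L2_B oO (H1_L2 hu) (H1_L2 hv).
split => // i; split; first exact: L2w.
move=> phi tphi; have sphi : smooth phi by case: tphi.
have [S1 S2] := H1L2_of_smooth oO bO sphi.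
have [u1 u2] := H1_L2 hu; have [v1 v2] := H1_L2 hv.
have wu : ip u.1 (partial i phi) = - ip (u.2 i) phi.
  by have [_ wr] := hu; have [_] := wr i; apply.
have wv : ip v.1 (partial i phi) = - ip (v.2 i) phi.
  by have [_ wr] := hv; have [_] := wr i; apply.
have := ipBl mO u1 v1 (S2 i); rewrite /= wu wv => E1.
have := ipBl mO (u2 i) (v2 i) S1 => E2.
rewrite -[LHS]/(ip (fun x => u.1 x - v.1 x) (partial i phi)) E1.
by rewrite -[RHS]/(- ip (fun x => u.2 i x - v.2 i x) phi) E2 opprB opprK addrC.
Qed.

End H10_theory.

(** * Dual norm and energy estimate for the Stokes system *)

Section stokes.
Variables (R : realType) (k : nat).
Local Notation n := k.+1.
Local Notation V := 'rV[R]_n.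
Local Notation lambda := (lebesgue_row R n).
Variables (Omega : set V) (dom : bounded_lipschitz_domain Omega).
Implicit Types (f g h : V -> R) (r : sobolev R n) (u v w : 'I_n -> sobolev R n).
Local Notation nrm := (nrm lambda Omega).
Local Notation ip := (ip lambda Omega).
Local Notation gn := (grad_norm Omega).

Let oO : open Omega. Proof. by case: dom. Qed.
Let bO : bounded_set Omega. Proof. by case: dom. Qed.
Let mO : measurable Omega. Proof. exact: measurable_domain. Qed.

Lemma L2_divergence u : (forall j, H1 Omega (u j)) -> L2 lambda Omega (divergence u).
Proof. by move=> hu; apply: (L2_sum mO) => i; have [_] := H1_L2 (hu i). Qed.

(** The form [a *: r + 0] is the one in which a closed subspace provides multiples of [r]. *)
Lemma grad_norm_scale (a : R) r : H1 Omega r -> gn (a *: r + 0) = `|a| * gn r.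
Proof.
move=> hr; have [_ r2] := H1_L2 hr.
apply/eqP; rewrite -(eqrXn2 (n := 2)) ?mulr_ge0 ?grad_norm_ge0//.
rewrite exprMn !grad_norm_sq mulr_sumr; apply/eqP; apply: eq_bigr => i _.
rewrite -exprMn -(nrm_Z mO a (r2 i)); congr (_ ^+ 2); apply: eq_nrm => x _.
by rewrite -[LHS]/(a * r.2 i x + 0) addr0.
Qed.

Section dual_norm.
Variables (Q : set (sobolev R n)) (Qc : closed_subspace Omega Q) (Qp : poincare Omega Q).
Variables (h : V -> R) (L2h : L2 lambda Omega h).

(** Normalizing [r] with both signs gives the absolute value. When the gradient norm of [r] is zero,
    the Poincare inequality on [Q] makes the pairing vanish; it also bounds the set whose supremum
    is taken. *)
Lemma dual_norm_bound r : Q r ->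
  `|pairing Omega h r| <= dual_norm Omega Q (pairing Omega h) * gn r.
Proof.
have [QH Q0 Ql _] := Qc; have [c c0 hc] := Qp.
have bound q : Q q -> `|pairing Omega h q| <= nrm h * (c * gn q).
  move=> Qq; have [q1 _] := H1_L2 (QH _ Qq).
  apply: le_trans (cauchy_schwarz mO L2h q1) _.
  by apply: ler_wpM2l; [exact: nrm_ge0|exact: hc].
have le_dual q : Q q -> gn q = 1 -> pairing Omega h q <= dual_norm Omega Q (pairing Omega h).
  move=> Qq q1; apply: ub_le_sup; last by exists q.
  exists (nrm h * c) => _ [p [Qp' p1] <-].
  by have := bound p Qp'; rewrite p1 mulr1; apply: le_trans; exact: ler_norm.
move=> Qr; have hr := QH _ Qr; have [r1 _] := H1_L2 hr.
have [g0|g0] := eqVneq (gn r) 0.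
  by have := bound r Qr; rewrite g0 !mulr0.
have gp : 0 < gn r by rewrite lt_neqAle eq_sym g0 grad_norm_ge0.
have scaled (a : R) : `|a| = (gn r)^-1 ->
    a * pairing Omega h r <= dual_norm Omega Q (pairing Omega h).
  move=> an; have := le_dual _ (Ql a _ _ Qr Q0); rewrite grad_norm_scale// an mulVf// => /(_ erefl).
  rewrite (_ : pairing Omega h _ = a * pairing Omega h r)//.
  rewrite -[RHS](ipZr mO a r1 L2h); apply: eq_ip => // x _.
  by rewrite -[LHS]/(a * r.1 x + 0) addr0.
have s1 := scaled (gn r)^-1 (ger0_norm (ltW (_ : 0 < (gn r)^-1))).
have s2 := scaled (- (gn r)^-1).
rewrite normrN ger0_norm in s2; last by rewrite invr_ge0 ltW.
have {}s1 := s1 ltac:(by rewrite invr_gt0).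
have {}s2 := s2 erefl.
rewrite mulrC ler_pdivrMr// in s1.
rewrite mulNr mulrC -mulNr ler_pdivrMr// in s2.
by rewrite ler_norml s1 lerNl s2.
Qed.

Lemma dual_norm_ge0 : 0 <= dual_norm Omega Q (pairing Omega h).
Proof.
have [[q [Qq q1]]|nq] := pselect (exists q, Q q /\ gn q = 1).
  by have := dual_norm_bound Qq; rewrite q1 mulr1; apply: le_trans.
(* No element of [Q] has unit gradient norm, and the supremum of the empty set is [0]. *)
rewrite /dual_norm sup_out// => -[[_ [q hq _]] _]; by apply: nq; exists q.
Qed.

End dual_norm.

Lemma stress_sum u v : (forall j, H1 Omega (u j)) -> (forall j, H1 Omega (v j)) ->
  \int[lambda]_(x in Omega) (\sum_i \sum_j (u j).2 i x * (v j).2 i x) =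
  \sum_i \sum_j ip ((u j).2 i) ((v j).2 i).
Proof.
move=> hu hv.
have iuv i j : lambda.-integrable Omega (EFin \o (fun x => (u j).2 i x * (v j).2 i x)).
  by apply: (L2_intM mO); [exact: (H1_L2 (hu j)).2|exact: (H1_L2 (hv j)).2].
rewrite (Rintegral_sum mO) => [|i].
  by apply: eq_bigr => i _; rewrite (Rintegral_sum mO).
have := integrable_sum mO (index_enum 'I_n) (P := xpredT)
  (h := fun j x => ((u j).2 i x * (v j).2 i x)%:E) (fun j _ => iuv i j).
by apply: eq_integrable => // x _; rewrite /= sumEFin.
Qed.

Lemma force_sum (f : 'I_n -> V -> R) v : (forall j, L2 lambda Omega (f j)) ->
  (forall j, H1 Omega (v j)) ->
  \int[lambda]_(x in Omega) (\sum_j f j x * (v j).1 x) = \sum_j ip (f j) ((v j).1).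
Proof.
move=> hf hv; rewrite (Rintegral_sum mO)// => j.
by apply: (L2_intM mO) => //; exact: (H1_L2 (hv j)).1.
Qed.

Lemma grad_pairing_sum r (q : sobolev R n) : H1 Omega r -> H1 Omega q ->
  grad_pairing Omega r q = \sum_i ip (r.2 i) (q.2 i).
Proof.
move=> hr hq; rewrite /grad_pairing (Rintegral_sum mO)// => j.
by apply: (L2_intM mO); [exact: (H1_L2 hr).2|exact: (H1_L2 hq).2].
Qed.

Lemma momentum_difference (f : 'I_n -> V -> R) u v (p q : sobolev R n) w :
  momentum_equation Omega f u p -> momentum_equation Omega f v q ->
  (forall j, H1 Omega (u j)) -> (forall j, H1 Omega (v j)) -> H1 Omega p -> H1 Omega q ->
  (forall j, H10 Omega (w j)) ->
  \sum_i \sum_j ip ((u j - v j).2 i) ((w j).2 i) + \sum_j ip ((p - q).2 j) ((w j).1) = 0.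
Proof.
move=> mu mv hu hv hp hq hw.
have hw1 j : H1 Omega (w j) by case: (hw j).
have wL j := H1_L2 (hw1 j).
have eu := mu w hw; have ev := mv w hw.
rewrite -ev (stress_sum hu hw1) (stress_sum hv hw1) in eu.
rewrite (force_sum (H1_L2 hp).2 hw1) (force_sum (H1_L2 hq).2 hw1) in eu.
have -> : \sum_i \sum_j ip ((u j - v j).2 i) ((w j).2 i) =
    \sum_i \sum_j ip ((u j).2 i) ((w j).2 i) - \sum_i \sum_j ip ((v j).2 i) ((w j).2 i).
  rewrite -sumrB; apply: eq_bigr => i _; rewrite -sumrB; apply: eq_bigr => j _.
  exact: (ipBl mO ((H1_L2 (hu j)).2 i) ((H1_L2 (hv j)).2 i) ((wL j).2 i)).
have -> : \sum_j ip ((p - q).2 j) ((w j).1) =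
    \sum_j ip (p.2 j) ((w j).1) - \sum_j ip (q.2 j) ((w j).1).
  rewrite -sumrB; apply: eq_bigr => j _.
  exact: (ipBl mO ((H1_L2 hp).2 j) ((H1_L2 hq).2 j) (wL j).1).
by rewrite addrACA -opprD eu subrr.
Qed.

Lemma energy_estimate w r (T eps b D : R) : 0 < eps -> 0 <= D ->
  (forall j, H10 Omega (w j)) -> H1 Omega r ->
  (forall z, H10 Omega z -> nrm z.1 <= T * nrm (z.2 ord0)) -> 0 < T ->
  \sum_i \sum_j ip ((w j).2 i) ((w j).2 i) + \sum_j ip (r.2 j) ((w j).1) = 0 ->
  eps * gn r ^+ 2 + ip (divergence w) r.1 = - b -> `|b| <= D * gn r ->
  gn r <= D / eps /\ h1vnorm Omega w <= (T + 1) * T * (D / eps).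
Proof.
move=> eps0 D0 hw hr hT T0 mom cont hb.
have hw1 j : H1 Omega (w j) by case: (hw j).
have hL j := H1_L2 (hw1 j); have [r1 r2] := H1_L2 hr.
pose W := \sum_j gn (w j) ^+ 2.
have W0 : 0 <= W by apply: sumr_ge0 => j _; exact: sqr_ge0.
have WE : \sum_i \sum_j ip ((w j).2 i) ((w j).2 i) = W.
  rewrite exchange_big /=; apply: eq_bigr => j _; rewrite grad_norm_sq.
  by apply: eq_bigr => i _; rewrite nrm_ip.
rewrite WE in mom.
have divE : ip (divergence w) r.1 = W.
  have -> : ip (divergence w) r.1 = \sum_i ip ((w i).2 i) r.1.
    rewrite /ip -(Rintegral_sum mO) => [|i]; last exact: (L2_intM mO ((hL i).2 i) r1).
    by apply: eq_Rintegral => x _; rewrite /divergence mulr_suml.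
  rewrite (eq_bigr (fun i => - ip (r.2 i) (w i).1)).
    by rewrite sumrN; apply/eqP; rewrite eq_sym -addr_eq0 mom.
  by move=> i _; rewrite ipC (H10_weak_partial oO bO i hr (hw i)).
rewrite divE in cont.
have g0 := grad_norm_ge0 Omega r.
have hb' : - b <= D * gn r by apply: le_trans hb; rewrite -normrN ler_norm.
(* The term [W] of the mass equation is nonnegative and is dropped; one factor [gn r] is then
   cancelled, unless it is zero. *)
have rho : gn r <= D / eps.
  rewrite ler_pdivlMr//.
  have : eps * gn r ^+ 2 <= D * gn r by lra.
  have [->|gr] := eqVneq (gn r) 0; first by rewrite mul0r.
  have gp : 0 < gn r by rewrite lt_neqAle eq_sym gr.
  by rewrite expr2 mulrA ler_pM2r// mulrC.
split => //.
pose S := Num.sqrt W.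
have S2 : S ^+ 2 = W by rewrite sqr_sqrtr.
have S0 : 0 <= S by exact: sqrtr_ge0.
have nw j : nrm (w j).1 <= T * gn (w j).
  apply: le_trans (hT _ (hw j)) _; rewrite ler_pM2l//; exact: nrm_partial_le_grad_norm.
have sumw : \sum_j nrm (w j).1 ^+ 2 <= (T * S) ^+ 2.
  rewrite exprMn S2 /W mulr_sumr; apply: ler_sum => j _; rewrite -exprMn.
  by rewrite lerXn2r ?nnegrE ?mulr_ge0 ?nrm_ge0 ?grad_norm_ge0// ltW.
have WS : W <= gn r * (T * S).
  have -> : W = - \sum_j ip (r.2 j) (w j).1 by apply/eqP; rewrite -addr_eq0 mom.
  apply: le_trans (ler_norm _) _; rewrite normrN.
  apply: (@le_trans _ _ (\sum_j nrm (r.2 j) * nrm (w j).1)).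
    apply: le_trans (ler_norm_sum _ _ _) _; apply: ler_sum => j _.
    by apply: (cauchy_schwarz mO); [exact: r2|exact: (hL j).1].
  apply: le_trans (ler_norm _) _; apply: le_trans (cauchy_sum _ _) _.
  apply: ler_pM; [exact: sqrtr_ge0|exact: sqrtr_ge0| |].
    by rewrite /grad_norm.
  rewrite -[leRHS]ger0_norm ?mulr_ge0 ?(ltW T0)// -sqrtr_sqr ler_sqrt// sqr_ge0//.
have SD : S <= T * (D / eps).
  apply: (@le_trans _ _ (T * gn r)); last by rewrite ler_pM2l.
  have [->|Sn] := eqVneq S 0; first by rewrite mulr_ge0// ltW.
  have Sp : 0 < S by rewrite lt_neqAle eq_sym Sn.
  by rewrite -(ler_pM2r Sp) -expr2 S2; apply: le_trans WS _; rewrite mulrCA mulrA.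
(* The Poincare inequality bounds the squared norm by [(T ^+ 2 + 1) * S ^+ 2], hence by the square
   of [(T + 1) * S]; with [S <= T * (D / eps)] this yields the factor [(T + 1) * T]. *)
have hv : h1vnorm Omega w <= (T + 1) * S.
  have TS0 : 0 <= (T + 1) * S by rewrite mulr_ge0// addr_ge0// ltW.
  rewrite -[leRHS](ger0_norm TS0) -sqrtr_sqr ler_sqrt ?sqr_ge0//.
  rewrite (eq_bigr (fun j => nrm (w j).1 ^+ 2 + gn (w j) ^+ 2)); last first.
    by move=> j _; rewrite h1norm_sq.
  rewrite big_split/= -/W -S2; apply: le_trans (lerD sumw (lexx _)) _.
  by have := mulr_ge0 (ltW T0) (sqr_ge0 S); nra.
apply: le_trans hv _; rewrite -mulrA ler_pM2l//.
by rewrite addr_gt0.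
Qed.
End stokes.

Section error_estimate.
Variables (R : realType) (k : nat) (k0 : (0 < k)%N).
Local Notation n := k.+1.
Local Notation V := 'rV[R]_n.
Local Notation lambda := (lebesgue_row R n).
Variables (Omega : set V) (dom : bounded_lipschitz_domain Omega).
Variables (Q : set (sobolev R n)) (Qc : closed_subspace Omega Q) (Qp : poincare Omega Q).
Variables (F u_b : 'I_n -> V -> R) (p_b : sobolev R n) (G : sobolev R n -> R).
Variables (u_PP : 'I_n -> sobolev R n) (p_PP : sobolev R n).
Hypothesis PP : PP_solution Omega Q F u_b p_b G u_PP p_PP.
Local Notation ip := (ip lambda Omega).
Local Notation nrm := (nrm lambda Omega).

Lemma error_estimate : exists2 c : R, 0 < c &
  forall eps u p, 0 < eps -> ES_solution Omega Q F u_b p_b G eps u p ->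
    h1vnorm Omega (u - u_PP) <=
      c / eps * dual_norm Omega Q (pairing Omega (divergence u_PP)) /\
    h1norm Omega (p - p_PP) <=
      c / eps * dual_norm Omega Q (pairing Omega (divergence u_PP)).
Proof.
have [oO _ _ bO _] := dom; have mO : measurable Omega by exact: measurable_domain.
have [T T0 hT] := poincare_H10 oO bO.
have [cp cp0 hcp] := Qp; have [QH _ Ql _] := Qc.
have [HuP HpP momP contP [trP bP]] := PP.
have TT0 : 0 < (T + 1) * T by rewrite mulr_gt0// addr_gt0.
have cp1 : 0 < cp + 1 by rewrite addr_gt0.
(* The first summand serves the velocity and the second the pressure, for which the Poincare
   inequality on [Q] bounds the [H^1] norm by [cp + 1] times the gradient norm. *)
exists ((T + 1) * T + (cp + 1)); first by rewrite addr_gt0.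
move=> eps u p eps0 [Hu Hp mom cont [tr bc]].
pose D := dual_norm Omega Q (pairing Omega (divergence u_PP)); rewrite -/D.
have L2PP := L2_divergence dom HuP; have L2u := L2_divergence dom Hu.
have D0 : 0 <= D by exact: (dual_norm_ge0 dom Qc Qp L2PP).
have Qr : Q (p - p_PP).
  (* The lift [p_b] cancels, and the difference is a combination of the form under which [Q] is
     closed. *)
  have -> : p - p_PP = (-1) *: (p_PP - p_b) + (p - p_b).
    by rewrite scaleN1r opprB [RHS]addrC addrA subrK.
  exact: Ql.
have Hr := QH _ Qr; have [r1 r2] := H1_L2 Hr.
have Hw j : H1 Omega ((u - u_PP) j) by exact: (H1_B oO bO (Hu j) (HuP j)).
have H0w j : H10 Omega ((u - u_PP) j).
  apply: (H10_small_trace k0 dom (Hw j)).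
  exact: (small_trace_B _ (Hu j) (HuP j) (tr j) (trP j)).
have eqm := momentum_difference dom mom momP Hu HuP Hp HpP H0w.
have eqc : eps * grad_norm Omega (p - p_PP) ^+ 2 + ip (divergence (u - u_PP)) (p - p_PP).1 =
    - pairing Omega (divergence u_PP) (p - p_PP).
  have -> : grad_norm Omega (p - p_PP) ^+ 2 =
      grad_pairing Omega p (p - p_PP) - grad_pairing Omega p_PP (p - p_PP).
    rewrite grad_norm_sq (grad_pairing_sum dom Hp Hr) (grad_pairing_sum dom HpP Hr) -sumrB.
    apply: eq_bigr => i _; rewrite nrm_ip.
    exact: (ipBl mO ((H1_L2 Hp).2 i) ((H1_L2 HpP).2 i) (r2 i)).
  have -> : ip (divergence (u - u_PP)) (p - p_PP).1 =
      pairing Omega (divergence u) (p - p_PP) - pairing Omega (divergence u_PP) (p - p_PP).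
    rewrite -[RHS](ipBl mO L2u L2PP r1); apply: eq_ip => // x _.
    by rewrite /divergence -sumrB.
  by rewrite mulrBr (contP _ Qr) addrACA (cont _ Qr) addrA subrr add0r.
have [rho hv] := energy_estimate dom eps0 D0 H0w Hr hT T0 eqm eqc (dual_norm_bound dom Qc Qp L2PP Qr).
have De : 0 <= D / eps by rewrite divr_ge0// ltW.
rewrite (mulrAC _ _ D) -mulrA; split.
  apply: le_trans hv _; rewrite ler_wpM2r//.
  by rewrite lerDl ltW.
apply: (@le_trans _ _ ((cp + 1) * (D / eps))); last first.
  by rewrite ler_wpM2r// lerDr ltW.
apply: (@le_trans _ _ ((cp + 1) * grad_norm Omega (p - p_PP))); last by rewrite ler_pM2l.
have g0 := grad_norm_ge0 Omega (p - p_PP).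
have cg := mulr_ge0 (ltW cp1) g0.
rewrite -(ler_pXn2r (n := 2)) ?nnegrE ?h1norm_ge0// h1norm_sq.
have h := hcp _ Qr; have nz : 0 <= nrm (p - p_PP).1 by exact: nrm_ge0.
rewrite -[l2norm _ _]/(nrm _) in h.
move: (grad_norm _ _) (nrm _) h g0 cg nz => g m h g0 cg nz.
have := lerXn2r 2 (nz : m \in Num.nneg) (mulr_ge0 (ltW cp0) g0 : cp * g \in Num.nneg) h.
by have := mulr_ge0 (ltW cp0) (sqr_ge0 g); nra.
Qed.

End error_estimate.

Lemma cvg0_le_inv (R : realType) (f : R -> R) (C : R) :
  (forall eps, 0 < eps -> 0 <= f eps <= C / eps) -> f eps @[eps --> +oo] --> 0.
Proof.
move=> hf; apply/cvgrPdist_le => e e0.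
have E : \forall t \near +oo, C / e <= t by exact: nbhs_pinfty_ge (num_real _).
have E0 : \forall t \near +oo, (0 : R) < t by exact: nbhs_pinfty_gt.
apply: filterS2 E E0 => t.
move=> + t0; have /andP[f0 fC] := hf t t0.
rewrite ler_pdivrMr// sub0r normrN ger0_norm// => h; apply: le_trans fC _.
by rewrite ler_pdivrMr// mulrC.
Qed.

Theorem theorem3p2 (R : realType) (n : nat) (n_ge2 : (2 <= n)%N)
    (Omega : set 'rV[R]_n) (Omega_dom : bounded_lipschitz_domain Omega)
    (nu : 'rV[R]_n -> 'rV[R]_n) (nu_normal : outward_unit_normal Omega nu)
    (Q : set (sobolev R n)) (Q_closed : closed_subspace Omega Q)
    (Q_poincare : poincare Omega Q)
    (F : 'I_n -> 'rV[R]_n -> R)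
    (F_L2 : forall j, L2 (lebesgue_row R n) Omega (F j))
    (u_b : 'I_n -> 'rV[R]_n -> R) (u_b_H12 : forall j, H12 Omega (u_b j))
    (u_b_flux : \int[surface_measure R n]_(x in boundary Omega)
                  (\sum_j u_b j x * nu x ord0 j) = 0)
    (p_b : sobolev R n) (p_b_H1 : H1 Omega p_b)
    (G : sobolev R n -> R) (G_dual : dual Omega Q G)
    (u_PP : 'I_n -> sobolev R n) (p_PP : sobolev R n)
    (PP : PP_solution Omega Q F u_b p_b G u_PP p_PP)
    (u_ : R -> 'I_n -> sobolev R n) (p_ : R -> sobolev R n)
    (ES : forall eps : R, 0 < eps ->
            ES_solution Omega Q F u_b p_b G eps (u_ eps) (p_ eps)) :
  (exists2 c : R, 0 < c & forall eps : R, 0 < eps ->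
     h1vnorm Omega (u_ eps - u_PP) <=
       c / eps * dual_norm Omega Q (pairing Omega (divergence u_PP)) /\
     h1norm Omega (p_ eps - p_PP) <=
       c / eps * dual_norm Omega Q (pairing Omega (divergence u_PP))) /\
  h1vnorm Omega (u_ eps - u_PP) @[eps --> +oo] --> 0 /\
  h1norm Omega (p_ eps - p_PP) @[eps --> +oo] --> 0.
Proof.
case: n n_ge2 Omega Omega_dom nu nu_normal Q Q_closed Q_poincare F F_L2 u_b u_b_H12 u_b_flux
  p_b p_b_H1 G G_dual u_PP p_PP PP u_ p_ ES => // k k1 O dom _ _ Q' Qc Qp F' _ ub _ _ pb _ G' _
  uP pP PP' u p ES'.
(* The dimension is [k.+1 >= 2], so the boundary has dimension [k > 0], as the tube estimate
   requires. *)
have k0 : (0 < k)%N by [].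
have [c c0 hc] := error_estimate k0 dom Qc Qp PP'.
pose D := dual_norm O Q' (pairing O (divergence uP)).
split; first by exists c => // eps eps0; exact: hc (ES' eps eps0).
split; apply: (@cvg0_le_inv _ _ (c * D)) => eps eps0.
all: have [h1 h2] := hc _ _ _ eps0 (ES' eps eps0).
  by rewrite sqrtr_ge0 mulrAC.
by rewrite h1norm_ge0 mulrAC.
Qed.
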